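(* Let $G$ be a graph that does not contain infinitely many pairwise vertex-disjoint rays, let $\Psi$ be a set of ends of $G$, and suppose the $\Psi$-system $M=M(G,\Psi)=(E(G),\mathcal{L})$ is a matroid. Then $M$ is $k$-nearly finitary for some $k\in\mathbb{N}$.
   Context: A ray is a one-way infinite path; two rays are equivalent if for every finite set $S$ of vertices they have tails in the same component of $G-S$; an end is an equivalence class, and $\Omega(G)$ is the set of ends. The space $|G|$ has underlying set $V(G)\sqcup\Omega(G)\sqcup (0,1)\times E(G)$ (edges realized as unit intervals between their endvertices), with topology given by: metric $\epsilon$-balls ($\epsilon\le 1$) around vertices and around interior points of edges, and, for an end $\omega$ and a finite vertex set $S$, the basic open set $\hat C(S,\omega)$ consisting of the component $C(S,\omega)$ of $G-S$ containing a ray of $\omega$, together with all vertices and interior points of edges in or incident with it and all ends represented by rays in it. For $\Psi\subseteq\Omega(G)$ let $|G|_\Psi=|G|\setminus(\Omega(G)\setminus\Psi)$, regarded with vertex set $V(G)\cup\Psi$ and edge set $E(G)$. Declare two points $v,v'$ of $V(G)\cup\Psi$ equivalent if every partition of $V(G)\cup\Psi$ into two disjoint open subsets of $|G|_\Psi$ puts $v,v'$ in the same part, and let $\tilde G_\Psi$ be the quotient. The $\Psi$-system $M(G,\Psi)$ has ground set $E(G)$, and a set of edges is independent iff it contains no set of the form $\{e\in E(G): \text{the interior of } e \subseteq C\}$ with $C$ a topological circle (homeomorphic image of $S^1$) in $\tilde G_\Psi$. Matroid axioms: $\emptyset$ independent; subsets of independent sets independent; if $B$ is maximal and $A$ non-maximal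 independent then $A\cup\{b\}$ independent for some $b\in B\setminus A$; for independent $A\subseteq X\subseteq E$ a maximal independent $S$ with $A\subseteq S\subseteq X$ exists. Bases are maximal independent sets; $M^{\mathrm{fin}}$ has as independent sets the sets all of whose finite subsets are independent in $M$; $M$ is $k$-nearly finitary if $|F\setminus B|\le k$ whenever a base $F$ of $M^{\mathrm{fin}}$ contains a base $B$ of $M$. *)

(* Defs.v *)
From Stdlib Require Import Reals List Arith Relations.
Open Scope R_scope.

Set Implicit Arguments.

Record graph := Graph {
  V : Type;
  E : Type;
  src : E -> V;                 (* endpoint at parameter 0 *)
  tgt : E -> V;                 (* endpoint at parameter 1 *)
  no_loop : forall e, src e <> tgt e;
  no_parallel : forall e f,
    (src e = src f /\ tgt e = tgt f) \/ (src e = tgt f /\ tgt e = src f) -> e = f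
}.

Arguments src {g} e.
Arguments tgt {g} e.

Section G.
Variable G : graph.

Definition incident (e : E G) (v : V G) : Prop := src e = v \/ tgt e = v.

Definition adjacent (u w : V G) : Prop :=
  exists e : E G, (src e = u /\ tgt e = w) \/ (src e = w /\ tgt e = u).

Definition finite_set (T : Type) (S : T -> Prop) : Prop :=
  exists l : list T, forall x, S x -> In x l.

Record ray := Ray {
  rv : nat -> V G;
  rv_inj : forall n m, rv n = rv m -> n = m;
  rv_adj : forall n, adjacent (rv n) (rv (S n))
}.

Definition connS (S : V G -> Prop) (u w : V G) : Prop :=
  ~ S u /\ ~ S w /\
  clos_refl_trans (V G) (fun a b => adjacent a b /\ ~ S a /\ ~ S b) u w.

Definition tail_avoids (r : ray) (n : nat) (S : V G -> Prop) : Prop :=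
  forall k, (n <= k)%nat -> ~ S (rv r k).

Definition ray_equiv (r r' : ray) : Prop :=
  forall S : V G -> Prop, finite_set S ->
    exists n m, tail_avoids r n S /\ tail_avoids r' m S /\ connS S (rv r n) (rv r' m).

Definition is_end (A : ray -> Prop) : Prop :=
  exists r, forall r', A r' <-> ray_equiv r r'.

Inductive point :=
| PV : V G -> point
| PO : (ray -> Prop) -> point
| PE : E G -> R -> point.   (* PE e t : the point at parameter t of edge e *)

Definition valid (x : point) : Prop :=
  match x with
  | PV _ => True
  | PO A => is_end A
  | PE _ t => 0 < t < 1
  end.

(* metric eps-ball around vertex v (0 < eps <= 1) *)
Definition vball (v : V G) (eps : R) : point -> Prop := fun x =>
  match x with
  | PV w => w = v
  | PO _ => False
  | PE f s => 0 < s < 1 /\ ((src f = v /\ s < eps) \/ (tgt f = v /\ 1 - s < eps))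
  end.

(* metric eps-ball around the inner point of e at parameter t (0 < eps <= 1) *)
Definition eball (e : E G) (t eps : R) : point -> Prop := fun x =>
  (exists s, x = PE e s /\ 0 < s < 1 /\ Rabs (s - t) < eps)
  \/ (t < eps /\ vball (src e) (eps - t) x)
  \/ (1 - t < eps /\ vball (tgt e) (eps - (1 - t)) x).

Definition comp (S : V G -> Prop) (u : V G) : V G -> Prop := fun w => connS S u w.

Definition hatC (C : V G -> Prop) : point -> Prop := fun x =>
  match x with
  | PV w => C w
  | PO A => is_end A /\ exists r, A r /\ forall n, C (rv r n)
  | PE f s => 0 < s < 1 /\ (C (src f) \/ C (tgt f))
  end.

Definition basic_open (B : point -> Prop) : Prop :=
  (exists v eps, 0 < eps <= 1 /\ forall x, B x <-> vball v eps x)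
  \/ (exists e t eps, 0 < t < 1 /\ 0 < eps <= 1 /\ forall x, B x <-> eball e t eps x)
  \/ (exists (S : V G -> Prop) (A : ray -> Prop) (r : ray) (n : nat),
        finite_set S /\ is_end A /\ A r /\ tail_avoids r n S /\
        forall x, B x <-> hatC (comp S (rv r n)) x).

Definition openG (U : point -> Prop) : Prop :=
  (forall x, U x -> valid x) /\
  forall x, U x -> exists B, basic_open B /\ B x /\ forall y, B y -> U y.

Variable Psi : (ray -> Prop) -> Prop.

Definition inGPsi (x : point) : Prop :=
  valid x /\ match x with PO A => Psi A | _ => True end.

Definition openPsi (W : point -> Prop) : Prop :=
  exists U, openG U /\ forall x, W x <-> (U x /\ inGPsi x).

Definition VPsi (x : point) : Prop :=
  match x with PV _ => True | PO A => is_end A /\ Psi A | PE _ _ => False end.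

Definition psi_equiv (x y : point) : Prop :=
  forall O1 O2, openPsi O1 -> openPsi O2 ->
    (forall z, O1 z -> O2 z -> False) ->
    (forall z, VPsi z -> O1 z \/ O2 z) ->
    (O1 x <-> O1 y).

Definition eqPsi (x y : point) : Prop :=
  x = y \/ (VPsi x /\ VPsi y /\ psi_equiv x y).

Definition qclass (x : point) : point -> Prop := fun y => inGPsi y /\ eqPsi x y.

Definition is_qpoint (c : point -> Prop) : Prop :=
  exists x, inGPsi x /\ c = qclass x.

Definition openQ (U : (point -> Prop) -> Prop) : Prop :=
  (forall c, U c -> is_qpoint c) /\
  openPsi (fun x => inGPsi x /\ U (qclass x)).

Definition S1 (p : R * R) : Prop := fst p * fst p + snd p * snd p = 1.

Definition dist2 (p q : R * R) : R :=
  (fst p - fst q) * (fst p - fst q) + (snd p - snd q) * (snd p - snd q).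

Definition openS1 (W : R * R -> Prop) : Prop :=
  (forall p, W p -> S1 p) /\
  forall p, W p -> exists eps, 0 < eps /\
    forall q, S1 q -> dist2 p q < eps * eps -> W q.

Definition is_circle (C : (point -> Prop) -> Prop) : Prop :=
  exists f : R * R -> (point -> Prop),
    (forall p, S1 p -> is_qpoint (f p)) /\
    (forall p q, S1 p -> S1 q -> f p = f q -> p = q) /\
    (forall c, C c <-> exists p, S1 p /\ f p = c) /\
    (forall U, openQ U -> openS1 (fun p => S1 p /\ U (f p))) /\
    (forall W, openS1 W -> exists U, openQ U /\
        forall c, (exists p, W p /\ f p = c) <-> (U c /\ C c)).

Definition circle_edges (C : (point -> Prop) -> Prop) : E G -> Prop :=
  fun e => forall t, 0 < t < 1 -> C (qclass (PE e t)).

Definition psi_indep (I : E G -> Prop) : Prop :=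
  ~ exists C, is_circle C /\ forall e, circle_edges C e -> I e.

End G.

Section Matroid.
Variable T : Type.
Variable indep : (T -> Prop) -> Prop.

Definition subset (A B : T -> Prop) := forall x, A x -> B x.

Definition maximal_in (ind : (T -> Prop) -> Prop) (X S : T -> Prop) : Prop :=
  ind S /\ subset S X /\
  forall S', ind S' -> subset S S' -> subset S' X -> subset S' S.

Definition maximal_indep_in (X S : T -> Prop) : Prop := maximal_in indep X S.

Definition is_base (B : T -> Prop) : Prop := maximal_indep_in (fun _ => True) B.

Definition is_matroid : Prop :=
  indep (fun _ => False) /\
  (forall A B, indep B -> subset A B -> indep A) /\
  (forall A B, indep A -> ~ is_base A -> is_base B ->
     exists b, B b /\ ~ A b /\ indep (fun x => A x \/ x = b)) /\
  (forall A X, indep A -> subset A X ->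
     exists S, subset A S /\ maximal_indep_in X S).

Definition fin_indep (I : T -> Prop) : Prop :=
  forall F, subset F I -> finite_set F -> indep F.

Definition nearly_finitary (k : nat) : Prop :=
  forall F B, maximal_in fin_indep (fun _ => True) F ->
    is_base B -> subset B F ->
    exists l : list T, (length l <= k)%nat /\
      forall x, F x -> ~ B x -> In x l.
End Matroid.

Definition inf_disjoint_rays (G : graph) : Prop :=
  exists R : nat -> ray G,
    forall i j, i <> j -> forall n m, rv (R i) n <> rv (R j) m.

(* Main.v *)
(** Let [B] be a base of [M] inside a base [F] of [M^fin]. By Halin's theorem the numbers of disjoint
rays are bounded by some [k]; in particular there are at most [k] ends. Finite cycles of the quotient
of the graph are circles, so [F] is a forest in that quotient. Choose a maximal family of disjoint rays
in [F]. Attach the rays to their ends one at a time: if attaching a ray closes a cycle, the connection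
between the ray and its end leaves the ray for the last time at some vertex, and deleting the edge of the
ray that follows this vertex breaks the cycle. This deletes at most [k] edges and leaves a set [I] that is
still a forest once its rays are joined to their ends. For each [e] in [I] a topological cut meets [I] only
in [e]: separate the finitely many ends as the two sides of [I - e] prescribe, and move the components of
[I - e] that cross to one side; by a star-comb argument none of them comes close to an end of the other
side. A circle minus a point is connected, so it does not meet a cut in exactly one edge. Hence [I] is
independent, and base exchange carries the bound from [F - I] to [F - B]. *)

Require Import Defs.
From Stdlib Require Import Reals List Arith Lia Lra Relations Classical ClassicalEpsilon
  FunctionalExtensionality PropExtensionality.
Set Implicit Arguments.
Open Scope nat_scope.

(** A set without finite circuits can still be dependent: a double ray with both tails in one end of
    [Psi] closes up to a circle. Joining rays to their ends makes such circles visible as ordinary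
    cycles. A maximal family is enough for this, because every other ray of the set meets one of its
    members infinitely often. Circles are never analysed beyond having three points, having no
    isolated point and staying connected when a point is removed; only finite circuits are ever
    shown to be circles. The topology of vertices and ends enters the graph arguments only through
    [cut], a combinatorial form of an open bipartition. The base [B] is arbitrary and has no visible
    structure. So the bound is proved for the constructed set [I], and exchange carries it to [B]
    one element at a time. The resulting [k] depends on the graph alone, not on [Psi]. *)

Lemma adjacent_sym (G : graph) (u w : V G) : adjacent G u w -> adjacent G w u.
Proof. intros [e H]; exists e; tauto. Qed.

(** * Counting in finite lists *)

Definition filterP {A : Type} (P : A -> Prop) (l : list A) : list A :=
  filter (fun x => if excluded_middle_informative (P x) then true else false) l.

Lemma filterP_In {A : Type} (P : A -> Prop) l x : In x (filterP P l) <-> In x l /\ P x.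
Proof.
  unfold filterP; rewrite filter_In.
  destruct (excluded_middle_informative (P x)); intuition discriminate.
Qed.

Lemma filterP_NoDup {A : Type} (P : A -> Prop) l : NoDup l -> NoDup (filterP P l).
Proof. apply NoDup_filter. Qed.

Lemma filterP_length {A : Type} (P : A -> Prop) l :
  length l = length (filterP P l) + length (filterP (fun x => ~ P x) l).
Proof.
  unfold filterP; induction l as [|a l IH]; simpl; [reflexivity|].
  destruct (excluded_middle_informative (P a)), (excluded_middle_informative (~ P a));
    simpl; try tauto; lia.
Qed.

Lemma pigeonhole {A B : Type} (r : A -> B -> Prop) (l1 : list A) (l2 : list B) :
  NoDup l1 -> (forall a, In a l1 -> exists b, In b l2 /\ r a b) ->
  (forall a a' b, r a b -> r a' b -> a = a') -> length l1 <= length l2.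
Proof.
  revert l2; induction l1 as [|a l1 IH]; intros l2 Hnd Hex Hinj; simpl; [lia|].
  inversion Hnd as [|? ? Ha Hnd']; subst.
  destruct (Hex a (or_introl eq_refl)) as (b & Hb & Hab).
  apply in_split in Hb as (l & l' & ->).
  rewrite length_app; simpl.
  enough (length l1 <= length (l ++ l')) by (rewrite length_app in *; lia).
  apply IH; auto.
  intros a' Ha'. destruct (Hex a' (or_intror Ha')) as (b' & Hb' & Hab').
  exists b'; split; auto.
  rewrite in_app_iff in *; simpl in Hb'.
  destruct Hb' as [|[<-|]]; auto.
  exfalso; apply Ha; rewrite (Hinj a a' b); auto.
Qed.

Definition disjoint_rays {G : graph} (r r' : ray G) : Prop := forall n m, rv r n <> rv r' m.

Lemma disjoint_rays_sym {G : graph} (r r' : ray G) : disjoint_rays r r' -> disjoint_rays r' r.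
Proof. intros H n m E; exact (H m n (eq_sym E)). Qed.

Definition disjoint_family {G : graph} (n : nat) (R : nat -> ray G) : Prop :=
  forall i j, i < n -> j < n -> i <> j -> disjoint_rays (R i) (R j).

(** * Stable matchings of two ray systems *)

Section Matching.
Variables (G : graph) (R Q : nat -> ray G) (men women : list nat) (start : nat).
Hypothesis men_nodup : NoDup men.
Hypothesis Q_disjoint : forall j j', In j women -> In j' women -> j <> j' ->
  disjoint_rays (Q j) (Q j').

Definition at_woman (i t j q : nat) : Prop := In j women /\ rv (R i) t = rv (Q j) q.

(* Gale-Shapley: man [i] proposes along [R i], currently at vertex [p i], to the rays [Q j] met there;
   [Q j] prefers late vertices. [dominated] says that no proposal so far beats all current ones. *)
Definition dominated (p : nat -> nat) : Prop :=
  forall i t j q, In i men -> start <= t <= p i -> at_woman i t j q ->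
    exists i' q', In i' men /\ q <= q' /\ at_woman i' (p i') j q'.

Definition accepted (p : nat -> nat) (i j q : nat) : Prop :=
  at_woman i (p i) j q /\
  forall i' q', In i' men -> at_woman i' (p i') j q' -> q' <= q.

Lemma at_woman_unique i t j q j' q' : at_woman i t j q -> at_woman i t j' q' -> j = j' /\ q = q'.
Proof.
  intros [Hj H] [Hj' H'].
  destruct (Nat.eq_dec j j') as [<-|N].
  - split; auto. apply (rv_inj (Q j)); congruence.
  - exfalso; apply (Q_disjoint Hj Hj' N q q'); congruence.
Qed.

Definition bump (p : nat -> nat) (i : nat) : nat -> nat :=
  fun k => if Nat.eq_dec k i then S (p i) else p k.

Lemma bump_same p i : bump p i i = S (p i).
Proof. unfold bump; destruct (Nat.eq_dec i i); congruence. Qed.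

Lemma bump_other p i k : k <> i -> bump p i k = p k.
Proof. unfold bump; destruct (Nat.eq_dec k i); congruence. Qed.

(** If the dominating proposal is that of the rejected [i] himself, somebody else stands at a later
    vertex of the same ray, as otherwise [i] would be accepted. So [i] may step on without harming
    [dominated]. *)
Lemma rejected_witness p i j q i0 q0 :
  ~ (exists j q, accepted p i j q) ->
  In i0 men -> q <= q0 -> at_woman i0 (p i0) j q0 ->
  exists i' q', i' <> i /\ In i' men /\ q <= q' /\ at_woman i' (p i') j q'.
Proof.
  intros Hrej Hi0 Hq Hat.
  destruct (Nat.eq_dec i0 i) as [->|N]; [|exists i0, q0; auto].
  apply NNPP; intros Hno; apply Hrej; exists j, q0; split; auto.
  intros i' q' Hi' Hat'.
  destruct (Nat.eq_dec i' i) as [->|N'].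
  - destruct (at_woman_unique Hat Hat'); lia.
  - destruct (le_lt_dec q' q0); auto.
    exfalso; apply Hno; exists i', q'; repeat split; try apply Hat'; auto; lia.
Qed.

Lemma dominated_bump p i : In i men -> dominated p -> ~ (exists j q, accepted p i j q) ->
  dominated (bump p i).
Proof.
  intros Hi Hdom Hrej k t j q Hk Ht Hat.
  assert (Hold : start <= t <= p k ->
    exists i' q', In i' men /\ q <= q' /\ at_woman i' (bump p i i') j q').
  { intros Ht'. destruct (Hdom k t j q Hk Ht' Hat) as (i0 & q0 & Hi0 & Hq0 & Hat0).
    destruct (@rejected_witness p i j q i0 q0 Hrej Hi0 Hq0 Hat0) as (i' & q' & N & H1 & H2 & H3).
    exists i', q'; rewrite bump_other; auto. }
  destruct (Nat.eq_dec k i) as [->|N].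
  - rewrite bump_same in Ht. destruct (Nat.eq_dec t (S (p i))) as [->|N'].
    + exists i, q; rewrite bump_same; auto.
    + apply Hold; lia.
  - rewrite bump_other in Ht by auto; auto.
Qed.

Definition meets_many (T : nat -> nat) : Prop :=
  forall i, In i men -> exists l, NoDup l /\ length l >= length men /\
    forall j, In j l -> exists t q, start <= t <= T i /\ at_woman i t j q.

(** By time [T i] the man [i] has met at least [length men] women. Were he still rejected, each of
    them would be held by some other man, and a man stands at one woman at a time: there are too few
    men. *)
Lemma rejected_bound T p i : meets_many T -> In i men -> dominated p ->
  ~ (exists j q, accepted p i j q) -> p i < T i.
Proof.
  intros HT Hi Hdom Hrej.
  destruct (le_lt_dec (T i) (p i)) as [Hle|]; auto. exfalso.
  destruct (HT i Hi) as (l & Hnd & Hlen & Hl).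
  apply in_split in Hi as Hs; destruct Hs as (m1 & m2 & Em).
  assert (H : length l <= length (m1 ++ m2)).
  { apply (@pigeonhole _ _ (fun j i' => exists q, at_woman i' (p i') j q)); auto.
    - intros j Hj. destruct (Hl j Hj) as (t & q & Ht & Hat).
      destruct (Hdom i t j q Hi) as (i0 & q0 & Hi0 & Hq0 & Hat0); [lia|auto|].
      destruct (@rejected_witness p i j q i0 q0 Hrej Hi0 Hq0 Hat0) as (i' & q' & N & H1 & H2 & H3).
      exists i'; split; [|exists q'; auto].
      rewrite Em, in_app_iff in H1; simpl in H1. rewrite in_app_iff.
      destruct H1 as [|[|]]; auto; congruence.
    - intros j j' i' [q H] [q' H']. exact (proj1 (at_woman_unique H H')). }
  rewrite Em in Hlen; rewrite length_app in *; simpl in Hlen; lia.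
Qed.

Definition potential (T p : nat -> nat) (l : list nat) : nat :=
  list_sum (map (fun i => T i - p i) l).

Lemma potential_notin T p i l : ~ In i l -> potential T (bump p i) l = potential T p l.
Proof.
  intros H; unfold potential; f_equal; apply map_ext_in.
  intros k Hk; rewrite bump_other; auto. intros ->; auto.
Qed.

Lemma potential_bump T p i l : NoDup l -> In i l -> p i < T i ->
  potential T (bump p i) l < potential T p l.
Proof.
  intros Hnd Hi Hlt. induction Hnd as [|a l Ha Hnd IH]; [destruct Hi|].
  unfold potential in *; simpl in *.
  destruct (Nat.eq_dec a i) as [->|N].
  - rewrite bump_same. pose proof (@potential_notin T p i l Ha) as E; unfold potential in E. lia.
  - rewrite bump_other by auto. destruct Hi; [congruence|]. specialize (IH H); lia.
Qed.

(** A rejected man is still short of [T i], so advancing him lowers [potential]. The second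
    hypothesis makes [dominated] vacuous at the start. *)
Lemma stable_matching T : meets_many T ->
  (forall i j q, In i men -> ~ at_woman i start j q) ->
  exists p, (forall i, In i men -> start <= p i) /\ dominated p /\
    forall i, In i men -> exists j q, accepted p i j q.
Proof.
  intros HT Hstart.
  assert (H : forall n p, potential T p men <= n -> (forall i, In i men -> start <= p i) ->
    dominated p -> exists p, (forall i, In i men -> start <= p i) /\ dominated p /\
    forall i, In i men -> exists j q, accepted p i j q).
  { intros n; induction n as [|n IH]; intros p Hn Hp Hdom;
      (destruct (classic (forall i, In i men -> exists j q, accepted p i j q)) as [Hall|Hno];
       [exists p; auto|]);
      apply not_all_ex_not in Hno as [i Hi]; apply imply_to_and in Hi as [Hi Hrej];
      pose proof (rejected_bound HT Hi Hdom Hrej) as Hlt;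
      pose proof (@potential_bump T p i men men_nodup Hi Hlt) as Hdec; [lia|].
    apply (IH (bump p i)); [lia| |apply dominated_bump; auto].
    intros k Hk. destruct (Nat.eq_dec k i) as [->|N].
    - rewrite bump_same. specialize (Hp i Hi); lia.
    - rewrite bump_other; auto. }
  apply (H _ (fun _ => start) (le_n _)); [auto|].
  intros i t j q Hi Ht Hat. exfalso.
  apply (Hstart i j q Hi). replace start with t by lia; auto.
Qed.

End Matching.

(** * Choice principles, rerouting of rays and Halin's theorem *)

Lemma choice_fun {A B : Type} (r : A -> B -> Prop) :
  (forall a, exists b, r a b) -> exists f, forall a, r a (f a).
Proof.
  intros H. exists (fun a => proj1_sig (constructive_indefinite_description _ (H a))).
  intros a. apply (proj2_sig (constructive_indefinite_description _ (H a))).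
Qed.

Lemma bound_on_list {A : Type} (P : A -> nat -> Prop) (l : list A) :
  (forall a n m, n <= m -> P a n -> P a m) ->
  (forall a, In a l -> exists n, P a n) -> exists n, forall a, In a l -> P a n.
Proof.
  intros Hmon; induction l as [|a l IH]; intros H; [exists 0; intros ? []|].
  destruct IH as [n Hn]; [intros; apply H; simpl; auto|].
  destruct (H a (or_introl eq_refl)) as [m Hm].
  exists (n + m); intros b [<-|Hb]; [apply (Hmon _ m)|apply (Hmon _ n)]; auto; lia.
Qed.

Lemma splice_rays {G : graph} (r s : ray G) (p q : nat) : rv r p = rv s q ->
  (forall t m, t <= p -> q < m -> rv r t <> rv s m) ->
  exists r' : ray G, (forall t, t <= p -> rv r' t = rv r t) /\
    forall t, p < t -> rv r' t = rv s (q + (t - p)).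
Proof.
  intros E H.
  set (f := fun t => if le_lt_dec t p then rv r t else rv s (q + (t - p))).
  assert (Hinj : forall n m, f n = f m -> n = m).
  { intros n m; unfold f; destruct (le_lt_dec n p), (le_lt_dec m p); intros F.
    - apply (rv_inj r); auto.
    - exfalso; apply (H n (q + (m - p))); auto; lia.
    - exfalso; apply (H m (q + (n - p))); auto; lia.
    - apply rv_inj in F; lia. }
  assert (Hadj : forall n, adjacent G (f n) (f (S n))).
  { intros n; unfold f; destruct (le_lt_dec n p), (le_lt_dec (S n) p); try lia.
    - apply rv_adj.
    - replace n with p by lia. rewrite E.
      replace (q + (S p - p)) with (S q) by lia. apply rv_adj.
    - replace (q + (S n - p)) with (S (q + (n - p))) by lia. apply rv_adj. }
  exists (Ray f Hinj Hadj); simpl; unfold f; split; intros t Ht;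
    destruct (le_lt_dec t p); auto; lia.
Qed.

(** A man related to fewer than [k] women is discarded together with these women. Each discard costs
    fewer than [k] women, so at least [a] survive, and discarded men are related to no survivor. *)
Lemma thin_out (r : nat -> nat -> Prop) (a k : nat) (men women : list nat) :
  NoDup men -> NoDup women -> a + k * length men <= length women ->
  exists men' women', NoDup men' /\ incl men' men /\ NoDup women' /\ incl women' women /\
    a <= length women' /\
    (forall i j, In i men -> ~ In i men' -> In j women' -> ~ r i j) /\
    (forall i, In i men' -> exists l, NoDup l /\ k <= length l /\ incl l women' /\
      forall j, In j l -> r i j).
Proof.
  remember (length men) as n eqn:En. revert men women En.
  induction n as [|n IH]; intros men women En Hm Hw Hlen.
  - destruct men; [|discriminate]. exists nil, women.
    repeat split; auto using incl_refl; try lia; intros ? [].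
  - destruct (classic (forall i, In i men -> k <= length (filterP (r i) women))) as [Hall|Hno].
    { exists men, women. repeat split; auto using incl_refl; try lia; try tauto.
      intros i Hi; exists (filterP (r i) women); repeat split; auto using filterP_NoDup.
      - intros j Hj; apply filterP_In in Hj; tauto.
      - intros j Hj; apply filterP_In in Hj; tauto. }
    apply not_all_ex_not in Hno as [i Hi]; apply imply_to_and in Hi as [Hi Hlt].
    apply in_split in Hi as (m1 & m2 & ->).
    pose proof (filterP_length (r i) women) as Hfl.
    apply NoDup_remove in Hm as [Hm Hi].
    rewrite length_app in En; simpl in En.
    destruct (IH (m1 ++ m2) (filterP (fun j => ~ r i j) women))
      as (men' & women' & H1 & H2 & H3 & H4 & H5 & H6 & H7); auto using filterP_NoDup.
    { rewrite length_app; lia. } { nia. }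
    exists men', women'. repeat split; auto.
    + intros x Hx; apply H2 in Hx; rewrite in_app_iff in *; simpl; tauto.
    + intros x Hx; apply H4 in Hx; apply filterP_In in Hx; tauto.
    + intros i' j Hi' Hn Hj.
      rewrite in_app_iff in Hi'; simpl in Hi'.
      destruct (Nat.eq_dec i' i) as [->|N].
      * apply H4 in Hj; apply filterP_In in Hj; tauto.
      * apply H6; auto. rewrite in_app_iff; destruct Hi' as [|[|]]; auto; congruence.
Qed.

Definition arbitrarily_many_rays (G : graph) : Prop :=
  forall n, exists R : nat -> ray G, disjoint_family n R.

(** By disjointness each vertex of [Z] spoils at most one ray. *)
Lemma rays_avoiding (G : graph) (Z : list (V G)) (n : nat) : arbitrarily_many_rays G ->
  exists (Q : nat -> ray G) (W : list nat), NoDup W /\ n <= length W /\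
    (forall j j', In j W -> In j' W -> j <> j' -> disjoint_rays (Q j) (Q j')) /\
    forall j q, In j W -> ~ In (rv (Q j) q) Z.
Proof.
  intros Hmany. destruct (Hmany (length Z + n)) as [Q HQ].
  set (hits := fun j => exists q, In (rv (Q j) q) Z).
  set (N := seq 0 (length Z + n)).
  exists Q, (filterP (fun j => ~ hits j) N).
  assert (HN : forall j, In j N <-> j < length Z + n) by (intros j; unfold N; rewrite in_seq; lia).
  assert (Hlen : length (filterP hits N) <= length Z).
  { apply (@pigeonhole _ _ (fun j v => j < length Z + n /\ exists q, rv (Q j) q = v)).
    - apply filterP_NoDup, seq_NoDup.
    - intros j Hj; apply filterP_In in Hj as [Hj [q Hq]]. apply HN in Hj.
      exists (rv (Q j) q); eauto.
    - intros j j' v [Hj [q Hq]] [Hj' [q' Hq']].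
      destruct (Nat.eq_dec j j'); auto. exfalso; apply (HQ j j' Hj Hj' n0 q q'); congruence. }
  pose proof (filterP_length hits N) as Hfl. unfold N at 1 in Hfl; rewrite length_seq in Hfl.
  repeat split.
  - apply filterP_NoDup, seq_NoDup.
  - lia.
  - intros j j' Hj Hj'; apply filterP_In in Hj as [Hj _]; apply filterP_In in Hj' as [Hj' _].
    apply HQ; apply HN; auto.
  - intros j q Hj; apply filterP_In in Hj as [_ Hj]. intros Hq; apply Hj; exists q; auto.
Qed.

(* Halin's step, with a stable matching in place of Menger's theorem: rerouting each ray at its match
   onto the matched new ray keeps the rays disjoint. *)
Lemma extend_family (G : graph) (n : nat) (R : nat -> ray G) : arbitrarily_many_rays G ->
  disjoint_family n R ->
  exists R', disjoint_family (S n) R' /\ forall i t, i < n -> t <= n -> rv (R' i) t = rv (R i) t.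
Proof.
  intros Hmany HR.
  (* The first [n + 1] vertices of each old ray are to be kept, so the new rays must avoid them. *)
  set (Z := flat_map (fun i => map (rv (R i)) (seq 0 (S n))) (seq 0 n)).
  assert (HZ : forall i t, i < n -> t <= n -> In (rv (R i) t) Z).
  { intros i t Hi Ht; unfold Z; apply in_flat_map; exists i; split; [apply in_seq; lia|].
    apply in_map, in_seq; lia. }
  (* The summand [n * n] pays for discarding up to [n] men at the cost of [n] women each; [S n]
     women remain, more than there are men. *)
  destruct (@rays_avoiding G Z (S n + n * n) Hmany) as (Q & W0 & HW0 & Hlen0 & HQ0 & HZ0).
  destruct (@thin_out (fun i j => exists t q, rv (R i) t = rv (Q j) q) (S n) n (seq 0 n) W0)
    as (men & W & Hmen & Imen & HW & IW & HlenW & Hfree & Hmeet);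
    auto using seq_NoDup; [rewrite length_seq; lia|].
  assert (Hlt : forall i, In i men -> i < n) by (intros i Hi; apply Imen, in_seq in Hi; lia).
  assert (HQ : forall j j', In j W -> In j' W -> j <> j' -> disjoint_rays (Q j) (Q j')) by auto.
  assert (HZW : forall i t j q, i < n -> t <= n -> In j W -> rv (R i) t <> rv (Q j) q).
  { intros i t j q Hi Ht Hj E. apply (HZ0 j q); auto. rewrite <- E; auto. }
  assert (Hmen_le : length men <= n).
  { rewrite <- (length_seq n 0). apply NoDup_incl_length; auto. }
  assert (HT : exists T, meets_many R Q men W n T).
  { assert (H : forall i, exists T, In i men -> exists l, NoDup l /\ length l >= length men /\
      forall j, In j l -> exists t q, n <= t <= T /\ at_woman R Q W i t j q).
    { intros i. destruct (classic (In i men)) as [Hi|]; [|exists 0; tauto].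
      destruct (Hmeet i Hi) as (l & Hnd & Hl & Il & Hr).
      destruct (@bound_on_list _ (fun j T => exists t q, n <= t <= T /\ at_woman R Q W i t j q) l)
        as [T HT].
      - intros j T T' Hle (t & q & Ht & Hat); exists t, q; split; auto; lia.
      - intros j Hj. destruct (Hr j Hj) as (t & q & E). exists t, t, q; repeat split; auto.
        destruct (le_lt_dec n t); auto. exfalso; apply (HZW i t j q); auto; lia.
      - exists T; intros _; exists l; repeat split; auto; lia. }
    apply choice_fun in H as [T HT]. exists T; intros i Hi; apply HT; auto. }
  destruct HT as [T HT].
  destruct (@stable_matching G R Q men W n Hmen HQ T HT) as (p & Hp & Hdom & Hacc).
  { intros i j q Hi [Hj E]. apply (HZW i n j q); auto. }
  (* By [dominated] every woman met so far has a current proposer, so at most [length men] women are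
     met. [W] is larger, and a woman met by nobody is the additional ray. *)
  assert (Hspare : exists w, In w W /\ forall i t q, In i men -> t <= p i -> rv (R i) t <> rv (Q w) q).
  { apply NNPP; intros Hno.
    assert (Hle : length W <= length men); [|lia].
    apply (@pigeonhole _ _ (fun j i => exists q, at_woman R Q W i (p i) j q)); auto.
    - intros w Hw. apply NNPP; intros Hn. apply Hno; exists w; split; auto.
      intros i t q Hi Ht E. apply Hn.
      destruct (Hdom i t w q Hi) as (i' & q' & Hi' & _ & Hat'); [|split; auto|eauto].
      split; auto. destruct (le_lt_dec n t); auto. exfalso; apply (HZW i t w q); auto; lia.
    - intros j j' i [q H] [q' H']. exact (proj1 (at_woman_unique HQ H H')). }
  destruct Hspare as (w & Hw & Hspare).
  (* Up to his match no man meets [Q j] beyond the accepted vertex, so the rest of [Q j] is free. *)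
  assert (Hseg : forall i j q t q', In i men -> accepted R Q men W p i j q ->
    forall k, In k men -> t <= p k -> rv (R k) t = rv (Q j) q' -> q' <= q).
  { intros i j q t q' Hi Ha k Hk Ht E. pose proof Ha as [[Hj _] Hbest].
    destruct (le_lt_dec n t) as [Hnt|Hnt]; [|exfalso; apply (HZW k t j q'); auto; lia].
    destruct (Hdom k t j q' Hk) as (i' & q'' & Hi' & Hle & Hat); [lia|split; auto|].
    specialize (Hbest _ _ Hi' Hat); lia. }
  assert (Hnew : forall i, exists r, (In i men -> exists j q, accepted R Q men W p i j q /\
      (forall t, t <= p i -> rv r t = rv (R i) t) /\
      forall t, p i < t -> rv r t = rv (Q j) (q + (t - p i))) /\
    (~ In i men -> r = if Nat.eq_dec i n then Q w else R i)).
  { intros i. destruct (classic (In i men)) as [Hi|Hi];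
      [|exists (if Nat.eq_dec i n then Q w else R i); tauto].
    destruct (Hacc i Hi) as (j & q & Ha).
    destruct (@splice_rays G (R i) (Q j) (p i) q) as (r & H1 & H2).
    - apply Ha.
    - intros t m Ht Hm E. pose proof (Hseg i j q t m Hi Ha i Hi Ht E). lia.
    - exists r; split; [intros _; exists j, q; auto|tauto]. }
  apply choice_fun in Hnew as [R' HR'].
  assert (Hw_men : ~ In n men) by (intros H; apply Hlt in H; lia).
  assert (HR'n : R' n = Q w).
  { destruct (HR' n) as [_ H]. rewrite H by auto. destruct (Nat.eq_dec n n); congruence. }
  assert (HR'k : forall i, i < n -> ~ In i men -> R' i = R i).
  { intros i Hi Hn; destruct (HR' i) as [_ H]. rewrite H by auto.
    destruct (Nat.eq_dec i n); auto; lia. }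
  assert (Hshape : forall i, i < n -> In i men -> forall t, 
    (t <= p i /\ rv (R' i) t = rv (R i) t) \/
    exists j q q', accepted R Q men W p i j q /\ q < q' /\ rv (R' i) t = rv (Q j) q').
  { intros i Hi Him t. destruct (HR' i) as [H _]. destruct (H Him) as (j & q & Ha & H1 & H2).
    destruct (le_lt_dec t (p i)); [left; auto|right].
    exists j, q, (q + (t - p i)); repeat split; try apply Ha; auto; lia. }
  assert (Hspare' : forall i, i < n -> disjoint_rays (R' i) (Q w)).
  { intros i Hi t m E. destruct (classic (In i men)) as [Him|Him].
    - destruct (Hshape i Hi Him t) as [[Ht E']|(j & q & q' & Ha & Hq & E')]; rewrite E' in E.
      + apply (Hspare i t m); auto.
      + destruct (Nat.eq_dec j w) as [->|N].
        * pose proof (proj1 Ha) as [_ E1]. apply (Hspare i (p i) q); auto.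
        * apply (HQ j w (proj1 (proj1 Ha)) Hw N q' m E).
    - rewrite HR'k in E by auto. apply (Hfree i w); eauto. apply in_seq; lia. }
  assert (Hdisj : forall i k, i < n -> k < n -> i <> k -> In i men -> disjoint_rays (R' i) (R' k)).
  { intros i k Hi Hk N Him t m E.
    destruct (classic (In k men)) as [Hkm|Hkm].
    - destruct (Hshape i Hi Him t) as [[Ht E1]|(j & q & q1 & Ha & Hq & E1)];
      destruct (Hshape k Hk Hkm m) as [[Hm E2]|(j' & q' & q2 & Ha' & Hq' & E2)];
      rewrite E1, E2 in E.
      + apply (HR i k Hi Hk N t m E).
      + pose proof (Hseg k j' q' t q2 Hkm Ha' i Him Ht E). lia.
      + pose proof (Hseg i j q m q1 Him Ha k Hkm Hm (eq_sym E)). lia.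
      + destruct (Nat.eq_dec j j') as [<-|N'].
        (* Two men accepted at the same woman would stand at the same vertex, against the
           disjointness of the old rays. *)
        * pose proof (proj2 Ha _ _ Hkm (proj1 Ha')). pose proof (proj2 Ha' _ _ Him (proj1 Ha)).
          apply (HR i k Hi Hk N (p i) (p k)).
          destruct Ha as [[_ F] _], Ha' as [[_ F'] _]. rewrite F, F'. f_equal; lia.
        * apply (HQ j j' (proj1 (proj1 Ha)) (proj1 (proj1 Ha')) N' _ _ E).
    - rewrite (HR'k k) in E by auto.
      destruct (Hshape i Hi Him t) as [[Ht E1]|(j & q & q1 & Ha & Hq & E1)]; rewrite E1 in E.
      + apply (HR i k Hi Hk N t m E).
      + apply (Hfree k j); eauto; [apply in_seq; lia|apply Ha]. }
  exists R'; split.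
  - intros i k Hi Hk N.
    destruct (Nat.eq_dec i n) as [->|Hin]; destruct (Nat.eq_dec k n) as [->|Hkn]; try lia.
    + rewrite HR'n. apply disjoint_rays_sym, Hspare'; lia.
    + rewrite HR'n. apply Hspare'; lia.
    + destruct (classic (In i men)); [apply Hdisj; auto; lia|].
      destruct (classic (In k men)); [apply disjoint_rays_sym, Hdisj; auto; lia|].
      rewrite !HR'k by (auto; lia). apply HR; lia.
  - intros i t Hi Ht. destruct (classic (In i men)) as [Him|Him].
    + destruct (HR' i) as [H _]. destruct (H Him) as (j & q & Ha & H1 & H2).
      apply H1. specialize (Hp i Him); lia.
    + rewrite HR'k; auto.
Qed.

(** Stage [n] fixes the first [n + 1] vertices of its rays for good, so the rays converge vertex by
    vertex. A common vertex of two limit rays, or a repetition in one, would already occur at a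
    finite stage. *)
Theorem halin (G : graph) : arbitrarily_many_rays G -> inf_disjoint_rays G.
Proof.
  intros Hmany.
  destruct (Hmany 0) as [R0 _].
  assert (Hstep : forall a : nat * (nat -> ray G), exists R', disjoint_family (fst a) (snd a) ->
    disjoint_family (S (fst a)) R' /\
    forall i t, i < fst a -> t <= fst a -> rv (R' i) t = rv (snd a i) t).
  { intros [n R]; simpl. destruct (classic (disjoint_family n R)) as [HR|]; [|exists R; tauto].
    destruct (extend_family Hmany HR) as [R' HR']; exists R'; auto. }
  apply choice_fun in Hstep as [next Hnext].
  set (F := fix F n := match n with 0 => R0 | S m => next (m, F m) end).
  assert (HF : forall n, disjoint_family n (F n)).
  { intros n; induction n as [|n IH]; [intros i j Hi; lia|]. apply (Hnext (n, F n)); auto. }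
  assert (Hstab : forall i t n m, i < n -> t <= n -> n <= m -> rv (F m i) t = rv (F n i) t).
  { intros i t n m Hi Ht Hle. induction Hle as [|m Hle IH]; auto.
    rewrite <- IH. apply (Hnext (m, F m)); simpl; auto; lia. }
  set (f := fun i t => rv (F (S (i + t)) i) t).
  assert (Hf : forall i t n, i + t < n -> f i t = rv (F n i) t).
  { intros i t n H; unfold f; symmetry; apply Hstab; lia. }
  assert (Hinj : forall i n m, f i n = f i m -> n = m).
  { intros i n m E. rewrite (Hf i n (S (i + n + m))), (Hf i m (S (i + n + m))) in E by lia.
    apply (rv_inj (F (S (i + n + m)) i)); auto. }
  assert (Hadj : forall i n, adjacent G (f i n) (f i (S n))).
  { intros i n. rewrite (Hf i n (S (i + S n))), (Hf i (S n) (S (i + S n))) by lia.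
    apply rv_adj. }
  exists (fun i => Ray (f i) (Hinj i) (Hadj i)); simpl.
  intros i j N n m E.
  rewrite (Hf i n (S (i + j + n + m))), (Hf j m (S (i + j + n + m))) in E by lia.
  apply (HF (S (i + j + n + m)) i j) in E; auto; lia.
Qed.

(** * Ends and their neighbourhoods *)

Lemma union_over_list {A B : Type} (P : A -> list B -> Prop) (l : list A) :
  (forall a X Y, incl X Y -> P a X -> P a Y) ->
  (forall a, In a l -> exists X, P a X) -> exists X, forall a, In a l -> P a X.
Proof.
  intros Hmon; induction l as [|a l IH]; intros H; [exists nil; intros ? []|].
  destruct IH as [X HX]; [intros; apply H; simpl; auto|].
  destruct (H a (or_introl eq_refl)) as [Y HY].
  exists (X ++ Y); intros b [<-|Hb]; [apply (Hmon _ Y)|apply (Hmon _ X)]; auto using incl_appl, incl_appr, incl_refl.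
Qed.

Section Ends.
Variable G : graph.
Implicit Types (X Y : list (V G)) (r : ray G) (u v : V G) (w : ray G -> Prop).

Definition lset X : V G -> Prop := fun v => In v X.

Lemma finite_lset X : finite_set (lset X).
Proof. exists X; auto. Qed.

Lemma connS_refl (T : V G -> Prop) u : ~ T u -> connS G T u u.
Proof. repeat split; auto. apply rt_refl. Qed.

Lemma connS_step (T : V G -> Prop) u v : adjacent G u v -> ~ T u -> ~ T v -> connS G T u v.
Proof. repeat split; auto. apply rt_step; auto. Qed.

Lemma connS_trans (T : V G -> Prop) u v x : connS G T u v -> connS G T v x -> connS G T u x.
Proof. intros (H1 & H2 & H3) (H4 & H5 & H6); repeat split; auto. eapply rt_trans; eauto. Qed.

Lemma connS_sym (T : V G -> Prop) u v : connS G T u v -> connS G T v u.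
Proof.
  intros (H1 & H2 & H3); repeat split; auto. clear H1 H2.
  induction H3 as [x y (? & ? & ?)| |x y z]; [|apply rt_refl|eapply rt_trans; eauto].
  apply rt_step; auto using adjacent_sym.
Qed.

Lemma connS_mono (T T' : V G -> Prop) u v :
  (forall x, T x -> T' x) -> connS G T' u v -> connS G T u v.
Proof.
  intros HT (H1 & H2 & H3); repeat split; auto. clear H1 H2.
  induction H3 as [x y (? & ? & ?)| |x y z]; [|apply rt_refl|eapply rt_trans; eauto].
  apply rt_step; repeat split; auto.
Qed.

Lemma tail_avoids_finite r X : exists n, tail_avoids r n (lset X).
Proof.
  destruct (@bound_on_list _ (fun v n => forall k, n <= k -> rv r k <> v) X) as [n Hn].
  - intros v n m Hle H k Hk; apply H; lia.
  - intros v _. destruct (classic (exists k, rv r k = v)) as [[k <-]|Hno].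
    + exists (S k); intros k' Hk' E. apply rv_inj in E; lia.
    + exists 0; intros k _ E; eauto.
  - exists n; intros k Hk Hin. apply (Hn _ Hin k Hk eq_refl).
Qed.

Lemma tail_avoids_conn r n m (T : V G -> Prop) : tail_avoids r n T -> n <= m ->
  connS G T (rv r n) (rv r m).
Proof.
  intros H Hle; induction Hle as [|m Hle IH].
  - apply connS_refl, H; lia.
  - eapply connS_trans; [exact IH|]. apply connS_step; [apply rv_adj| |]; apply H; lia.
Qed.

Lemma ray_equiv_refl r : ray_equiv r r.
Proof.
  intros T [X HX]. destruct (tail_avoids_finite r X) as [n Hn].
  assert (Hn' : tail_avoids r n T) by (intros k Hk Hin; apply (Hn k Hk), HX, Hin).
  exists n, n; split; [|split]; auto. apply connS_refl, Hn'; auto.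
Qed.

Lemma ray_equiv_sym r r' : ray_equiv r r' -> ray_equiv r' r.
Proof.
  intros H T HT. destruct (H T HT) as (n & m & H1 & H2 & H3).
  exists m, n; auto using connS_sym.
Qed.

Lemma ray_equiv_trans r1 r2 r3 : ray_equiv r1 r2 -> ray_equiv r2 r3 -> ray_equiv r1 r3.
Proof.
  intros H H' T HT. destruct (H T HT) as (n & m & H1 & H2 & H3).
  destruct (H' T HT) as (n' & m' & H1' & H2' & H3').
  exists n, m'; split; [|split]; auto.
  assert (F : connS G T (rv r2 m) (rv r2 n')).
  { destruct (le_ge_dec m n'); [|apply connS_sym]; apply tail_avoids_conn; auto. }
  apply (connS_trans (connS_trans H3 F) H3').
Qed.

Lemma end_mem_equiv (w : ray G -> Prop) r r' : is_end w -> w r -> (w r' <-> ray_equiv r r').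
Proof.
  intros [r0 H0] Hr. rewrite H0 in *. split; intros H.
  - eapply ray_equiv_trans; [apply ray_equiv_sym|]; eauto.
  - eapply ray_equiv_trans; eauto.
Qed.

Lemma end_eq_class (w : ray G -> Prop) r : is_end w -> w r -> w = ray_equiv r.
Proof.
  intros Hw Hr. apply functional_extensionality; intros r'.
  apply propositional_extensionality, end_mem_equiv; auto.
Qed.

Lemma is_end_class r : is_end (ray_equiv r).
Proof. exists r; tauto. Qed.

(* The vertex set of the component [C(X, w)], and below it the same set together with its neighbours. *)
Definition nb X (w : ray G -> Prop) (v : V G) : Prop :=
  exists r n, w r /\ tail_avoids r n (lset X) /\ connS G (lset X) (rv r n) v.

Definition nbN X (w : ray G -> Prop) (v : V G) : Prop :=
  exists u, nb X w u /\ (v = u \/ adjacent G u v).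

Lemma nb_mono X Y w v : incl X Y -> nb Y w v -> nb X w v.
Proof.
  intros HI (r & n & Hr & Ht & Hc). exists r, n; split; [|split]; auto.
  - intros k Hk Hin; apply (Ht k Hk), HI, Hin.
  - eapply connS_mono; [|exact Hc]. exact HI.
Qed.

Lemma nbN_mono X Y w v : incl X Y -> nbN Y w v -> nbN X w v.
Proof. intros HI (u & Hu & H); exists u; split; auto. eapply nb_mono; eauto. Qed.

Lemma nb_nbN X w v : nb X w v -> nbN X w v.
Proof. intros H; exists v; auto. Qed.

Lemma nb_notin X w v : nb X w v -> ~ In v X.
Proof. intros (r & n & _ & _ & H); apply H. Qed.

Lemma nb_conn X w u v : is_end w -> nb X w u -> nb X w v -> connS G (lset X) u v.
Proof.
  intros Hw (r & n & Hr & Ht & Hc) (r' & n' & Hr' & Ht' & Hc').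
  apply (@end_mem_equiv w r r' Hw Hr) in Hr'.
  destruct (Hr' _ (finite_lset X)) as (m & m' & Hm & Hm' & Hmm).
  assert (F : connS G (lset X) (rv r n) (rv r m)).
  { destruct (le_ge_dec n m); [|apply connS_sym]; apply tail_avoids_conn; auto. }
  assert (F' : connS G (lset X) (rv r' m') (rv r' n')).
  { destruct (le_ge_dec m' n'); [|apply connS_sym]; apply tail_avoids_conn; auto. }
  eapply connS_trans; [apply connS_sym, Hc|]. eapply connS_trans; [exact F|].
  eapply connS_trans; [exact Hmm|]. eapply connS_trans; eauto.
Qed.

Lemma nb_ext X w u v : nb X w u -> connS G (lset X) u v -> nb X w v.
Proof. intros (r & n & Hr & Ht & Hc) H. exists r, n; split; [|split]; auto.
  apply (connS_trans Hc H). Qed.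

Lemma nb_adj X w u v : nb X w u -> adjacent G u v -> ~ In v X -> nb X w v.
Proof. intros H Ha Hv. eapply nb_ext; [exact H|]. apply connS_step; auto. eapply nb_notin, H. Qed.

Lemma nbN_notin X w v : nbN X w v -> ~ In v X -> nb X w v.
Proof. intros (u & Hu & [->|Ha]) Hv; auto. eapply nb_adj; eauto. Qed.

Lemma nb_tail X w r : w r -> exists n, forall m, n <= m -> nb X w (rv r m).
Proof.
  intros Hr. destruct (tail_avoids_finite r X) as [n Hn]. exists n; intros m Hm.
  exists r, n; split; auto; split; auto. apply tail_avoids_conn; auto.
Qed.

Lemma nb_tail_end w r : is_end w -> (forall X, exists n, forall m, n <= m -> nb X w (rv r m)) -> w r.
Proof.
  intros Hw H. pose proof Hw as [r0 H0]. apply H0. intros T [X HX].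
  destruct (H X) as [n Hn].
  assert (Hr0 : w r0) by (apply H0, ray_equiv_refl).
  destruct (nb_tail X w r0 Hr0) as [m Hm].
  exists m, n; split; [|split].
  - intros k Hk Hin; apply HX in Hin; apply (nb_notin (Hm k Hk) Hin).
  - intros k Hk Hin; apply HX in Hin; apply (nb_notin (Hn k Hk) Hin).
  - apply (@connS_mono T (lset X)); [exact HX|]. apply (@nb_conn X w); auto.
Qed.

Definition shift_ray r (n : nat) : ray G.
Proof.
  refine (@Ray G (fun t => rv r (n + t)) _ _).
  - intros a b H; apply rv_inj in H; lia.
  - intros a; replace (n + S a) with (S (n + a)) by lia; apply rv_adj.
Defined.

Lemma meeting_rays_equiv r r' : (forall N, exists s t, N <= s /\ N <= t /\ rv r s = rv r' t) ->
  ray_equiv r r'.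
Proof.
  intros H T [X HX].
  destruct (tail_avoids_finite r X) as [n Hn], (tail_avoids_finite r' X) as [m Hm].
  destruct (H (n + m)) as (s & t & Hs & Ht & E).
  assert (Hs' : tail_avoids r s T) by (intros k Hk Hin; apply HX in Hin; apply (Hn k); auto; lia).
  assert (Ht' : tail_avoids r' t T) by (intros k Hk Hin; apply HX in Hin; apply (Hm k); auto; lia).
  exists s, t; split; auto; split; auto. rewrite E. apply connS_refl, Ht'; lia.
Qed.

Lemma inequivalent_separated r r' : ~ ray_equiv r r' -> exists X, forall n m,
  tail_avoids r n (lset X) -> tail_avoids r' m (lset X) -> ~ connS G (lset X) (rv r n) (rv r' m).
Proof.
  intros H. apply not_all_ex_not in H as [T H]. apply imply_to_and in H as [[X HX] H].
  exists X; intros n m Hn Hm Hc. apply H. exists n, m; split; [|split].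
  - intros k Hk Hin; apply (Hn k Hk), HX, Hin.
  - intros k Hk Hin; apply (Hm k Hk), HX, Hin.
  - eapply connS_mono; [|exact Hc]. exact HX.
Qed.

(** One finite [X] serves all pairs. Tails that avoid [X] lie in different components of [G - X], so
    they are disjoint. *)
Lemma inequivalent_rays_disjoint (L : nat -> ray G) (n : nat) :
  (forall i j, i < n -> j < n -> i <> j -> ~ ray_equiv (L i) (L j)) ->
  exists R : nat -> ray G, disjoint_family n R.
Proof.
  intros H.
  destruct (@union_over_list _ _ (fun (a : nat * nat) X => fst a <> snd a -> forall k m,
      tail_avoids (L (fst a)) k (lset X) -> tail_avoids (L (snd a)) m (lset X) ->
      ~ connS G (lset X) (rv (L (fst a)) k) (rv (L (snd a)) m))
    (list_prod (seq 0 n) (seq 0 n))) as [X HX].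
  { intros [i j] X Y HI; simpl. intros HX N k m Hk Hm Hc. apply (HX N k m).
    - intros p Hp Hin; apply (Hk p Hp), HI, Hin.
    - intros p Hp Hin; apply (Hm p Hp), HI, Hin.
    - eapply connS_mono; [|exact Hc]. exact HI. }
  { intros [i j] Hij. apply in_prod_iff in Hij as [Hi Hj]. apply in_seq in Hi, Hj. simpl.
    destruct (Nat.eq_dec i j) as [->|N]; [exists nil; tauto|].
    destruct (@inequivalent_separated (L i) (L j)) as [X HX]; [apply H; lia|]. exists X; auto. }
  destruct (choice_fun (fun i n => tail_avoids (L i) n (lset X)) (fun i => tail_avoids_finite (L i) X)) as [N HN].
  exists (fun i => shift_ray (L i) (N i)). intros i j Hi Hj Nij s t E; simpl in E.
  apply (HX (i, j)) with (k := N i + s) (m := N j + t); simpl; auto.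
  - apply in_prod_iff; split; apply in_seq; lia.
  - intros k Hk; apply HN; lia.
  - intros k Hk; apply HN; lia.
  - rewrite E. apply connS_refl, HN; lia.
Qed.

Lemma maximal_nat (P : nat -> Prop) (k : nat) : P 0 -> (forall n, P n -> n <= k) ->
  exists n, P n /\ ~ P (S n).
Proof.
  intros H0 Hk. apply NNPP; intros Hno.
  assert (H : forall n, P n) by (intros n; induction n; auto; apply NNPP; eauto).
  specialize (Hk _ (H (S k))); lia.
Qed.

Lemma finitely_many_ends (k : nat) :
  (forall n (R : nat -> ray G), disjoint_family n R -> n <= k) ->
  exists l : list (ray G -> Prop), forall w, is_end w -> In w l.
Proof.
  intros Hk.
  destruct (classic (exists r : ray G, True)) as [[r0 _]|Hno].
  2: { exists nil; intros w [r _]; apply Hno; eauto. }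
  destruct (@maximal_nat (fun n => exists L : nat -> ray G, 
    forall i j, i < n -> j < n -> i <> j -> ~ ray_equiv (L i) (L j)) k) as (n & [L HL] & Hmax).
  - exists (fun _ => r0); intros; lia.
  - intros n [L HL]. destruct (inequivalent_rays_disjoint L HL) as [R HR]. eauto.
  - exists (map (fun i => ray_equiv (L i)) (seq 0 n)). intros w [r Hr].
    apply NNPP; intros Hin. apply Hmax.
    assert (Hneq : forall i, i < n -> ~ ray_equiv (L i) r).
    { intros i Hi E. apply Hin, in_map_iff. exists i; split; [|apply in_seq; lia].
      symmetry; apply end_eq_class; [exists r; auto|]. apply Hr, ray_equiv_sym, E. }
    exists (fun i => if Nat.eq_dec i n then r else L i). intros i j Hi Hj N.
    destruct (Nat.eq_dec i n) as [->|], (Nat.eq_dec j n) as [->|]; try lia.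
    + intros E; apply (Hneq j); [lia|]. apply ray_equiv_sym, E.
    + apply Hneq; lia.
    + apply HL; lia.
Qed.
End Ends.
Arguments lset {G} X _.

(** * Local description of the topology *)

Section Topology.
Variables (G : graph) (Psi : (ray G -> Prop) -> Prop).
Local Open Scope R_scope.

Definition near_end (v : V G) (d : R) (e : E G) (s : R) : Prop :=
  0 < s < 1 /\ ((src e = v /\ s < d) \/ (tgt e = v /\ 1 - s < d)).

(** Openness in the subspace for [Psi], tested separately at inner points of edges, at vertices and
    at ends; [openPsi_local] and [local_openPsi] give the equivalence with [openPsi]. *)
Definition local_open (W : point G -> Prop) : Prop :=
  (forall x, W x -> inGPsi Psi x) /\
  (forall e t, W (PE G e t) ->
     exists d, 0 < d /\ forall s, Rabs (s - t) < d -> 0 < s < 1 -> W (PE G e s)) /\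
  (forall v, W (PV G v) ->
     exists d, 0 < d <= 1 /\ forall e s, near_end v d e s -> W (PE G e s)) /\
  (forall w, W (PO w) -> exists X,
     (forall v, nb X w v ->
        W (PV G v) /\ forall e s, 0 < s < 1 -> incident G e v -> W (PE G e s)) /\
     (forall w' r, Psi w' -> is_end w' -> w' r -> (forall n, nb X w (rv r n)) -> W (PO w'))).

Lemma vball_edge_open (v : V G) eps e t : vball v eps (PE G e t) ->
  exists d, 0 < d /\ forall s, Rabs (s - t) < d -> 0 < s < 1 -> vball v eps (PE G e s).
Proof.
  intros [Ht [[Hv Hlt]|[Hv Hlt]]].
  - exists (eps - t); split; [lra|]. intros s Hs Hs'; split; auto; left; split; auto.
    apply Rabs_def2 in Hs; lra.
  - exists (eps - (1 - t)); split; [lra|]. intros s Hs Hs'; split; auto; right; split; auto.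
    apply Rabs_def2 in Hs; lra.
Qed.

Lemma basic_open_valid (B : point G -> Prop) x : basic_open B -> B x -> valid x.
Proof.
  intros [(v & eps & He & HB)|[(e & t & eps & Ht & He & HB)|(S & A & r & n & HS & HA & Hr & Hn & HB)]] Hx;
    apply HB in Hx.
  - destruct x; simpl in *; tauto.
  - destruct Hx as [(s & -> & Hs & _)|[[_ H]|[_ H]]]; [exact Hs| |]; destruct x; simpl in *; tauto.
  - destruct x; simpl in *; tauto.
Qed.

(** The basic set need not be centred at [w]: it is given by a ray of an end [A]. The ray of [w]
    inside the component carries the whole neighbourhood of [w] at [X] into it. *)
Lemma end_in_comp_nb (S : V G -> Prop) (A w : ray G -> Prop) r n : finite_set S -> is_end A -> A r ->
  tail_avoids r n S -> hatC (Defs.comp G S (rv r n)) (PO w) ->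
  exists X, (forall u, S u -> In u X) /\ forall v, nb X w v -> Defs.comp G S (rv r n) v.
Proof.
  intros [X HX] HA Hr Hn [Hw (r' & Hr' & Hc)]. exists X; split; auto. intros v Hv.
  destruct (nb_tail X w r' Hr') as [m Hm].
  pose proof (nb_conn Hw (Hm m (le_n _)) Hv) as H.
  apply (@connS_mono G S (lset X)) in H; [|exact HX].
  unfold Defs.comp in *. eapply connS_trans; [apply (Hc m)|exact H].
Qed.

Lemma openPsi_local (W : point G -> Prop) : openPsi Psi W -> local_open W.
Proof.
  intros (U & [Hval Hop] & HW). split; [intros x Hx; apply HW; auto|].
  split; [|split].
  - intros e t Ht. apply HW in Ht as [Ht _].
    destruct (Hop _ Ht) as (B & HB & HBt & HBU).
    enough (exists d, 0 < d /\ forall s, Rabs (s - t) < d -> 0 < s < 1 -> B (PE G e s)) as (d & Hd & H).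
    { exists d; split; auto. intros s Hs Hs'. apply HW; split; auto. split; simpl; auto. }
    destruct HB as [(v & eps & He & HB)|[(e' & t' & eps & Ht' & He & HB)|(S & A & r & n & HS & HA & Hr & Hn & HB)]];
      apply HB in HBt.
    + destruct (vball_edge_open HBt) as (d & Hd & H). exists d; split; auto.
      intros s Hs Hs'; apply HB; auto.
    + destruct HBt as [(s & E & Hs & Habs)|[[Hlt H]|[Hlt H]]].
      * injection E as <- <-. exists (eps - Rabs (t - t')); split; [lra|].
        intros s Hs1 Hs2. apply HB. left; exists s; repeat split; try tauto.
        apply Rle_lt_trans with (Rabs (s - t) + Rabs (t - t')); [|lra].
        replace (s - t') with ((s - t) + (t - t')) by ring. apply Rabs_triang.
      * destruct (vball_edge_open H) as (d & Hd & H'). exists d; split; auto.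
        intros s Hs Hs'; apply HB; right; left; auto.
      * destruct (vball_edge_open H) as (d & Hd & H'). exists d; split; auto.
        intros s Hs Hs'; apply HB; right; right; auto.
    + exists 1; split; [lra|]. intros s _ Hs; apply HB; split; auto; apply HBt.
  - intros v Hv. apply HW in Hv as [Hv _].
    destruct (Hop _ Hv) as (B & HB & HBt & HBU).
    enough (exists d, 0 < d <= 1 /\ forall e s, near_end v d e s -> B (PE G e s)) as (d & Hd & H).
    { exists d; split; auto. intros e s Hs. apply HW; split; auto. split; simpl; auto. apply Hs. }
    destruct HB as [(v' & eps & He & HB)|[(e' & t' & eps & Ht' & He & HB)|(S & A & r & n & HS & HA & Hr & Hn & HB)]];
      apply HB in HBt.
    + simpl in HBt; subst v'. exists eps; split; auto. intros e s Hs; apply HB, Hs.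
    + destruct HBt as [(s & E & _)|[[Hlt H]|[Hlt H]]]; [discriminate| |]; simpl in H; subst v.
      * exists (eps - t'); split; [lra|]. intros e s Hs; apply HB; right; left; split; auto.
      * exists (eps - (1 - t')); split; [lra|]. intros e s Hs; apply HB; right; right; split; auto.
    + exists 1; split; [lra|]. intros e s [Hs H]; apply HB; split; auto.
      simpl in HBt. destruct H as [[-> _]|[-> _]]; auto.
  - intros w Hw. apply HW in Hw as [Hw _].
    destruct (Hop _ Hw) as (B & HB & HBt & HBU).
    destruct HB as [(v' & eps & He & HB)|[(e' & t' & eps & Ht' & He & HB)|(S & A & r & n & HS & HA & Hr & Hn & HB)]];
      apply HB in HBt.
    + destruct HBt.
    + destruct HBt as [(s & E & _)|[[Hlt H]|[Hlt H]]]; [discriminate| |]; destruct H.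
    + destruct (@end_in_comp_nb S A w r n HS HA Hr Hn HBt) as (X & _ & HX).
      exists X; split.
      * intros v Hv. apply HX in Hv. split.
        -- apply HW; split; [apply HBU, HB, Hv|]. split; simpl; auto.
        -- intros e s Hs Hin. apply HW; split; [|split; simpl; auto].
           apply HBU, HB; split; auto. destruct Hin as [->| ->]; auto.
      * intros w' r' Hp Hw' Hr' Hn'. apply HW; split; [|split; simpl; auto].
        apply HBU, HB; split; auto. exists r'; split; auto.
Qed.

Lemma local_openPsi (W : point G -> Prop) : local_open W -> openPsi Psi W.
Proof.
  intros (Hin & HE & HV & HO).
  (* The union of all basic sets whose part in the subspace lies in [W]. *)
  exists (fun x => exists B, basic_open B /\ B x /\ forall y, B y -> inGPsi Psi y -> W y). split; [split|].
  - intros x (B & HB & Hx & _). eapply basic_open_valid; eauto.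
  - intros x (B & HB & Hx & H). exists B; split; auto; split; auto. intros y Hy; exists B; auto.
  - intros x; split; [|intros [(B & HB & Hx & H) Hx']; auto].
    intros Hx. split; auto. pose proof (Hin x Hx) as Hx'. destruct x as [v|w|e t].
    + destruct (HV v Hx) as (d & Hd & H). exists (vball v d); split; [|split; [reflexivity|]].
      * left; exists v, d; split; auto; tauto.
      * intros [u|w|e s]; [intros ->; auto|intros []|]. intros Hy _; apply H, Hy.
    + destruct (HO w Hx) as (X & H1 & H2). destruct Hx' as [[r Hr] Hp]. simpl in Hp.
      assert (Hw : is_end w) by (exists r; auto). assert (Hwr : w r) by (apply Hr, ray_equiv_refl).
      destruct (tail_avoids_finite r X) as [n Hn].
      exists (hatC (Defs.comp G (lset X) (rv r n))); split; [|split].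
      * right; right. exists (lset X), w, r, n. split; [apply finite_lset|]. repeat split; auto; tauto.
      * split; auto. exists (shift_ray r n); split.
        -- apply nb_tail_end; auto. intros Y. destruct (nb_tail Y w r Hwr) as [m Hm].
           exists m; intros k Hk; apply Hm; simpl; lia.
        -- intros k; apply (tail_avoids_conn (m := (n + k)%nat) Hn). lia.
      * assert (Hnb : forall v, Defs.comp G (lset X) (rv r n) v -> nb X w v).
        { intros v Hv; exists r, n; auto. }
        intros [u|w'|e s].
        -- intros Hu _; apply H1, Hnb, Hu.
        -- intros (Hw' & r' & Hr' & Hc) [_ Hp']. apply (H2 w' r'); auto.
        -- intros [Hs [Hc|Hc]] _; apply Hnb in Hc; apply (H1 _ Hc); auto; [left|right]; auto.
    + destruct (HE e t Hx) as (d & Hd & H). destruct Hx' as [Ht _]; simpl in Ht.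
      (* With [eps] at most [t] and [1 - t] the ball stays inside the edge, so the other two cases
         of [eball] are void. *)
      set (eps := Rmin d (Rmin t (1 - t))).
      assert (He : eps <= d) by apply Rmin_l.
      assert (He' : eps <= t) by (unfold eps; eapply Rle_trans; [apply Rmin_r|apply Rmin_l]).
      assert (He'' : eps <= 1 - t) by (unfold eps; eapply Rle_trans; [apply Rmin_r|apply Rmin_r]).
      assert (Hpos : 0 < eps) by (unfold eps; repeat apply Rmin_glb_lt; lra).
      exists (eball e t eps); split; [|split].
      * right; left; exists e, t, eps; repeat split; try lra; auto.
      * left; exists t; split; auto; split; auto.
        replace (t - t) with 0 by ring. rewrite Rabs_R0; auto.
      * intros y [(s & -> & Hs & Habs)|[[Hlt _]|[Hlt _]]] _; [|lra|lra]. apply H; auto; lra.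
Qed.

(* The open bipartitions of [V(G)] and [Psi], in combinatorial terms (see [psi_equiv_cut]). *)
Definition cut (A : V G -> Prop) (Q : (ray G -> Prop) -> Prop) : Prop :=
  forall w, Psi w -> is_end w -> exists X, forall v, nbN X w v -> (A v <-> Q w).

Definition on_side (A : V G -> Prop) (Q : (ray G -> Prop) -> Prop) (x : point G) : Prop :=
  match x with PV _ v => A v | PO w => Q w | PE _ _ _ => False end.

Lemma cut_compl A Q : cut A Q -> cut (fun v => ~ A v) (fun w => ~ Q w).
Proof. intros H w Hp Hw. destruct (H w Hp Hw) as [X HX]. exists X; intros v Hv. rewrite HX; tauto. Qed.

Lemma cut_and A Q A' Q' : cut A Q -> cut A' Q' -> cut (fun v => A v /\ A' v) (fun w => Q w /\ Q' w).
Proof.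
  intros H H' w Hp Hw. destruct (H w Hp Hw) as [X HX], (H' w Hp Hw) as [X' HX'].
  exists (X ++ X'); intros v Hv. rewrite (HX v), (HX' v); [tauto| |];
    eapply nbN_mono; try exact Hv; auto using incl_appl, incl_appr, incl_refl.
Qed.

(* The cut side as an open point set; a crossing edge [e] is divided at the point [tau e]. *)
Definition side_points (A : V G -> Prop) (Q : (ray G -> Prop) -> Prop) (tau : E G -> R)
  (x : point G) : Prop :=
  match x with
  | PV _ v => A v
  | PO w => is_end w /\ Psi w /\ Q w
  | PE _ e s => 0 < s < 1 /\
      ((A (src e) /\ A (tgt e)) \/ (A (src e) /\ ~ A (tgt e) /\ s < tau e) \/
       (~ A (src e) /\ A (tgt e) /\ tau e < s))
  end.

Lemma cut_end_determined A Q X w w' r : cut A Q -> Psi w' -> is_end w' -> w' r ->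
  (forall v, nbN X w v -> (A v <-> Q w)) -> (forall n, nb X w (rv r n)) -> (Q w' <-> Q w).
Proof.
  intros H Hp Hw Hr HX Hn. destruct (H w' Hp Hw) as [X' HX'].
  destruct (nb_tail X' w' r Hr) as [m Hm].
  rewrite <- (HX' (rv r m)), <- (HX (rv r m)); [tauto| |]; apply nb_nbN; auto.
Qed.

(** A vertex may have infinitely many incident edges. The margin [m] keeps all dividing points
    uniformly away from the endvertices, which gives one radius for all these edges. *)
Lemma side_points_open A Q tau m : cut A Q -> 0 < m < 1 -> (forall e, m <= tau e <= 1 - m) ->
  local_open (side_points A Q tau).
Proof.
  intros Hcut Hm Htau; split; [|split; [|split]].
  - intros [v|w|e s]; unfold inGPsi; simpl; tauto.
  - intros e t [Ht [H|[(H1 & H2 & H)|(H1 & H2 & H)]]].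
    + exists 1; split; [lra|]; intros s _ Hs; split; auto.
    + exists (tau e - t); split; [lra|]; intros s Habs Hs; split; auto. right; left.
      apply Rabs_def2 in Habs; repeat split; auto; lra.
    + exists (t - tau e); split; [lra|]; intros s Habs Hs; split; auto. right; right.
      apply Rabs_def2 in Habs; repeat split; auto; lra.
  - intros v Hv; simpl in Hv. exists m; split; [lra|].
    intros e s [Hs [[<- Hlt]|[<- Hlt]]]; split; auto; specialize (Htau e).
    + destruct (classic (A (tgt e))); [left; auto|right; left]. repeat split; auto; lra.
    + destruct (classic (A (src e))); [left; auto|right; right]. repeat split; auto; lra.
  - intros w (Hw & Hp & HQ). destruct (Hcut w Hp Hw) as [X HX]. exists X; split.
    + intros v Hv. split; [apply HX; auto using nb_nbN|].
      intros e s Hs Hin; split; auto. left. destruct Hin as [<-|<-].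
      * split; apply HX; auto; [apply nb_nbN; auto|]. exists (src e); split; auto. right; exists e; auto.
      * split; apply HX; auto; [|apply nb_nbN; auto]. exists (tgt e); split; auto. right; exists e; auto.
    + intros w' r Hp' Hw' Hr Hn. repeat split; auto.
      apply (cut_end_determined r Hcut Hp' Hw' Hr HX Hn); auto.
Qed.

(** The neighbours in [nbN] come from here: an edge leaving the neighbourhood of an end lies
    entirely in the open set of that end, so its outer endvertex cannot lie in the other open set
    without the two sets meeting on this edge. *)
Lemma local_open_cut O1 O2 : local_open O1 -> local_open O2 ->
  (forall z, O1 z -> O2 z -> False) -> (forall z, VPsi Psi z -> O1 z \/ O2 z) ->
  cut (fun v => O1 (PV G v)) (fun w => O1 (PO w)).
Proof.
  assert (Hside : forall O O', local_open O -> local_open O' ->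
    (forall z, O z -> O' z -> False) -> (forall z, VPsi Psi z -> O z \/ O' z) ->
    forall w, O (PO w) -> exists X, forall v, nbN X w v -> O (PV G v)).
  { intros O O' (_ & _ & _ & HO) (_ & _ & HV & _) Hd Hc w Hw.
    destruct (HO w Hw) as (X & HX & _). exists X; intros v (u & Hu & [->|[e He]]); [apply HX; auto|].
    destruct (Hc (PV G v) I) as [|Hv]; auto. exfalso.
    destruct (HV v Hv) as (d & Hd' & H). destruct (HX u Hu) as [_ H'].
    destruct He as [[E1 E2]|[E1 E2]].
    - apply (Hd (PE G e (1 - d / 2))); [apply H'; [lra|left; auto]|apply H].
      split; [lra|]. right; split; auto; lra.
    - apply (Hd (PE G e (d / 2))); [apply H'; [lra|right; auto]|apply H].
      split; [lra|]. left; split; auto; lra. }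
  intros H1 H2 Hd Hc w Hp Hw.
  destruct (Hc (PO w)) as [Ho|Ho]; [split; auto| |].
  - destruct (Hside O1 O2 H1 H2 Hd Hc w Ho) as [X HX]. exists X; intros v Hv. split; auto.
  - destruct (Hside O2 O1 H2 H1) with (w := w) as [X HX]; eauto.
    { intros z Hz; apply Hc in Hz; tauto. }
    exists X; intros v Hv. split; intros H; exfalso; eauto.
Qed.

(** Away from the ends, edges impose no condition: dividing every crossing edge at its midpoint
    turns a cut into two disjoint open sets. The midpoints stay uncovered, which is harmless, as
    only vertices and ends have to be covered. *)
Lemma psi_equiv_cut x y : VPsi Psi x -> VPsi Psi y ->
  (psi_equiv Psi x y <-> forall A Q, cut A Q -> (on_side A Q x <-> on_side A Q y)).
Proof.
  intros Hx Hy; split.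
  - intros H A Q Hcut.
    assert (Hx' : forall z, VPsi Psi z -> (on_side A Q z <-> side_points A Q (fun _ => 1 / 2) z)).
    { intros [v|w|e s]; simpl; tauto. }
    rewrite (Hx' x Hx), (Hx' y Hy).
    apply (H _ (side_points (fun v => ~ A v) (fun w => ~ Q w) (fun _ => 1 / 2))).
    + apply local_openPsi, (@side_points_open A Q (fun _ => 1 / 2) (1 / 2)); auto; intros; lra.
    + apply local_openPsi, (@side_points_open _ _ (fun _ => 1 / 2) (1 / 2)); auto using cut_compl; intros; lra.
    + intros [v|w|e s]; simpl; [tauto|tauto|].
      intros [_ [H1|[H1|H1]]] [_ [H2|[H2|H2]]]; try tauto; lra.
    + intros [v|w|e s]; simpl; [|intros [Hw Hp]|tauto].
      * intros _; apply classic.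
      * destruct (classic (Q w)); auto.
  - intros H O1 O2 H1 H2 Hd Hc.
    pose proof (local_open_cut (openPsi_local H1) (openPsi_local H2) Hd Hc) as Hcut.
    specialize (H _ _ Hcut). destruct x, y; simpl in *; tauto.
Qed.

Lemma psi_equiv_refl x : psi_equiv Psi x x.
Proof. intros O1 O2 _ _ _ _; tauto. Qed.

Lemma psi_equiv_sym x y : psi_equiv Psi x y -> psi_equiv Psi y x.
Proof. intros H O1 O2 H1 H2 H3 H4. symmetry; apply (H O1 O2); auto. Qed.

Lemma psi_equiv_trans x y z : psi_equiv Psi x y -> psi_equiv Psi y z -> psi_equiv Psi x z.
Proof. intros H H' O1 O2 H1 H2 H3 H4. rewrite (H O1 O2), (H' O1 O2); auto; tauto. Qed.

Lemma qclass_eq x y : inGPsi Psi x -> (qclass Psi x = qclass Psi y <-> eqPsi Psi x y).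
Proof.
  intros Hx; split.
  - intros E. assert (H : qclass Psi x x) by (split; auto; left; auto).
    rewrite E in H. destruct H as [_ [->|(H1 & H2 & H3)]]; [left; auto|right].
    split; [|split]; auto using psi_equiv_sym.
  - intros [->|(H1 & H2 & H3)]; auto.
    apply functional_extensionality; intros z; apply propositional_extensionality.
    unfold qclass; split; intros [Hz [<-|(H4 & H5 & H6)]]; split; auto; right; (split; [|split]); auto.
    + apply psi_equiv_sym; auto.
    + eapply psi_equiv_trans; [apply psi_equiv_sym|]; eauto.
    + eapply psi_equiv_trans; eauto.
Qed.

(** * Open sets of the quotient from saturated open sets *)

Definition saturated (W : point G -> Prop) : Prop :=
  forall x y, VPsi Psi x -> VPsi Psi y -> psi_equiv Psi x y -> W x -> W y.

Definition image_of (W : point G -> Prop) (c : point G -> Prop) : Prop :=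
  exists x, W x /\ c = qclass Psi x.

Lemma image_of_iff W x : (forall x, W x -> inGPsi Psi x) -> saturated W -> inGPsi Psi x ->
  (image_of W (qclass Psi x) <-> W x).
Proof.
  intros Hin Hs Hx; split; [|intros H; exists x; auto].
  intros (y & Hy & E). apply qclass_eq in E as [->|(H1 & H2 & H3)]; auto.
  apply (Hs y x); auto. apply psi_equiv_sym; auto.
Qed.

Lemma image_of_open W : local_open W -> saturated W -> openQ Psi (image_of W).
Proof.
  intros HW Hs. pose proof (proj1 HW) as Hin. split.
  - intros c (x & Hx & ->). exists x; auto.
  - replace (fun x => inGPsi Psi x /\ image_of W (qclass Psi x)) with W; [apply local_openPsi; auto|].
    apply functional_extensionality; intros x; apply propositional_extensionality. split.
    + intros Hx; split; auto. exists x; auto.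
    + intros [Hx H]. apply image_of_iff in H; auto.
Qed.

Lemma side_points_saturated A Q tau : cut A Q -> saturated (side_points A Q tau).
Proof.
  intros Hcut x y Hx Hy Hxy H. rewrite psi_equiv_cut in Hxy by auto.
  specialize (Hxy A Q Hcut). destruct x, y; simpl in *; tauto.
Qed.

Definition edge_interval (e : E G) (a b : R) (x : point G) : Prop :=
  exists s, x = PE G e s /\ 0 < s < 1 /\ a < s < b.

Lemma edge_interval_open e a b : local_open (edge_interval e a b).
Proof.
  split; [|split; [|split]].
  - intros x (s & -> & Hs & _); split; simpl; auto.
  - intros e' t (s & E & Hs & Hab). injection E as -> ->.
    exists (Rmin (s - a) (b - s)); split; [apply Rmin_glb_lt; lra|].
    intros s' Habs Hs'. exists s'; repeat split; try tauto; apply Rabs_def2 in Habs;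
      pose proof (Rmin_l (s - a) (b - s)); pose proof (Rmin_r (s - a) (b - s)); lra.
  - intros v (s & E & _); discriminate.
  - intros v (s & E & _); discriminate.
Qed.

Lemma edge_interval_saturated e a b : saturated (edge_interval e a b).
Proof. intros x y Hx _ _ (s & -> & _). destruct Hx. Qed.

(** Serves both as the complement of a closed piece of an edge and, along the edges of a circuit, to
    make the neighbourhood of a vertex small. *)
Definition outside_interval (W : point G -> Prop) (L : list (E G)) (a b : R) (x : point G) : Prop :=
  W x /\ forall e s, In e L -> x = PE G e s -> ~ (a <= s <= b).

Lemma outside_interval_open W L a b : local_open W -> 0 < a -> b < 1 ->
  local_open (outside_interval W L a b).
Proof.
  intros (Hin & HE & HV & HO) Ha Hb. split; [|split; [|split]].
  - intros x [Hx _]; auto.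
  - intros e t [Ht Hout]. destruct (HE e t Ht) as (d & Hd & H).
    destruct (classic (In e L)) as [HeL|HeL].
    + assert (Hab : t < a \/ b < t).
      { destruct (Rlt_le_dec t a); auto. destruct (Rlt_le_dec b t); auto.
        exfalso; apply (Hout e t); auto. }
      set (d' := if Rlt_le_dec t a then a - t else t - b).
      assert (Hd' : 0 < d') by (unfold d'; destruct (Rlt_le_dec t a); lra).
      exists (Rmin d d'); split; [apply Rmin_glb_lt; auto|]. intros s Hs Hs'.
      pose proof (Rmin_l d d'); pose proof (Rmin_r d d'). split; [apply H; auto; lra|].
      intros e' s' _ E; injection E as <- <-. unfold d' in *.
      apply Rabs_def2 in Hs. destruct (Rlt_le_dec t a); lra.
    + exists d; split; auto. intros s Hs Hs'; split; auto. intros e' s' Hi E; injection E as <- <-; tauto.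
  - intros v [Hv _]. destruct (HV v Hv) as (d & Hd & H).
    set (d' := Rmin d (Rmin a (1 - b))).
    assert (H1 : d' <= d) by apply Rmin_l.
    assert (H2 : d' <= a) by (unfold d'; eapply Rle_trans; [apply Rmin_r|apply Rmin_l]).
    assert (H3 : d' <= 1 - b) by (unfold d'; eapply Rle_trans; [apply Rmin_r|apply Rmin_r]).
    assert (H4 : 0 < d') by (unfold d'; repeat apply Rmin_glb_lt; lra).
    exists d'; split; [lra|]. intros e s [Hs Hn]. split.
    + apply H; split; auto. destruct Hn as [[-> Hn]|[-> Hn]]; [left|right]; split; auto; lra.
    + intros e' s' _ E; injection E as <- <-. destruct Hn; lra.
  - intros w [Hw _]. destruct (HO w Hw) as (X & HX1 & HX2).
    (* No edge of [L] is incident with a vertex outside this enlarged set. *)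
    exists (map src L ++ map tgt L ++ X); split.
    + intros v Hv. pose proof (nb_notin Hv) as Hnot. rewrite !in_app_iff in Hnot.
      assert (Hv' : nb X w v).
      { eapply nb_mono; [|exact Hv]. intros z Hz; rewrite !in_app_iff; auto. }
      split; [split; [apply HX1; auto|intros; discriminate]|].
      intros e s Hs Hi; split; [apply (HX1 v Hv'); auto|].
      intros e' s' Hi' E; injection E as <- <-. exfalso; apply Hnot.
      destruct Hi as [<-|<-]; [left|right; left]; apply in_map; auto.
    + intros w' r Hp Hw' Hr Hn. split; [|intros; discriminate]. apply (HX2 w' r); auto.
      intros n; eapply nb_mono; [|apply Hn]. intros z Hz; rewrite !in_app_iff; auto.
Qed.

Lemma outside_interval_saturated W L a b : saturated W -> saturated (outside_interval W L a b).
Proof.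
  intros Hs x y Hx Hy Hxy [HW _]. split; [apply (Hs x y); auto|].
  intros e s _ ->; destruct Hy.
Qed.

Lemma whole_space_open : local_open (inGPsi Psi).
Proof.
  split; [|split; [|split]]; auto.
  - intros e t _; exists 1; split; [lra|]; split; simpl; auto.
  - intros v _; exists 1; split; [lra|]. intros e s [Hs _]; split; simpl; auto.
  - intros w _; exists nil; split.
    + intros v _; split; [split; simpl; auto|]. intros e s Hs _; split; simpl; auto.
    + intros w' r Hp Hw' _ _; split; simpl; auto.
Qed.

Lemma whole_space_saturated : saturated (inGPsi Psi).
Proof. intros x [v|w|e s] _ Hy _ _; split; simpl in *; tauto. Qed.

End Topology.

(** * Circles and cuts *)

Section Sphere.
Local Open Scope R_scope.

Lemma R_connected (T1 T2 : R -> Prop) t1 t2 :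
  (forall t, T1 t -> exists d, 0 < d /\ forall s, Rabs (s - t) < d -> T1 s) ->
  (forall t, T2 t -> exists d, 0 < d /\ forall s, Rabs (s - t) < d -> T2 s) ->
  (forall t, T1 t \/ T2 t) -> (forall t, T1 t -> T2 t -> False) ->
  T1 t1 -> T2 t2 -> t1 < t2 -> False.
Proof.
  intros O1 O2 Hc Hd H1 H2 Hlt.
  destruct (completeness (fun x => t1 <= x <= t2 /\ forall y, t1 <= y <= x -> T1 y)) as [m [Hub Hlub]].
  - exists t2; intros x Hx; lra.
  - exists t1; split; [lra|]. intros y Hy; replace y with t1 by lra; auto.
  - assert (Hm : t1 <= m <= t2).
    { split; [apply Hub; split; [lra|]; intros y Hy; replace y with t1 by lra; auto|].
      apply Hlub; intros x Hx; lra. }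
    assert (Hbelow : forall y, t1 <= y < m -> T1 y).
    { intros y Hy. apply NNPP; intros Hn. apply (Rlt_not_le m y); [lra|].
      apply Hlub. intros x [Hx Hx']. destruct (Rle_lt_dec x y); auto.
      exfalso; apply Hn, Hx'; lra. }
    destruct (Hc m) as [Hm1|Hm2].
    + destruct (O1 m Hm1) as (d & Hd' & H). destruct (Rle_lt_dec t2 m).
      { apply (Hd t2); auto. replace t2 with m by lra; auto. }
      set (x := Rmin t2 (m + d / 2)).
      assert (Hx : x <= t2) by apply Rmin_l. assert (Hx' : x <= m + d / 2) by apply Rmin_r.
      assert (Hx'' : m < x) by (apply Rmin_glb_lt; lra).
      assert (x <= m); [|lra]. apply Hub; split; [lra|]. intros y Hy.
      destruct (Rlt_le_dec y m); [apply Hbelow; lra|]. apply H, Rabs_def1; lra.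
    + destruct (O2 m Hm2) as (d & Hd' & H).
      destruct (Rle_lt_dec m t1); [apply (Hd t1); auto; replace t1 with m by lra; auto|].
      set (y := Rmax t1 (m - d / 2)).
      assert (Hy : t1 <= y) by apply Rmax_l. assert (Hy' : m - d / 2 <= y) by apply Rmax_r.
      assert (Hy'' : y < m) by (apply Rmax_lub_lt; lra).
      apply (Hd y); [apply Hbelow; lra|]. apply H, Rabs_def1; lra.
Qed.

(* The inverse of the stereographic projection from [p], read as the product of [-p] with
   the rational parametrization of the unit circle minus [-1] in the complex plane. *)
Definition stereo (p : R * R) (t : R) : R * R :=
  let c := (1 - t * t) / (1 + t * t) in
  let s := 2 * t / (1 + t * t) in
  (- (fst p * c - snd p * s), - (fst p * s + snd p * c)).

Lemma stereo_S1 p t : S1 p -> S1 (stereo p t).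
Proof.
  destruct p as [a b]; unfold S1, stereo; simpl; intros H.
  assert (Ht : 1 + t * t <> 0) by nra.
  transitivity ((a * a + b * b) * (((1 - t * t) * (1 - t * t) + 4 * (t * t)) / ((1 + t * t) * (1 + t * t)))).
  - field; auto.
  - rewrite H; field; auto.
Qed.

Lemma stereo_dist p s t : S1 p ->
  dist2 (stereo p s) (stereo p t) = 4 * ((s - t) * (s - t)) / ((1 + s * s) * (1 + t * t)).
Proof.
  destruct p as [a b]; unfold S1, stereo, dist2; simpl; intros H.
  assert (Ht : 1 + t * t <> 0) by nra. assert (Hs : 1 + s * s <> 0) by nra.
  transitivity ((a * a + b * b) * (4 * ((s - t) * (s - t)) / ((1 + s * s) * (1 + t * t)))).
  - field; auto.
  - rewrite H; field; auto.
Qed.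

Lemma stereo_dist_le p s t : S1 p -> dist2 (stereo p s) (stereo p t) <= 4 * ((s - t) * (s - t)).
Proof.
  intros H; rewrite stereo_dist by auto.
  set (D := (1 + s * s) * (1 + t * t)). set (d := (s - t) * (s - t)).
  pose proof (Rle_0_sqr s) as H1. pose proof (Rle_0_sqr t) as H2.
  pose proof (Rle_0_sqr (s * t)) as H3. pose proof (Rle_0_sqr (s - t)) as Hd. unfold Rsqr in *.
  assert (HD : 1 <= D) by (unfold D; lra). fold d in Hd.
  apply Rmult_le_reg_r with D; [lra|].
  replace (4 * d / D * D) with (4 * d) by (field; lra). nra.
Qed.

Lemma stereo_avoids p t : S1 p -> stereo p t <> p.
Proof.
  destruct p as [a b]; unfold S1, stereo; simpl; intros H E; injection E as E1 E2.
  assert (Ht : 1 + t * t <> 0) by nra.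
  assert (F : a * (- (a * ((1 - t * t) / (1 + t * t)) - b * (2 * t / (1 + t * t)))) +
          b * (- (a * (2 * t / (1 + t * t)) + b * ((1 - t * t) / (1 + t * t)))) = a * a + b * b)
    by (rewrite E1, E2; ring).
  rewrite H in F.
  replace (a * (- (a * ((1 - t * t) / (1 + t * t)) - b * (2 * t / (1 + t * t)))) +
          b * (- (a * (2 * t / (1 + t * t)) + b * ((1 - t * t) / (1 + t * t)))))
    with ((a * a + b * b) * ((t * t - 1) / (1 + t * t))) in F by (field; auto).
  rewrite H in F.
  assert (t * t - 1 = 1 + t * t); [|lra].
  transitivity (1 * ((t * t - 1) / (1 + t * t)) * (1 + t * t)); [field; auto|].
  rewrite F; ring.
Qed.

Lemma stereo_onto p q : S1 p -> S1 q -> q <> p -> exists t, stereo p t = q.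
Proof.
  destruct p as [a b], q as [x y]; unfold S1, stereo; simpl; intros Hp Hq N.
  assert (Hk : 1 - (a * x + b * y) <> 0).
  { intros E. apply N.
    assert (F : Rsqr (x - a) + Rsqr (y - b) = 0) by (unfold Rsqr; lra).
    apply Rplus_sqr_eq_0 in F. f_equal; lra. }
  (* [k] is one minus the inner product of [p] and [q], and [u] is their cross product up to sign;
     the parameter of [q] is [u / k]. *)
  set (k := 1 - (a * x + b * y)) in *. set (u := b * x - a * y).
  assert (Hu : u * u = k * (2 - k)).
  { unfold u, k.
    assert (E : (b * x - a * y) * (b * x - a * y) =
      (a * a + b * b) * (x * x + y * y) - (a * x + b * y) * (a * x + b * y)) by ring.
    rewrite E, Hp, Hq; ring. }
  assert (Hden : 1 + u / k * (u / k) = 2 / k).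
  { transitivity (1 + u * u / (k * k)); [field; auto|]. rewrite Hu. field; auto. }
  assert (Hnum : 1 - u / k * (u / k) = 2 - 2 / k) by lra.
  exists (u / k). rewrite Hden, Hnum.
  replace ((2 - 2 / k) / (2 / k)) with (k - 1) by (field; auto).
  replace (2 * (u / k) / (2 / k)) with u by (field; auto).
  unfold u, k. f_equal.
  - transitivity ((a * a + b * b) * x); [ring|]. rewrite Hp; ring.
  - transitivity ((a * a + b * b) * y); [ring|]. rewrite Hp; ring.
Qed.

Lemma S1_punctured_connected p (W1 W2 : R * R -> Prop) q1 q2 : S1 p -> openS1 W1 -> openS1 W2 ->
  (forall q, S1 q -> q <> p -> W1 q \/ W2 q) -> (forall q, q <> p -> W1 q -> W2 q -> False) ->
  W1 q1 -> W2 q2 -> q1 <> p -> q2 <> p -> False.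
Proof.
  intros Hp HW1 HW2 Hc Hd H1 H2 N1 N2.
  assert (Hop : forall W, openS1 W -> forall t, W (stereo p t) ->
    exists d, 0 < d /\ forall s, Rabs (s - t) < d -> W (stereo p s)).
  { intros W [_ HW] t Ht. destruct (HW _ Ht) as (eps & He & H). exists (eps / 2); split; [lra|].
    intros s Hs; apply H; [apply stereo_S1; auto|].
    eapply Rle_lt_trans; [apply stereo_dist_le; auto|].
    apply Rabs_def2 in Hs. nra. }
  destruct (@stereo_onto p q1 Hp (proj1 HW1 _ H1) N1) as [t1 <-].
  destruct (@stereo_onto p q2 Hp (proj1 HW2 _ H2) N2) as [t2 <-].
  assert (Hc' : forall t, W1 (stereo p t) \/ W2 (stereo p t)).
  { intros t; apply Hc; [apply stereo_S1|apply stereo_avoids]; auto. }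
  assert (Hd' : forall t, W1 (stereo p t) -> W2 (stereo p t) -> False).
  { intros t; apply Hd, stereo_avoids; auto. }
  destruct (Rtotal_order t1 t2) as [Hlt|[->|Hlt]].
  - apply (@R_connected _ _ t1 t2 (Hop W1 HW1) (Hop W2 HW2)); auto.
  - apply (Hd' t2); auto.
  - apply (@R_connected _ _ t2 t1 (Hop W2 HW2) (Hop W1 HW1)); eauto.
    intros t; destruct (Hc' t); auto.
Qed.

Lemma S1_not_isolated p eps : S1 p -> 0 < eps -> exists q, S1 q /\ q <> p /\ dist2 p q < eps * eps.
Proof.
  destruct p as [a b]; intros Hp He.
  assert (Hp' : S1 (- a, - b)) by (unfold S1 in *; simpl in *; lra).
  assert (E0 : stereo (- a, - b) 0 = (a, b)) by (unfold stereo; simpl; f_equal; field).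
  (* Projecting from the antipode gives [p] the parameter 0; the point with parameter [eps / 4] is
     at distance at most [eps / 2] from it. *)
  exists (stereo (- a, - b) (eps / 4)). split; [apply stereo_S1; auto|]. rewrite <- E0. split.
  - intros E. pose proof (@stereo_dist (- a, - b) (eps / 4) 0 Hp') as H. rewrite E in H.
    assert (H0 : dist2 (stereo (- a, - b) 0) (stereo (- a, - b) 0) = 0) by (unfold dist2; ring).
    rewrite H0 in H.
    assert (0 < 4 * ((eps / 4 - 0) * (eps / 4 - 0)) / ((1 + eps / 4 * (eps / 4)) * (1 + 0 * 0))); [|lra].
    apply Rdiv_lt_0_compat; nra.
  - eapply Rle_lt_trans; [apply stereo_dist_le; auto|]. nra.
Qed.

End Sphere.

Section Circle.
Variables (G : graph) (Psi : (ray G -> Prop) -> Prop) (C : (point G -> Prop) -> Prop).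
Hypothesis HC : is_circle Psi C.
Local Open Scope R_scope.

Lemma circle_punctured_connected c0 c1 c2 U1 U2 : C c0 -> openQ Psi U1 -> openQ Psi U2 ->
  (forall c, C c -> c <> c0 -> U1 c \/ U2 c) -> (forall c, C c -> c <> c0 -> U1 c -> U2 c -> False) ->
  C c1 -> C c2 -> c1 <> c0 -> c2 <> c0 -> U1 c1 -> U2 c2 -> False.
Proof.
  destruct HC as (f & Hq & Hinj & Him & Hcont & _).
  intros H0 HU1 HU2 Hc Hd H1 H2 N1 N2 Hc1 Hc2.
  apply Him in H0 as (p & Hp & <-). apply Him in H1 as (q1 & Hq1 & <-). apply Him in H2 as (q2 & Hq2 & <-).
  apply (@S1_punctured_connected p (fun q => S1 q /\ U1 (f q)) (fun q => S1 q /\ U2 (f q)) q1 q2); auto.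
  - intros q Hsq N. assert (Hfq : f q <> f p) by (intros E; apply N, Hinj; auto).
    destruct (Hc (f q)); auto. apply Him; eauto.
  - intros q N [Hsq Ha] [_ Hb]. apply (Hd (f q)); auto. apply Him; eauto.
  - congruence.
  - congruence.
Qed.

Lemma circle_not_isolated c U : C c -> openQ Psi U -> U c -> exists c', C c' /\ U c' /\ c' <> c.
Proof.
  destruct HC as (f & Hq & Hinj & Him & Hcont & _). intros Hc HU Huc.
  apply Him in Hc as (p & Hp & <-). destruct (Hcont U HU) as [_ H].
  destruct (H p (conj Hp Huc)) as (eps & He & Hball).
  destruct (S1_not_isolated Hp He) as (q & Hsq & N & Hdist).
  exists (f q); repeat split; [apply Him; eauto|apply Hball; auto|]. intros E; apply N, Hinj; auto.
Qed.

Lemma circle_three_points : exists c0 c1 c2, C c0 /\ C c1 /\ C c2 /\ c1 <> c0 /\ c2 <> c0 /\ c1 <> c2.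
Proof.
  destruct HC as (f & Hq & Hinj & Him & _ & _).
  assert (H0 : S1 (0, 1)) by (unfold S1; simpl; ring).
  assert (H1 : S1 (1, 0)) by (unfold S1; simpl; ring).
  assert (H2 : S1 (-1, 0)) by (unfold S1; simpl; ring).
  exists (f (0, 1)), (f (1, 0)), (f (-1, 0)).
  repeat split; try (apply Him; eauto); intros E; apply Hinj in E; auto; injection E; lra.
Qed.

Lemma circle_qpoint c : C c -> exists x, inGPsi Psi x /\ c = qclass Psi x.
Proof.
  destruct HC as (f & Hq & _ & Him & _). intros Hc. apply Him in Hc as (p & Hp & <-).
  exact (Hq p Hp).
Qed.

Lemma edge_in_GPsi (e : E G) t : 0 < t < 1 -> inGPsi Psi (PE G e t).
Proof. intros H; split; simpl; auto. Qed.

Lemma edge_class_inj (e e' : E G) t t' : 0 < t < 1 -> 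
  qclass Psi (PE G e t) = qclass Psi (PE G e' t') -> e = e' /\ t = t'.
Proof.
  intros Ht E. apply qclass_eq in E; [|apply edge_in_GPsi; auto].
  destruct E as [E|([] & _)]. injection E; auto.
Qed.

Lemma edge_interval_class (e : E G) a b t : 0 < t < 1 ->
  (image_of Psi (edge_interval e a b) (qclass Psi (PE G e t)) <-> a < t < b).
Proof.
  intros Ht. rewrite image_of_iff.
  - split; [intros (s & E & _ & H); injection E as ->; auto|intros H; exists t; auto].
  - apply edge_interval_open.
  - apply edge_interval_saturated.
  - apply edge_in_GPsi; auto.
Qed.

(** A circle has no isolated point. This gives a second circle point in the interval, and then a
    third one closer to [t] than the second. *)
Lemma circle_edge_points e t a b : 0 < t < 1 -> C (qclass Psi (PE G e t)) -> a < t < b ->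
  exists s1 s2 s3, a < s1 /\ s1 < s2 /\ s2 < s3 /\ s3 < b /\ 0 < s1 /\ s3 < 1 /\
    C (qclass Psi (PE G e s1)) /\ C (qclass Psi (PE G e s2)) /\ C (qclass Psi (PE G e s3)).
Proof.
  intros Ht HCt Hab.
  assert (Hopen : forall a b, openQ Psi (image_of Psi (edge_interval e a b))).
  { intros; apply image_of_open; [apply edge_interval_open|apply edge_interval_saturated]. }
  destruct (circle_not_isolated HCt (Hopen a b)) as (c & Hc & (x & (s & -> & Hs & Hsab) & ->) & N);
    [apply edge_interval_class; auto|].
  assert (Nst : s <> t) by (intros ->; auto).
  set (d := Rabs (s - t)). assert (Hd : 0 < d) by (apply Rabs_pos_lt; lra).
  set (a' := Rmax a (t - d)). set (b' := Rmin b (t + d)).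
  assert (Ha1 : a <= a') by apply Rmax_l. assert (Ha2 : t - d <= a') by apply Rmax_r.
  assert (Hb1 : b' <= b) by apply Rmin_l. assert (Hb2 : b' <= t + d) by apply Rmin_r.
  assert (Ha3 : a' < t) by (apply Rmax_lub_lt; lra).
  assert (Hb3 : t < b') by (apply Rmin_glb_lt; lra).
  destruct (circle_not_isolated HCt (Hopen a' b')) as (c & Hc' & (x & (s' & -> & Hs' & Hs'ab) & ->) & N');
    [apply edge_interval_class; auto|].
  assert (Nst' : s' <> t) by (intros ->; auto).
  assert (Hcase : s <= t - d \/ t + d <= s).
  { unfold d, Rabs; destruct (Rcase_abs (s - t)); lra. }
  assert (Hsort : forall x y z, a < x -> 0 < x -> x < y -> y < z -> z < b -> z < 1 ->
    C (qclass Psi (PE G e x)) -> C (qclass Psi (PE G e y)) -> C (qclass Psi (PE G e z)) ->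
    exists s1 s2 s3, a < s1 /\ s1 < s2 /\ s2 < s3 /\ s3 < b /\ 0 < s1 /\ s3 < 1 /\
    C (qclass Psi (PE G e s1)) /\ C (qclass Psi (PE G e s2)) /\ C (qclass Psi (PE G e s3))).
  { intros x y z; exists x, y, z; repeat split; auto. }
  destruct Hcase, (Rlt_le_dec s' t).
  - apply (Hsort s s' t); auto; lra.
  - apply (Hsort s t s'); auto; lra.
  - apply (Hsort s' t s); auto; lra.
  - apply (Hsort t s' s); auto; lra.
Qed.

(** If the circle misses [t0], take three circle points of the edge on one side of [t0]. The open
    interval between the middle one and [t0] contains exactly one of the other two, and the middle
    one is its only boundary point on the circle; removing it would disconnect the circle. *)
Lemma circle_contains_edge e t : 0 < t < 1 -> C (qclass Psi (PE G e t)) -> circle_edges Psi C e.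
Proof.
  intros Ht HCt t0 Ht0. apply NNPP; intros Hmiss.
  assert (Hmain : forall a b s0 s1, 0 < a -> a < b -> b < 1 -> a < s0 < b -> 0 < s1 < 1 ->
    (s1 < a \/ b < s1) -> C (qclass Psi (PE G e s0)) -> C (qclass Psi (PE G e s1)) ->
    ((C (qclass Psi (PE G e a)) /\ ~ C (qclass Psi (PE G e b))) \/
     (C (qclass Psi (PE G e b)) /\ ~ C (qclass Psi (PE G e a)))) -> False).
  { intros a b s0 s1 Ha Hab Hb Hs0 Hs1 Hout H0 H1 Hends.
    set (U1 := image_of Psi (edge_interval e a b)).
    set (U2 := image_of Psi (outside_interval (inGPsi Psi) (e :: nil) a b)).
    assert (HO2 : local_open Psi (outside_interval (inGPsi Psi) (e :: nil) a b)).
    { apply outside_interval_open; auto. apply whole_space_open. }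
    assert (HS2 : saturated Psi (outside_interval (inGPsi Psi) (e :: nil) a b)).
    { apply outside_interval_saturated, whole_space_saturated. }
    assert (HU1 : openQ Psi U1).
    { apply image_of_open; [apply edge_interval_open|apply edge_interval_saturated]. }
    assert (HU2 : openQ Psi U2) by (apply image_of_open; auto).
    assert (HU2' : forall s, 0 < s < 1 -> (s < a \/ b < s) -> U2 (qclass Psi (PE G e s))).
    { intros s Hs Hs'. exists (PE G e s); split; auto. split; [apply edge_in_GPsi; auto|].
      intros e' s' _ E'; injection E' as <- <-; lra. }
    assert (Hcover : forall c0, (c0 = qclass Psi (PE G e a) \/ c0 = qclass Psi (PE G e b)) ->
      C c0 -> (forall c, C c -> c = qclass Psi (PE G e a) \/ c = qclass Psi (PE G e b) -> c = c0) -> False).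
    { intros c0 Hc0 HCc0 Honly.
      apply (@circle_punctured_connected c0 (qclass Psi (PE G e s0)) (qclass Psi (PE G e s1)) U1 U2); auto.
      - intros c Hc N. destruct (circle_qpoint Hc) as (x & Hx & ->).
        destruct (classic (exists s, x = PE G e s /\ a <= s <= b)) as [(s & -> & Hs)|Hno].
        + left. apply edge_interval_class; [lra|].
          destruct (Req_dec s a) as [->|]; [exfalso; apply N, Honly; auto|].
          destruct (Req_dec s b) as [->|]; [exfalso; apply N, Honly; auto|]. lra.
        + right. exists x; split; auto. split; auto. intros e' s [<-|[]] -> Hs; apply Hno; eauto.
      - intros c Hc N (x & (s & -> & Hs & Hsab) & ->) HU.
        apply image_of_iff in HU; [|apply HO2|auto|apply edge_in_GPsi; auto].
        apply (proj2 HU e s); simpl; auto; lra.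
      - intros E. destruct Hc0 as [->| ->]; apply edge_class_inj in E as [_ E]; lra.
      - intros E. destruct Hc0 as [->| ->]; apply edge_class_inj in E as [_ E]; lra.
      - apply edge_interval_class; lra. }
    destruct Hends as [[Hin Hnot]|[Hin Hnot]]; eapply Hcover; try exact Hin; auto;
      intros c Hc [->| ->]; tauto. }
  assert (Ntt : t <> t0) by (intros ->; auto).
  destruct (Rlt_le_dec t t0) as [Hlt|Hle].
  - destruct (@circle_edge_points e t 0 t0) as (s1 & s2 & s3 & H); auto; [lra|].
    apply (Hmain s2 t0 s3 s1); try tauto; lra.
  - destruct (@circle_edge_points e t t0 1) as (s1 & s2 & s3 & H); auto; [lra|].
    apply (Hmain t0 s2 s1 s3); try tauto; lra.
Qed.

(** A circle without edges would consist of classes of vertices and ends. Two different classes are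
    separated by a cut, and its two sides would disconnect the circle minus a third point [c0]. *)
Lemma circle_has_edge : exists e, circle_edges Psi C e.
Proof.
  apply NNPP; intros Hno.
  assert (HV : forall c, C c -> exists x, VPsi Psi x /\ c = qclass Psi x).
  { intros c Hc. destruct (circle_qpoint Hc) as ([v|w|e t] & Hx & ->).
    - exists (PV G v); simpl; auto.
    - exists (PO w); split; auto.
    - exfalso; apply Hno; exists e. apply (@circle_contains_edge e t); auto. apply Hx. }
  destruct circle_three_points as (c0 & c1 & c2 & H0 & H1 & H2 & N1 & N2 & N12).
  destruct (HV _ H1) as (x1 & Hx1 & ->). destruct (HV _ H2) as (x2 & Hx2 & ->).
  assert (Hin : forall x, VPsi Psi x -> inGPsi Psi x).
  { intros [v|w|e t]; simpl; [split; simpl; auto|intros [H H']; split; simpl; auto|tauto]. }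
  assert (Hsep : forall A Q, cut Psi A Q -> on_side A Q x1 -> ~ on_side A Q x2 -> False).
  { intros A Q Hcut Hs1 Hs2.
    set (A' := fun v => ~ A v). set (Q' := fun w => ~ Q w).
    assert (Hcut' : cut Psi A' Q') by (apply cut_compl; auto).
    set (S1 := side_points Psi A Q (fun _ => 1 / 2)). set (S2 := side_points Psi A' Q' (fun _ => 1 / 2)).
    assert (HS1 : local_open Psi S1) by (apply (@side_points_open _ _ _ _ _ (1 / 2)); auto; intros; lra).
    assert (HS2 : local_open Psi S2) by (apply (@side_points_open _ _ _ _ _ (1 / 2)); auto; intros; lra).
    assert (Hsat1 : saturated Psi S1) by (apply side_points_saturated; auto).
    assert (Hsat2 : saturated Psi S2) by (apply side_points_saturated; auto).
    assert (Hm1 : forall x, VPsi Psi x -> (image_of Psi S1 (qclass Psi x) <-> on_side A Q x)).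
    { intros x Hx. rewrite image_of_iff; auto; [|apply HS1]. destruct x; simpl in *; tauto. }
    assert (Hm2 : forall x, VPsi Psi x -> (image_of Psi S2 (qclass Psi x) <-> ~ on_side A Q x)).
    { intros x Hx. rewrite image_of_iff; auto; [|apply HS2]. destruct x; simpl in *; unfold A', Q'; tauto. }
    apply (@circle_punctured_connected c0 (qclass Psi x1) (qclass Psi x2) (image_of Psi S1) (image_of Psi S2));
      auto using image_of_open.
    - intros c Hc _. destruct (HV _ Hc) as (x & Hx & ->). rewrite Hm1, Hm2 by auto. apply classic.
    - intros c Hc _. destruct (HV _ Hc) as (x & Hx & ->). rewrite Hm1, Hm2 by auto. tauto.
    - apply Hm1; auto.
    - apply Hm2; auto. }
  apply N12. apply qclass_eq; auto. right; repeat apply conj; auto.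
  apply psi_equiv_cut; auto. intros A Q Hcut.
  destruct (classic (on_side A Q x1)), (classic (on_side A Q x2)); try tauto.
  - exfalso; eauto.
  - exfalso. apply (Hsep _ _ (cut_compl Hcut)).
    + destruct x1; simpl in *; auto.
    + destruct x2; simpl in *; auto.
Qed.

(* A circle minus an interior point of [e] is connected, so it cannot cross a cut in [e] alone. *)
Lemma circle_crosses_again e A Q : circle_edges Psi C e -> cut Psi A Q -> A (src e) -> ~ A (tgt e) ->
  exists g, g <> e /\ circle_edges Psi C g /\ ~ (A (src g) <-> A (tgt g)).
Proof.
  intros He Hcut Hs Ht. apply NNPP; intros Hno.
  set (A' := fun v => ~ A v). set (Q' := fun w => ~ Q w).
  assert (Hcut' : cut Psi A' Q') by (apply cut_compl; auto).
  set (S1 := side_points Psi A Q (fun _ => 1 / 2)). set (S2 := side_points Psi A' Q' (fun _ => 1 / 2)).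
  assert (HS1 : local_open Psi S1) by (apply (@side_points_open _ _ _ _ _ (1 / 2)); auto; intros; lra).
  assert (HS2 : local_open Psi S2) by (apply (@side_points_open _ _ _ _ _ (1 / 2)); auto; intros; lra).
  assert (Hsat1 : saturated Psi S1) by (apply side_points_saturated; auto).
  assert (Hsat2 : saturated Psi S2) by (apply side_points_saturated; auto).
  apply (@circle_punctured_connected (qclass Psi (PE G e (1 / 2))) (qclass Psi (PE G e (1 / 4)))
    (qclass Psi (PE G e (3 / 4))) (image_of Psi S1) (image_of Psi S2)); auto using image_of_open;
    try (apply He; lra); try (intros E; apply edge_class_inj in E as [_ E]; lra).
  - intros c Hc N. destruct (circle_qpoint Hc) as (x & Hx & ->).
    rewrite !image_of_iff; auto; [|apply HS2|apply HS1].
    destruct x as [v|w|g t]; simpl.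
    + apply classic.
    + unfold inGPsi in Hx; simpl in Hx. unfold Q'. destruct (classic (Q w)); tauto.
    + assert (Ht' : 0 < t < 1) by apply Hx.
      assert (Hg : circle_edges Psi C g) by (apply (@circle_contains_edge g t); auto).
      destruct (classic (A (src g) <-> A (tgt g))) as [Hiff|Hiff].
      * unfold A'. destruct (classic (A (src g))); tauto.
      * assert (Eg : g = e) by (apply NNPP; intros Ng; apply Hno; exists g; auto). subst g.
        assert (t <> 1 / 2) by (intros ->; auto).
        destruct (Rlt_le_dec t (1 / 2)); [left|right]; split; auto; right.
        right; unfold A'; repeat split; auto; lra.
  - intros c Hc N. destruct (circle_qpoint Hc) as (x & Hx & ->).
    rewrite !image_of_iff; auto; [|apply HS2|apply HS1].
    destruct x as [v|w|g t]; simpl; unfold A', Q'; [tauto|tauto|].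
    intros [_ [H1|[H1|H1]]] [_ [H2|[H2|H2]]]; try tauto; lra.
  - exists (PE G e (1 / 4)); split; auto. split; [lra|]. right; left; repeat split; auto; lra.
  - exists (PE G e (3 / 4)); split; auto. split; [lra|]. right; right; unfold A'; repeat split; auto; lra.
Qed.

End Circle.

(** A circle contains some edge [e], and by [circle_crosses_again] it crosses the cut of [e] in
    another edge too. *)
Lemma psi_indep_of_cuts (G : graph) (Psi : (ray G -> Prop) -> Prop) (I : E G -> Prop) :
  (forall e, I e -> exists A Q, cut Psi A Q /\ A (src e) /\ ~ A (tgt e) /\
     forall g, I g -> g <> e -> (A (src g) <-> A (tgt g))) ->
  psi_indep Psi I.
Proof.
  intros H (C & HC & HI). destruct (circle_has_edge HC) as [e He].
  destruct (H e (HI e He)) as (A & Q & Hcut & Hs & Ht & Hg).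
  destruct (circle_crosses_again HC He Hcut Hs Ht) as (g & N & Hcg & Hcross).
  apply Hcross, Hg; auto.
Qed.

(** * Finite circuits *)

Section Loop.
Local Open Scope R_scope.

(** The metric of a circle of length [L], for parameters in [[0, L)]. *)
Definition cyc_dist (L u v : R) : R := Rmin (Rabs (u - v)) (L - Rabs (u - v)).

Lemma cyc_dist_lt L u v d : cyc_dist L u v < d <-> Rabs (u - v) < d \/ L - Rabs (u - v) < d.
Proof. unfold cyc_dist, Rmin. destruct (Rle_dec (Rabs (u - v)) (L - Rabs (u - v))); lra. Qed.

Lemma cyc_dist_scale k L u v : 0 < k -> cyc_dist (k * L) (k * u) (k * v) = k * cyc_dist L u v.
Proof.
  intros Hk. unfold cyc_dist.
  replace (k * u - k * v) with (k * (u - v)) by ring. rewrite Rabs_mult, (Rabs_pos_eq k) by lra.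
  unfold Rmin. destruct (Rle_dec (k * Rabs (u - v)) (k * L - k * Rabs (u - v))),
    (Rle_dec (Rabs (u - v)) (L - Rabs (u - v))); nra.
Qed.

(* An algebraic substitute for the angle, running over [0, 4) counterclockwise from (1, 0). *)
Definition ang (p : R * R) : R := if Rle_lt_dec 0 (snd p) then 1 - fst p else 3 + fst p.

Lemma unit_bound x y : x * x + y * y = 1 -> -1 <= x <= 1.
Proof. intros H. pose proof (Rle_0_sqr y) as Hy; unfold Rsqr in Hy. split; nra. Qed.

Lemma unit_bound_strict x y : x * x + y * y = 1 -> y < 0 -> -1 < x < 1.
Proof. intros H Hy. assert (0 < y * y) by nra. split; nra. Qed.

Lemma unit_fst_inj x y y' : x * x + y * y = 1 -> x * x + y' * y' = 1 ->
  (0 <= y /\ 0 <= y') \/ (y < 0 /\ y' < 0) -> y = y'.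
Proof.
  intros H H' Hs. assert (E : (y - y') * (y + y') = 0) by lra.
  apply Rmult_integral in E. destruct E; lra.
Qed.

Lemma ang_range p : S1 p -> 0 <= ang p < 4.
Proof.
  destruct p as [x y]; unfold S1, ang; simpl; intros H.
  pose proof (unit_bound H).
  destruct (Rle_lt_dec 0 y) as [|Hy]; [lra|]. pose proof (unit_bound_strict H Hy); lra.
Qed.

Lemma ang_inj p q : S1 p -> S1 q -> ang p = ang q -> p = q.
Proof.
  destruct p as [x y], q as [x' y']; unfold S1, ang; simpl; intros H H' E.
  pose proof (unit_bound H). pose proof (unit_bound H').
  destruct (Rle_lt_dec 0 y) as [Hy|Hy], (Rle_lt_dec 0 y') as [Hy'|Hy'].
  - assert (x = x') by lra; subst x'. f_equal. apply (unit_fst_inj H H'); auto.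
  - pose proof (unit_bound_strict H' Hy'); lra.
  - pose proof (unit_bound_strict H Hy); lra.
  - assert (x = x') by lra; subst x'. f_equal. apply (unit_fst_inj H H'); auto.
Qed.

Lemma ang_onto t : 0 <= t < 4 -> exists p, S1 p /\ ang p = t.
Proof.
  intros Ht. destruct (Rle_lt_dec t 2).
  - exists (1 - t, sqrt (1 - (1 - t) * (1 - t))). unfold S1, ang; simpl. split.
    + rewrite sqrt_sqrt by nra. ring.
    + destruct (Rle_lt_dec 0 (sqrt (1 - (1 - t) * (1 - t)))) as [|F]; [ring|].
      pose proof (sqrt_pos (1 - (1 - t) * (1 - t))); lra.
  - exists (t - 3, - sqrt (1 - (t - 3) * (t - 3))). unfold S1, ang; simpl. split.
    + replace (- sqrt (1 - (t - 3) * (t - 3)) * - sqrt (1 - (t - 3) * (t - 3)))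
        with (sqrt (1 - (t - 3) * (t - 3)) * sqrt (1 - (t - 3) * (t - 3))) by ring.
      rewrite sqrt_sqrt by nra. ring.
    + assert (0 < sqrt (1 - (t - 3) * (t - 3))) by (apply sqrt_lt_R0; nra).
      destruct (Rle_lt_dec 0 (- sqrt (1 - (t - 3) * (t - 3)))); lra.
Qed.

Lemma cyc_dist_sym L u v : cyc_dist L u v = cyc_dist L v u.
Proof. unfold cyc_dist. rewrite Rabs_minus_sym; auto. Qed.

Lemma dist2_sym p q : dist2 p q = dist2 q p.
Proof. unfold dist2; ring. Qed.

Lemma sum_sq_bound a b e : a * a + b * b < e * e -> 0 < e -> - e < a < e.
Proof. intros H He. pose proof (Rle_0_sqr b) as Hb; unfold Rsqr in Hb. split; nra. Qed.

Lemma ang_continuous_across p q eps : S1 p -> S1 q -> 0 <= snd p -> snd q < 0 -> 0 < eps <= 1 ->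
  dist2 p q < eps * eps -> cyc_dist 4 (ang p) (ang q) < 3 * eps.
Proof.
  destruct p as [x y], q as [x' y']; unfold S1, dist2, ang; simpl; intros H H' Hy Hy' He Hd.
  destruct (Rle_lt_dec 0 y); [|lra]. destruct (Rle_lt_dec 0 y'); [lra|].
  pose proof (@sum_sq_bound (x - x') (y - y') eps Hd (proj1 He)) as Hx.
  assert (Hyy : - eps < y - y' < eps) by (apply (@sum_sq_bound _ (x - x')); lra).
  assert (Hy2 : y * y < eps * eps) by nra.
  pose proof (unit_bound H) as Hb. pose proof (unit_bound H') as Hb'.
  apply cyc_dist_lt. rewrite Rabs_left1 by lra.
  (* Both points are close to the horizontal axis: near (1, 0) the parameter wraps around, near (-1,
     0) it passes 2 continuously. *)
  destruct (Rle_lt_dec 0 x); [right|left].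
  - assert (1 - x < eps) by nra. lra.
  - assert (1 + x < eps) by nra. lra.
Qed.

Lemma ang_continuous p d : S1 p -> 0 < d -> exists eps, 0 < eps /\
  forall q, S1 q -> dist2 p q < eps * eps -> cyc_dist 4 (ang p) (ang q) < d.
Proof.
  intros Hp Hd. set (eps := Rmin 1 (d / 3)).
  assert (H1 : eps <= 1) by apply Rmin_l. assert (H2 : eps <= d / 3) by apply Rmin_r.
  assert (H0 : 0 < eps) by (apply Rmin_glb_lt; lra).
  exists eps; split; auto. intros q Hq Hpq. apply Rlt_le_trans with (3 * eps); [|lra].
  destruct (Rle_lt_dec 0 (snd p)), (Rle_lt_dec 0 (snd q)).
  - apply cyc_dist_lt; left. unfold dist2, ang in *.
    destruct (Rle_lt_dec 0 (snd p)); [|lra]. destruct (Rle_lt_dec 0 (snd q)); [|lra].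
    destruct (@sum_sq_bound _ _ _ Hpq H0). apply Rabs_def1; lra.
  - apply ang_continuous_across; auto.
  - rewrite cyc_dist_sym. apply ang_continuous_across; auto. rewrite dist2_sym; auto.
  - apply cyc_dist_lt; left. unfold dist2, ang in *.
    destruct (Rle_lt_dec 0 (snd p)); [lra|]. destruct (Rle_lt_dec 0 (snd q)); [lra|].
    destruct (@sum_sq_bound _ _ _ Hpq H0). apply Rabs_def1; lra.
Qed.

Lemma same_side_dist x y x' y' d : x * x + y * y = 1 -> x' * x' + y' * y' = 1 -> 0 <= y * y' ->
  - d < x - x' < d -> d <= 1 -> (x - x') * (x - x') + (y - y') * (y - y') < 10 * d.
Proof.
  intros H H' Hy Hx Hd.
  (* On the same side, the square of [y - y'] is at most |y^2 - y'^2| = |x^2 - x'^2|. *)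
  assert (Hsq : (y - y') * (y - y') <= 2 * d).
  { assert (Hb : -1 <= x <= 1 /\ -1 <= x' <= 1) by (split; eapply unit_bound; eassumption).
    destruct (Rle_lt_dec (y * y) (y' * y')).
    - apply Rle_trans with (y' * y' - y * y); [|nra].
      assert (y * y <= y * y'); [|lra].
      destruct (Rle_lt_dec 0 y); destruct (Rle_lt_dec 0 y'); nra.
    - apply Rle_trans with (y * y - y' * y'); [|nra].
      assert (y' * y' <= y * y'); [|lra].
      destruct (Rle_lt_dec 0 y); destruct (Rle_lt_dec 0 y'); nra. }
  nra.
Qed.

Lemma opposite_side_dist x y x' y' d : x * x + y * y = 1 -> x' * x' + y' * y' = 1 ->
  (2 + x + x' < d \/ 2 - x - x' < d) -> d <= 1 ->
  (x - x') * (x - x') + (y - y') * (y - y') < 10 * d.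
Proof.
  intros H H' Hx Hd.
  assert (Hb : -1 <= x <= 1 /\ -1 <= x' <= 1) by (split; eapply unit_bound; eassumption).
  assert (Hd0 : 0 < d) by lra.
  assert (Hsq : (y - y') * (y - y') <= 2 * (y * y + y' * y')).
  { pose proof (Rle_0_sqr (y + y')) as F; unfold Rsqr in F; nra. }
  assert (y * y <= 2 * d) by (destruct Hx; nra).
  assert (y' * y' <= 2 * d) by (destruct Hx; nra).
  assert ((x - x') * (x - x') < d).
  { assert (- d < x - x' < d) by lra. nra. }
  lra.
Qed.

Lemma ang_open p eps : S1 p -> 0 < eps -> exists d, 0 < d /\
  forall q, S1 q -> cyc_dist 4 (ang p) (ang q) < d -> dist2 p q < eps * eps.
Proof.
  intros Hp He. set (d := Rmin 1 (eps * eps / 10)).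
  assert (H1 : d <= 1) by apply Rmin_l. assert (H2 : d <= eps * eps / 10) by apply Rmin_r.
  assert (H0 : 0 < d) by (apply Rmin_glb_lt; nra).
  exists d; split; auto. intros q Hq Hpq. apply Rlt_le_trans with (10 * d); [|lra].
  apply cyc_dist_lt in Hpq. destruct p as [x y], q as [x' y']; unfold S1, dist2, ang in *; simpl in *.
  assert (Hb : -1 <= x <= 1 /\ -1 <= x' <= 1) by (split; eapply unit_bound; eassumption).
  destruct (Rle_lt_dec 0 y), (Rle_lt_dec 0 y').
  - apply same_side_dist; auto; [nra|].
    destruct Hpq as [Hpq|Hpq]; unfold Rabs in Hpq; destruct (Rcase_abs (1 - x - (1 - x'))); lra.
  - apply opposite_side_dist; auto.
    destruct Hpq as [Hpq|Hpq]; unfold Rabs in Hpq; destruct (Rcase_abs (1 - x - (3 + x'))); lra.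
  - apply opposite_side_dist; auto.
    destruct Hpq as [Hpq|Hpq]; unfold Rabs in Hpq; destruct (Rcase_abs (3 + x - (1 - x'))); lra.
  - apply same_side_dist; auto; [nra|].
    destruct Hpq as [Hpq|Hpq]; unfold Rabs in Hpq; destruct (Rcase_abs (3 + x - (3 + x'))); lra.
Qed.

End Loop.

Section LoopCircle.
Variables (G : graph) (Psi : (ray G -> Prop) -> Prop).
Local Open Scope R_scope.

Lemma openPsi_local_criterion (W : point G -> Prop) : (forall x, W x -> inGPsi Psi x) ->
  (forall x, W x -> exists W', openPsi Psi W' /\ W' x /\ forall y, W' y -> W y) -> openPsi Psi W.
Proof.
  intros Hin H.
  exists (fun x => exists U, openG U /\ U x /\ forall y, U y -> inGPsi Psi y -> W y). split; [split|].
  - intros x (U & [HU _] & Hx & _); auto.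
  - intros x (U & HU & Hx & HUW). destruct (proj2 HU x Hx) as (B & HB & HBx & HBU).
    exists B; split; auto; split; auto. intros y Hy; exists U; auto.
  - intros x; split; [|intros [(U & _ & Hx & HUW) Hx']; auto].
    intros Hx; split; auto. destruct (H x Hx) as (W' & (U & HU & HW') & HW'x & Hsub).
    exists U; split; auto. split; [apply HW'; auto|].
    intros y Hy Hy'; apply Hsub, HW'; auto.
Qed.

(** The last hypothesis is continuity of the inverse, in the form of open sets with a small trace on
    the loop, so no compactness is involved. The angle, scaled from [[0, 4)] to [[0, L)], carries
    the statement over to the unit circle. *)
Lemma loop_is_circle (L : R) (h : R -> point G -> Prop) : 0 < L ->
  (forall u, 0 <= u < L -> is_qpoint Psi (h u)) ->
  (forall u v, 0 <= u < L -> 0 <= v < L -> h u = h v -> u = v) ->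
  (forall U u, openQ Psi U -> 0 <= u < L -> U (h u) -> exists d, 0 < d /\
     forall v, 0 <= v < L -> cyc_dist L u v < d -> U (h v)) ->
  (forall u d, 0 <= u < L -> 0 < d -> exists U, openQ Psi U /\ U (h u) /\
     forall v, 0 <= v < L -> U (h v) -> cyc_dist L u v < d) ->
  is_circle Psi (fun c => exists u, 0 <= u < L /\ h u = c).
Proof.
  intros HL Hq Hinj Hcont Hopen.
  set (par := fun p => L / 4 * ang p).
  assert (Hpar : forall p, S1 p -> 0 <= par p < L).
  { intros p Hp; pose proof (ang_range Hp); unfold par; nra. }
  assert (Hpinj : forall p q, S1 p -> S1 q -> par p = par q -> p = q).
  { intros p q Hp Hq' E. apply ang_inj; auto. apply Rmult_eq_reg_l with (L / 4); auto; lra. }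
  assert (Honto : forall u, 0 <= u < L -> exists p, S1 p /\ par p = u).
  { intros u Hu. destruct (@ang_onto (u * 4 / L)) as (p & Hp & E).
    - split; [apply Rmult_le_pos; [lra|apply Rlt_le, Rinv_0_lt_compat; auto]|].
      apply Rmult_lt_reg_r with L; auto. unfold Rdiv; rewrite Rmult_assoc, Rinv_l; lra.
    - exists p; split; auto. unfold par; rewrite E; field; lra. }
  assert (Hcyc : forall p q, cyc_dist L (par p) (par q) = L / 4 * cyc_dist 4 (ang p) (ang q)).
  { intros p q. rewrite <- cyc_dist_scale by lra. unfold par. f_equal; field. }
  exists (fun p => h (par p)). split; [|split; [|split; [|split]]].
  - intros p Hp; auto.
  - intros p q Hp Hq' E. apply Hpinj, Hinj; auto.
  - intros c; split.
    + intros (u & Hu & <-). destruct (Honto u Hu) as (p & Hp & <-); eauto.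
    + intros (p & Hp & <-). exists (par p); auto.
  - intros U HU; split; [tauto|]. intros p [Hp HUp].
    destruct (Hcont U (par p) HU (Hpar p Hp) HUp) as (d & Hd & H).
    destruct (@ang_continuous p (4 / L * d) Hp) as (eps & He & H').
    { apply Rmult_lt_0_compat; auto. apply Rdiv_lt_0_compat; lra. }
    exists eps; split; auto. intros q Hsq Hdist; split; auto. apply H; auto. rewrite Hcyc.
    specialize (H' q Hsq Hdist). apply (Rmult_lt_compat_l (L / 4)) in H'; [|lra].
    replace (L / 4 * (4 / L * d)) with d in H' by (field; lra). auto.
  - intros W [HWS HW].
    (* The union of all open sets whose trace on the loop lies in the image of [W]. *)
    exists (fun c => exists U, openQ Psi U /\ U c /\
      forall v, 0 <= v < L -> U (h v) -> exists p, W p /\ par p = v).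
    split; [split|].
    + intros c (U & [HU _] & Hc & _); auto.
    + apply openPsi_local_criterion; [tauto|].
      intros x [Hx (U & [HU HU'] & HUx & Hv)].
      exists (fun x => inGPsi Psi x /\ U (qclass Psi x)); split; auto; split; auto.
      intros y [Hy HUy]; split; auto. exists U; split; auto. split; auto.
    + intros c; split.
      * intros (p & HWp & <-). pose proof (HWS p HWp) as Hp.
        split; [|exists (par p); auto].
        destruct (HW p HWp) as (eps & He & H).
        destruct (ang_open Hp He) as (d & Hd & H').
        destruct (Hopen (par p) (L / 4 * d) (Hpar p Hp)) as (U & HU & HUp & HUv); [nra|].
        exists U; split; auto; split; auto. intros v Hv HUhv.
        destruct (Honto v Hv) as (q & Hsq & <-). exists q; split; auto.
        apply H, H'; auto. specialize (HUv _ Hv HUhv). rewrite Hcyc in HUv.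
        apply Rmult_lt_reg_l with (L / 4); auto; lra.
      * intros [(U & HU & HUc & Hv) (u & Hu & <-)].
        destruct (Hv u Hu HUc) as (p & HWp & <-). eauto.
Qed.

End LoopCircle.

(** * Finite circuits of the quotient are circles *)

Definition joins {G : graph} (e : E G) (u v : V G) : Prop :=
  (src e = u /\ tgt e = v) \/ (src e = v /\ tgt e = u).

Lemma joins_sym {G : graph} (e : E G) u v : joins e u v -> joins e v u.
Proof. unfold joins; tauto. Qed.

Section Circuit.
Variables (G : graph) (Psi : (ray G -> Prop) -> Prop).
Local Open Scope R_scope.

Definition vequiv (u v : V G) : Prop := psi_equiv Psi (PV G u) (PV G v).

Lemma vequiv_cut u v A Q : vequiv u v -> cut Psi A Q -> (A u <-> A v).
Proof.
  intros H Hcut. assert (Hu : forall z, VPsi Psi (PV G z)) by (simpl; auto).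
  apply (proj1 (psi_equiv_cut Psi (PV G u) (PV G v) (Hu u) (Hu v)) H A Q Hcut).
Qed.

(** One separating cut for each point of the list; their intersection is again a cut. *)
Lemma separating_cut x (l : list (point G)) : VPsi Psi x ->
  (forall y, In y l -> VPsi Psi y /\ ~ psi_equiv Psi x y) ->
  exists A Q, cut Psi A Q /\ on_side A Q x /\ forall y, In y l -> ~ on_side A Q y.
Proof.
  intros Hx. induction l as [|y l IH]; intros H.
  - exists (fun _ => True), (fun _ => True). split; [intros w _ _; exists nil; tauto|].
    split; [destruct x; simpl; auto; destruct Hx|intros ? []].
  - destruct IH as (A & Q & Hcut & HA & Hl); [intros; apply H; simpl; auto|].
    destruct (H y (or_introl eq_refl)) as [Hy Hxy].
    assert (Hsep : exists A' Q', cut Psi A' Q' /\ on_side A' Q' x /\ ~ on_side A' Q' y).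
    { apply NNPP; intros Hno. apply Hxy, psi_equiv_cut; auto. intros A' Q' Hcut'.
      destruct (classic (on_side A' Q' x)), (classic (on_side A' Q' y)); try tauto; exfalso; apply Hno.
      - exists A', Q'; auto.
      - exists (fun v => ~ A' v), (fun w => ~ Q' w). split; [apply cut_compl; auto|].
        destruct x, y; simpl in *; tauto. }
    destruct Hsep as (A' & Q' & Hcut' & HA' & Hy').
    exists (fun v => A v /\ A' v), (fun w => Q w /\ Q' w). split; [apply cut_and; auto|].
    split; [destruct x; simpl in *; tauto|].
    intros z [<-|Hz]; [destruct y; simpl in *; tauto|].
    specialize (Hl z Hz). destruct z; simpl in *; tauto.
Qed.

(** A closed walk in the quotient: the head of an edge and the tail of the next one are only
    equivalent. Inequivalent tails do not exclude one edge run back and forth when [n] is 2, hence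
    [e_inj]. *)
Variables (n : nat) (e : nat -> E G) (a b : nat -> V G).
Definition next (i : nat) : nat := if Nat.eq_dec (S i) n then 0%nat else S i.
Hypothesis n_pos : (0 < n)%nat.
Hypothesis e_joins : forall i, (i < n)%nat -> joins (e i) (a i) (b i).
Hypothesis heads : forall i, (i < n)%nat -> vequiv (b i) (a (next i)).
Hypothesis tails_inequiv : forall i j, (i < n)%nat -> (j < n)%nat -> vequiv (a i) (a j) -> i = j.
Hypothesis e_inj : forall i j, (i < n)%nat -> (j < n)%nat -> e i = e j -> i = j.

(** Converts the parameter along the walk, from [a i] to [b i], into the parameter of the edge, from
    [src] to [tgt]. *)
Definition pos (i : nat) (s : R) : R :=
  if excluded_middle_informative (src (e i) = a i) then s else 1 - s.

Lemma pos_range i s : 0 < s < 1 -> 0 < pos i s < 1.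
Proof. intros H; unfold pos; destruct (excluded_middle_informative _); lra. Qed.

Lemma pos_dist i s s' : Rabs (pos i s - pos i s') = Rabs (s - s').
Proof.
  unfold pos; destruct (excluded_middle_informative _); auto.
  rewrite Rabs_minus_sym. f_equal; ring.
Qed.

Lemma near_tail i s d : (i < n)%nat -> 0 < s < 1 -> s < d -> near_end G (a i) d (e i) (pos i s).
Proof.
  intros Hi Hs Hd; split; [apply pos_range; auto|]. unfold pos.
  destruct (excluded_middle_informative (src (e i) = a i)) as [H|H]; [left; auto|right].
  destruct (e_joins Hi) as [[H1 H2]|[H1 H2]]; [contradiction|]. split; auto; lra.
Qed.

Lemma near_head i s d : (i < n)%nat -> 0 < s < 1 -> 1 - s < d -> near_end G (b i) d (e i) (pos i s).
Proof.
  intros Hi Hs Hd; split; [apply pos_range; auto|]. unfold pos.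
  destruct (excluded_middle_informative (src (e i) = a i)) as [H|H].
  - right. destruct (e_joins Hi) as [[H1 H2]|[H1 H2]]; auto.
    exfalso; apply (@no_loop G (e i)). congruence.
  - left. destruct (e_joins Hi) as [[H1 H2]|[H1 H2]]; [contradiction|auto].
Qed.

Lemma floor_exists k u : 0 <= u < INR k -> exists i, (i < k)%nat /\ INR i <= u < INR (S i).
Proof.
  intros Hu. induction k as [|m IH]; [simpl in Hu; lra|].
  destruct (Rlt_le_dec u (INR m)) as [H|H].
  - destruct IH as (i & Hi & H'); [lra|]. exists i; split; auto; lia.
  - exists m; split; [lia|]. lra.
Qed.

Lemma floor_unique u i j : INR i <= u < INR (S i) -> INR j <= u < INR (S j) -> i = j.
Proof.
  intros Hi Hj. assert (H : (i < S j)%nat) by (apply INR_lt; lra).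
  assert (H' : (j < S i)%nat) by (apply INR_lt; lra). lia.
Qed.

Definition floor (u : R) : nat := epsilon (inhabits 0%nat) (fun i => INR i <= u < INR (S i)).

Lemma floor_eq u i : INR i <= u < INR (S i) -> floor u = i.
Proof.
  intros H. apply (@floor_unique u); auto. unfold floor.
  apply (epsilon_spec (inhabits 0%nat) (fun i => INR i <= u < INR (S i))). eauto.
Qed.

(* Runs through edge [e i] from [a i] to [b i] on the interval [i, i + 1). *)
Definition circuit (u : R) : point G -> Prop :=
  let i := floor u in
  if Req_dec_T u (INR i) then qclass Psi (PV G (a i)) else qclass Psi (PE G (e i) (pos i (u - INR i))).

Lemma circuit_vertex i : circuit (INR i) = qclass Psi (PV G (a i)).
Proof.
  unfold circuit. rewrite (@floor_eq _ i) by (rewrite S_INR; lra).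
  destruct (Req_dec_T (INR i) (INR i)); congruence.
Qed.

Lemma circuit_edge i s : 0 < s < 1 -> circuit (INR i + s) = qclass Psi (PE G (e i) (pos i s)).
Proof.
  intros Hs. unfold circuit. rewrite (@floor_eq _ i) by (rewrite S_INR; lra).
  destruct (Req_dec_T (INR i + s) (INR i)); [lra|]. replace (INR i + s - INR i) with s by ring. auto.
Qed.

Lemma circuit_cases u : 0 <= u < INR n ->
  exists i, (i < n)%nat /\ (u = INR i \/ exists s, 0 < s < 1 /\ u = INR i + s).
Proof.
  intros Hu. destruct (floor_exists n Hu) as (i & Hi & H). rewrite S_INR in H.
  exists i; split; auto. destruct (Req_dec_T u (INR i)); auto. right.
  exists (u - INR i); split; lra.
Qed.

Lemma INR_gap i j : INR i < INR j -> INR i + 1 <= INR j.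
Proof. intros H. apply INR_lt in H. rewrite <- S_INR. apply le_INR; lia. Qed.

Lemma INR_below i : (i < n)%nat -> 0 <= INR i /\ INR i + 1 <= INR n.
Proof. intros H; split; [apply pos_INR|apply INR_gap, lt_INR; auto]. Qed.

Lemma next_value j : (j < n)%nat -> INR (next j) = INR j + 1 \/ (next j = 0%nat /\ INR j + 1 = INR n).
Proof.
  intros Hj. unfold next. destruct (Nat.eq_dec (S j) n) as [<-|]; [right|left];
    rewrite S_INR; auto.
Qed.

Lemma prev_exists i : (i < n)%nat -> exists j, (j < n)%nat /\ next j = i.
Proof.
  intros Hi. destruct i as [|i].
  - exists (n - 1)%nat; split; [lia|]. unfold next. destruct (Nat.eq_dec (S (n - 1)) n); lia.
  - exists i; split; [lia|]. unfold next. destruct (Nat.eq_dec (S i) n); lia.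
Qed.

Lemma next_inj i j : (i < n)%nat -> (j < n)%nat -> next i = next j -> i = j.
Proof.
  intros Hi Hj. unfold next. destruct (Nat.eq_dec (S i) n), (Nat.eq_dec (S j) n); lia.
Qed.

Lemma abs_cases x : (0 <= x /\ Rabs x = x) \/ (x < 0 /\ Rabs x = - x).
Proof. unfold Rabs; destruct (Rcase_abs x); [right|left]; split; lra. Qed.

Lemma cyc_close_to_vertex i v d : (i < n)%nat -> 0 <= v < INR n -> d <= 1 ->
  cyc_dist (INR n) (INR i) v < d ->
  v = INR i \/ (exists s, 0 < s < 1 /\ s < d /\ v = INR i + s) \/
  (exists j s, (j < n)%nat /\ next j = i /\ 0 < s < 1 /\ 1 - s < d /\ v = INR j + s).
Proof.
  intros Hi Hv Hd Hc. apply cyc_dist_lt in Hc.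
  pose proof (INR_below Hi) as Bi.
  destruct (circuit_cases Hv) as (j & Hj & [->|(s & Hs & ->)]); pose proof (INR_below Hj) as Bj.
  - left. destruct (Rtotal_order (INR i) (INR j)) as [H|[H|H]]; auto;
      apply INR_gap in H; destruct (abs_cases (INR i - INR j)) as [[? E]|[? E]]; rewrite E in Hc; lra.
  - destruct (Rtotal_order (INR i) (INR j)) as [H|[H|H]].
    + apply INR_gap in H. right; right. exists j, s.
      assert (Hj' : INR j + 1 > INR n - 1 + INR i).
      { destruct (abs_cases (INR i - (INR j + s))) as [[? E]|[? E]]; rewrite E in Hc; lra. }
      assert (Ei : i = 0%nat).
      { destruct i as [|i]; auto. exfalso. rewrite S_INR in *. pose proof (pos_INR i). lra. }
      subst i. simpl INR in *.
      assert (Ej : S j = n).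
      { apply INR_eq. rewrite S_INR. destruct (Rtotal_order (INR j + 1) (INR n)) as [F|[F|F]]; auto; [|lra].
        rewrite <- S_INR in F. apply INR_gap in F. rewrite S_INR in F. lra. }
      split; auto. split; [unfold next; destruct (Nat.eq_dec (S j) n); lia|].
      rewrite <- Ej, S_INR in Hc.
      destruct (abs_cases (0 - (INR j + s))) as [[? E]|[? E]]; rewrite E in Hc; repeat split; lra.
    + apply INR_eq in H; subst j.
      assert (E : Rabs (INR i - (INR i + s)) = s) by (rewrite Rabs_left; lra). rewrite E in Hc.
      destruct Hc as [Hc|Hc]; [right; left; exists s; auto|right; right; exists i, s].
      (* Closeness around the loop forces a single edge, whose two endvertices are the same point of
         the quotient. *)
      assert (En : n = 1%nat).
      { assert ((n < 2)%nat) by (apply INR_lt; simpl; lra). lia. }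
      rewrite En in Hc; simpl INR in Hc.
      split; auto. split; [unfold next; destruct (Nat.eq_dec (S i) n); lia|]. repeat split; lra.
    + apply INR_gap in H. right; right. exists j, s.
      assert (E1 : INR i = INR j + 1).
      { apply Rle_antisym; [|lra]. apply Rnot_lt_le; intros F. rewrite <- S_INR in F. apply INR_gap in F.
        rewrite S_INR in F.
        destruct (abs_cases (INR i - (INR j + s))) as [[? E]|[? E]]; rewrite E in Hc; lra. }
      split; auto. split.
      * rewrite <- S_INR in E1. apply INR_eq in E1. unfold next. destruct (Nat.eq_dec (S j) n); lia.
      * destruct (abs_cases (INR i - (INR j + s))) as [[? E]|[? E]]; rewrite E in Hc; repeat split; lra.
Qed.

Lemma cyc_close_to_edge i s v d : (i < n)%nat -> 0 < s < 1 -> 0 <= v < INR n -> d <= s -> d <= 1 - s ->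
  cyc_dist (INR n) (INR i + s) v < d ->
  exists s', 0 < s' < 1 /\ Rabs (s' - s) < d /\ v = INR i + s'.
Proof.
  intros Hi Hs Hv Hd1 Hd2 Hc. apply cyc_dist_lt in Hc. pose proof (INR_below Hi) as Bi.
  exists (v - INR i).
  destruct (abs_cases (INR i + s - v)) as [[? E]|[? E]]; rewrite E in Hc.
  - destruct Hc; [|lra]. repeat split; try lra. apply Rabs_def1; lra.
  - destruct Hc; [|lra]. repeat split; try lra. apply Rabs_def1; lra.
Qed.

Lemma circuit_qpoint u : 0 <= u < INR n -> is_qpoint Psi (circuit u).
Proof.
  intros Hu. destruct (circuit_cases Hu) as (i & Hi & [->|(s & Hs & ->)]).
  - exists (PV G (a i)); split; [split; simpl; auto|apply circuit_vertex].
  - exists (PE G (e i) (pos i s)); split; [apply edge_in_GPsi, pos_range; auto|apply circuit_edge; auto].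
Qed.

Lemma vertex_edge_class v g s : qclass Psi (PV G v) <> qclass Psi (PE G g s).
Proof.
  intros E. apply qclass_eq in E; [|split; simpl; auto]. destruct E as [E|(_ & [] & _)]; discriminate.
Qed.

Lemma circuit_inj u v : 0 <= u < INR n -> 0 <= v < INR n -> circuit u = circuit v -> u = v.
Proof.
  intros Hu Hv.
  destruct (circuit_cases Hu) as (i & Hi & [->|(s & Hs & ->)]);
  destruct (circuit_cases Hv) as (j & Hj & [->|(s' & Hs' & ->)]);
    rewrite ?circuit_vertex, ?circuit_edge by auto; intros E.
  - apply qclass_eq in E; [|split; simpl; auto]. f_equal. apply tails_inequiv; auto.
    destruct E as [E|(_ & _ & E)]; [injection E as ->; apply psi_equiv_refl|exact E].
  - apply vertex_edge_class in E; tauto.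
  - symmetry in E; apply vertex_edge_class in E; tauto.
  - apply edge_class_inj in E as [E1 E2]; [|apply pos_range; auto]. apply e_inj in E1; auto. subst j.
    f_equal. pose proof (pos_dist i s s') as F. rewrite E2, Rminus_diag, Rabs_R0 in F.
    destruct (abs_cases (s - s')) as [[? E]|[? E]]; rewrite E in F; lra.
Qed.

Lemma circuit_continuous U u : openQ Psi U -> 0 <= u < INR n -> U (circuit u) ->
  exists d, 0 < d /\ forall v, 0 <= v < INR n -> cyc_dist (INR n) u v < d -> U (circuit v).
Proof.
  intros [_ HU] Hu HUu. apply openPsi_local in HU as (_ & HE & HV & _).
  destruct (circuit_cases Hu) as (i & Hi & [->|(s & Hs & ->)]).
  - rewrite circuit_vertex in HUu.
    destruct (HV (a i)) as (d1 & Hd1 & H1); [split; [split; simpl; auto|auto]|].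
    destruct (prev_exists Hi) as (j & Hj & Hji).
    destruct (HV (b j)) as (d2 & Hd2 & H2).
    { split; [split; simpl; auto|]. replace (qclass Psi (PV G (b j))) with (qclass Psi (PV G (a i))); auto.
      apply qclass_eq; [split; simpl; auto|]. right; repeat apply conj; simpl; auto.
      apply psi_equiv_sym. rewrite <- Hji. apply heads; auto. }
    exists (Rmin d1 d2); split; [apply Rmin_glb_lt; tauto|]. intros v Hv Hc.
    pose proof (Rmin_l d1 d2). pose proof (Rmin_r d1 d2).
    apply cyc_close_to_vertex in Hc as [->|[(s & Hs & Hsd & ->)|(k & s & Hk & Hki & Hs & Hsd & ->)]]; auto; [| | |lra].
    + rewrite circuit_vertex; auto.
    + rewrite circuit_edge by auto. apply H1, near_tail; auto; lra.
    + assert (k = j) by (apply next_inj; congruence). subst k.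
      rewrite circuit_edge by auto. apply H2, near_head; auto; lra.
  - rewrite circuit_edge in HUu by auto.
    destruct (HE (e i) (pos i s)) as (d & Hd & H); [split; auto; apply edge_in_GPsi, pos_range; auto|].
    set (d' := Rmin d (Rmin s (1 - s))).
    assert (H1 : d' <= d) by apply Rmin_l.
    assert (H2 : d' <= s) by (unfold d'; eapply Rle_trans; [apply Rmin_r|apply Rmin_l]).
    assert (H3 : d' <= 1 - s) by (unfold d'; eapply Rle_trans; [apply Rmin_r|apply Rmin_r]).
    exists d'; split; [unfold d'; repeat apply Rmin_glb_lt; lra|]. intros v Hv Hc.
    apply cyc_close_to_edge in Hc as (s' & Hs' & Habs & ->); auto.
    rewrite circuit_edge by auto. apply H; [|apply pos_range; auto]. rewrite pos_dist; lra.
Qed.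

(** At a vertex, a cut isolates the class of [a i] from all other tails, and [outside_interval]
    removes the middle of every edge of the circuit. What remains of the circuit are pieces shorter
    than [d'] next to this class. *)
Lemma circuit_open u d : 0 <= u < INR n -> 0 < d -> exists U, openQ Psi U /\ U (circuit u) /\
  forall v, 0 <= v < INR n -> U (circuit v) -> cyc_dist (INR n) u v < d.
Proof.
  intros Hu Hd. destruct (circuit_cases Hu) as (i & Hi & [->|(s & Hs & ->)]).
  - destruct (@separating_cut (PV G (a i)) (map (fun j => PV G (a j)) (filterP (fun j => j <> i) (seq 0 n))))
      as (A & Q & Hcut & HA & Hother).
    { simpl; auto. }
    { intros y Hy. apply in_map_iff in Hy as (j & <- & Hj). apply filterP_In in Hj as [Hj N].
      apply in_seq in Hj. split; [simpl; auto|]. intros F. apply N; symmetry; apply tails_inequiv; auto; lia. }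
    assert (HA' : forall j, (j < n)%nat -> A (a j) -> j = i).
    { intros j Hj HAj. apply NNPP; intros N. apply (Hother (PV G (a j))); auto.
      apply (in_map (fun j => PV G (a j))), filterP_In. split; auto. apply in_seq; lia. }
    assert (HB : forall j, (j < n)%nat -> A (b j) -> next j = i).
    { intros j Hj HBj. apply HA'.
      - unfold next; destruct (Nat.eq_dec (S j) n); lia.
      - apply (vequiv_cut (heads Hj) Hcut); auto. }
    set (d' := Rmin d (1 / 4)).
    assert (H1 : d' <= d) by apply Rmin_l. assert (H2 : d' <= 1 / 4) by apply Rmin_r.
    assert (H0 : 0 < d') by (apply Rmin_glb_lt; lra).
    set (W := outside_interval (side_points Psi A Q (fun _ => 1 / 2)) (map e (seq 0 n)) d' (1 - d')).
    assert (HW : local_open Psi W).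
    { apply outside_interval_open; try lra. apply (@side_points_open _ _ _ _ _ (1 / 2)); auto; intros; lra. }
    assert (HWs : saturated Psi W) by (apply outside_interval_saturated, side_points_saturated; auto).
    exists (image_of Psi W). split; [apply image_of_open; auto|split].
    + rewrite circuit_vertex. exists (PV G (a i)); split; auto. split; [exact HA|intros; discriminate].
    + intros v Hv HU. apply cyc_dist_lt.
      destruct (circuit_cases Hv) as (j & Hj & [->|(s & Hs & ->)]).
      * rewrite circuit_vertex in HU.
        apply image_of_iff in HU; auto; [|apply HW|split; simpl; auto].
        rewrite (HA' j); auto; [|apply HU]. left. rewrite Rminus_diag, Rabs_R0; auto.
      * rewrite circuit_edge in HU by auto. pose proof (pos_range j Hs) as Hp.
        apply image_of_iff in HU; auto; [|apply HW|apply edge_in_GPsi; auto].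
        destruct HU as [[_ HU] Hout].
        assert (Hout' : ~ d' <= pos j s <= 1 - d').
        { apply (Hout (e j)); auto. apply in_map, in_seq; lia. }
        assert (Hcase : (s < d' /\ A (a j)) \/ (1 - s < d' /\ A (b j))).
        { unfold pos in *. destruct (excluded_middle_informative (src (e j) = a j)) as [F|F];
            destruct (e_joins Hj) as [[F1 F2]|[F1 F2]]; try contradiction.
          - rewrite F1, F2 in HU. destruct (Rlt_le_dec s d'); [left|right]; split; auto; try lra;
              destruct HU as [HU|[HU|HU]]; try tauto; lra.
          - exfalso; apply (@no_loop G (e j)); congruence.
          - rewrite F1, F2 in HU. destruct (Rlt_le_dec s d'); [left|right]; split; auto; try lra;
              destruct HU as [HU|[HU|HU]]; try tauto; lra. }
        destruct Hcase as [[Hsd HAj]|[Hsd HBj]].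
        -- rewrite (HA' j) by auto. left. apply Rabs_def1; lra.
        -- apply HB in HBj; auto. destruct (next_value Hj) as [F|[F1 F2]].
           ++ rewrite HBj in F. left. apply Rabs_def1; lra.
           ++ right. rewrite <- HBj, F1; simpl INR. rewrite Rabs_left1; pose proof (pos_INR j); lra.
  - exists (image_of Psi (edge_interval (e i) (pos i s - d) (pos i s + d))).
    assert (Hp := pos_range i Hs). split; [|split].
    + apply image_of_open; [apply edge_interval_open|apply edge_interval_saturated].
    + rewrite circuit_edge by auto. apply edge_interval_class; auto; lra.
    + intros v Hv (x & (r & -> & Hr & Hrd) & E).
      destruct (circuit_cases Hv) as (j & Hj & [->|(s' & Hs' & ->)]).
      * rewrite circuit_vertex in E. apply vertex_edge_class in E; tauto.
      * rewrite circuit_edge in E by auto. apply edge_class_inj in E as [E1 E2]; [|apply pos_range; auto].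
        apply e_inj in E1; auto. subst j r. apply cyc_dist_lt. left.
        replace (INR i + s - (INR i + s')) with (s - s') by ring. rewrite <- (pos_dist i).
        apply Rabs_def1; lra.
Qed.

Theorem finite_circuit_dependent (F : E G -> Prop) : (forall i, (i < n)%nat -> F (e i)) -> ~ psi_indep Psi F.
Proof.
  intros HF Hind. apply Hind. exists (fun c => exists u, 0 <= u < INR n /\ circuit u = c). split.
  - apply loop_is_circle.
    + apply (lt_INR 0); auto.
    + apply circuit_qpoint.
    + apply circuit_inj.
    + apply circuit_continuous.
    + apply circuit_open.
  - intros g Hg. destruct (Hg (1 / 2)) as (u & Hu & E); [lra|].
    destruct (circuit_cases Hu) as (i & Hi & [->|(s & Hs & ->)]).
    + rewrite circuit_vertex in E. apply vertex_edge_class in E; tauto.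
    + rewrite circuit_edge in E by auto. apply edge_class_inj in E as [<- _]; auto. apply pos_range; auto.
Qed.

End Circuit.

(** * Forests in the quotient *)

Section Forest.
Variables (G : graph) (Psi : (ray G -> Prop) -> Prop).
Implicit Types (J : E G -> Prop) (Rs : list (ray G)).

Definition edge_in J (u v : V G) : Prop := exists g, J g /\ joins g u v.

Definition tail_in J (r : ray G) (t : nat) : Prop :=
  forall s, t <= s -> edge_in J (rv r s) (rv r (S s)).

Definition link J Rs (v : V G) (w : ray G -> Prop) : Prop :=
  exists r t, In r Rs /\ v = rv r t /\ w = ray_equiv r /\ Psi w /\ tail_in J r t.

(** A jump between equivalent points must have an end on one side. Hence a connection that leaves a
    component of the edge set does so towards an end, which [conn_first] relies on. *)
Definition step J Rs (x y : point G) : Prop :=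
  (exists u v, x = PV G u /\ y = PV G v /\ edge_in J u v) \/
  (VPsi Psi x /\ VPsi Psi y /\ psi_equiv Psi x y /\ exists w, x = PO w \/ y = PO w) \/
  (exists v w, link J Rs v w /\ ((x = PV G v /\ y = PO w) \/ (x = PO w /\ y = PV G v))).

(* Connectedness in the quotient of the graph with edge set [J], where the rays of [Rs]
   with a tail in [J] are joined to their ends and all other rays are not. *)
Definition conn J Rs : point G -> point G -> Prop := clos_refl_trans _ (step J Rs).

Definition minus J (e : E G) : E G -> Prop := fun g => J g /\ g <> e.

Definition forest Rs J : Prop :=
  forall e, J e -> ~ conn (minus J e) Rs (PV G (src e)) (PV G (tgt e)).

Lemma edge_in_sym J u v : edge_in J u v -> edge_in J v u.
Proof. intros (g & Hg & H); exists g; auto using joins_sym. Qed.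

Lemma edge_in_mono J J' u v : (forall g, J g -> J' g) -> edge_in J u v -> edge_in J' u v.
Proof. intros H (g & Hg & Hj); exists g; auto. Qed.

Lemma step_sym J Rs x y : step J Rs x y -> step J Rs y x.
Proof.
  intros [(u & v & -> & -> & H)|[(H1 & H2 & H3 & w & H)|(v & w & H & H')]].
  - left; exists v, u; auto using edge_in_sym.
  - right; left. repeat apply conj; auto using psi_equiv_sym. exists w; tauto.
  - right; right; exists v, w; tauto.
Qed.

Lemma conn_refl J Rs x : conn J Rs x x.
Proof. apply rt_refl. Qed.

Lemma conn_sym J Rs x y : conn J Rs x y -> conn J Rs y x.
Proof.
  intros H; induction H; [apply rt_step, step_sym; auto|apply rt_refl|eapply rt_trans; eauto].
Qed.

Lemma conn_trans J Rs x y z : conn J Rs x y -> conn J Rs y z -> conn J Rs x z.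
Proof. apply rt_trans. Qed.

Lemma conn_edge J Rs u v : edge_in J u v -> conn J Rs (PV G u) (PV G v).
Proof. intros H; apply rt_step; left; eauto. Qed.

Lemma conn_jump J Rs x w : VPsi Psi x -> VPsi Psi (PO w) -> psi_equiv Psi x (PO w) ->
  conn J Rs x (PO w).
Proof. intros H1 H2 H3; apply rt_step; right; left; eauto 6. Qed.

Lemma conn_link J Rs v w : link J Rs v w -> conn J Rs (PV G v) (PO w).
Proof. intros H; apply rt_step; right; right; exists v, w; auto. Qed.

Lemma link_mono J J' Rs v w : (forall g, J g -> J' g) -> link J Rs v w -> link J' Rs v w.
Proof.
  intros H (r & t & Hr & Hv & Hw & Hp & Ht). exists r, t; repeat apply conj; auto.
  intros s Hs; eapply edge_in_mono; eauto.
Qed.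

Lemma conn_mono J J' Rs x y : (forall g, J g -> J' g) -> conn J Rs x y -> conn J' Rs x y.
Proof.
  intros H Hc; induction Hc as [x y Hs| |x y z]; [|apply rt_refl|eapply rt_trans; eauto].
  apply rt_step. destruct Hs as [(u & v & Hx & Hy & He)|[Hj|(v & w & Hl & H')]].
  - left; exists u, v; eauto using edge_in_mono.
  - right; left; auto.
  - right; right; exists v, w; eauto using link_mono.
Qed.

Lemma forest_mono Rs J J' : (forall g, J' g -> J g) -> forest Rs J -> forest Rs J'.
Proof.
  intros H HF e He Hc. apply (HF e); auto. eapply conn_mono; [|exact Hc].
  intros g [Hg N]; split; auto.
Qed.

Lemma forest_bridge Rs J g u v : forest Rs J -> J g -> joins g u v ->
  ~ conn (minus J g) Rs (PV G u) (PV G v).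
Proof.
  intros HF Hg [[<- <-]|[<- <-]] Hc; apply (HF g); auto. apply conn_sym; auto.
Qed.

Lemma conn_tail J Rs r t m : tail_in J r t -> t <= m -> conn J Rs (PV G (rv r t)) (PV G (rv r m)).
Proof.
  intros Ht Hle; induction Hle as [|m Hle IH]; [apply conn_refl|].
  eapply conn_trans; [exact IH|]. apply conn_edge, Ht; auto.
Qed.

(** ** Finitely independent sets are forests *)

Fixpoint qwalk J (a : V G) (l : list (E G * V G * V G)) (b : V G) : Prop :=
  match l with
  | nil => vequiv Psi a b
  | (g, u, v) :: l' => vequiv Psi a u /\ J g /\ joins g u v /\ qwalk J v l' b
  end.

Definition tail_of (x : E G * V G * V G) : V G := snd (fst x).
Definition head_of (x : E G * V G * V G) : V G := snd x.
Definition edge_of (x : E G * V G * V G) : E G := fst (fst x).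

(** The last vertex [b] counts as a further tail, because the walk is going to be closed up by an
    edge with tail [b]. *)
Fixpoint simple (l : list (E G * V G * V G)) (b : V G) : Prop :=
  match l with
  | nil => True
  | x :: l' => ~ vequiv Psi (tail_of x) b /\
      (forall y, In y l' -> ~ vequiv Psi (tail_of x) (tail_of y)) /\ simple l' b
  end.

Lemma vequiv_refl v : vequiv Psi v v.
Proof. apply psi_equiv_refl. Qed.

Lemma vequiv_sym u v : vequiv Psi u v -> vequiv Psi v u.
Proof. apply psi_equiv_sym. Qed.

Lemma vequiv_trans u v x : vequiv Psi u v -> vequiv Psi v x -> vequiv Psi u x.
Proof. apply psi_equiv_trans. Qed.

Lemma qwalk_end J a l b c : qwalk J a l b -> vequiv Psi b c -> qwalk J a l c.
Proof.
  intros H Hbc. revert a H; induction l as [|[[g u] v] l IH]; simpl; intros a H.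
  - eapply vequiv_trans; eauto.
  - destruct H as (H1 & H2 & H3 & H4); auto.
Qed.

Lemma qwalk_start J a a' l b : vequiv Psi a a' -> qwalk J a' l b -> qwalk J a l b.
Proof.
  intros Ha. destruct l as [|[[g u] v] l]; simpl; intros H.
  - eapply vequiv_trans; eauto.
  - destruct H as (H1 & H2); split; auto. eapply vequiv_trans; eauto.
Qed.

Lemma qwalk_snoc J a l b g v : qwalk J a l b -> J g -> joins g b v ->
  qwalk J a (l ++ (g, b, v) :: nil) v.
Proof.
  intros H Hg Hj. revert a H; induction l as [|[[g' u'] v'] l IH]; simpl; intros a H.
  - auto using vequiv_refl.
  - destruct H as (H1 & H2 & H3 & H4); auto.
Qed.

(** With no rays joined, an excursion through ends is a chain of equivalences and collapses to a
    single one. *)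
Lemma conn_qwalk J u z : conn J nil (PV G u) z ->
  match z with
  | PV _ v => exists l, qwalk J u l v
  | PO w => exists v l, qwalk J u l v /\ psi_equiv Psi (PV G v) (PO w)
  | PE _ _ _ => False
  end.
Proof.
  intros H. apply clos_rt_rtn1 in H. induction H as [|y z Hs Hc IH].
  - exists nil. apply vequiv_refl.
  - destruct Hs as [(a & b & -> & -> & (g & Hg & Hj))|[(H1 & H2 & H3 & w & H)|(v & w & (r & t & [] & _) & _)]].
    + destruct IH as [l Hl]. exists (l ++ (g, a, b) :: nil). apply qwalk_snoc; auto.
    + destruct y as [y|y|], z as [z|z|]; try tauto.
      * destruct H; discriminate.
      * destruct IH as [l Hl]; eauto.
      * destruct IH as (v & l & Hl & Hv). exists l. apply (@qwalk_end J u l v z Hl).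
        eapply psi_equiv_trans; eauto.
      * destruct IH as (v & l & Hl & Hv). exists v, l; split; auto. eapply psi_equiv_trans; eauto.
Qed.

Lemma qwalk_suffix J a l1 x l2 b : qwalk J a (l1 ++ x :: l2) b -> qwalk J (tail_of x) (x :: l2) b.
Proof.
  revert a; induction l1 as [|[[g u] v] l1 IH]; simpl; intros a H.
  - destruct x as [[g u] v]; simpl in *. unfold tail_of; simpl. split; [apply vequiv_refl|tauto].
  - destruct H as (_ & _ & _ & H). eapply IH; eauto.
Qed.

Lemma simple_suffix l1 l2 b : simple (l1 ++ l2) b -> simple l2 b.
Proof. induction l1; simpl; tauto. Qed.

Lemma qwalk_simple J a l b : qwalk J a l b -> exists l', qwalk J a l' b /\ simple l' b.
Proof.
  revert a; induction l as [|[[g u] v] l IH]; intros a H.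
  - exists nil; simpl; auto.
  - destruct H as (H1 & H2 & H3 & H4). destruct (IH v H4) as (l' & Hl' & Hs).
    destruct (classic (vequiv Psi u b)) as [Hub|Hub].
    { exists nil; simpl; split; auto. eapply vequiv_trans; eauto. }
    destruct (classic (exists y, In y l' /\ vequiv Psi u (tail_of y))) as [(y & Hy & Huy)|Hno].
    + apply in_split in Hy as (l1 & l2 & ->). exists (y :: l2). split.
      * apply (@qwalk_start J a (tail_of y)); [eapply vequiv_trans; eauto|].
        eapply qwalk_suffix; eauto.
      * eapply simple_suffix; eauto.
    + exists ((g, u, v) :: l'). split; [simpl; auto|]. simpl; split; auto. split; auto.
      intros y Hy Huy; apply Hno; eauto.
Qed.

Lemma qwalk_heads J d l b g u v : qwalk J v l b -> let L := (g, u, v) :: l in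
  forall i, i < length L ->
    vequiv Psi (head_of (nth i L d)) (if Nat.eq_dec (S i) (length L) then b else tail_of (nth (S i) L d)).
Proof.
  revert g u v; induction l as [|[[g' u'] v'] l IH]; intros g u v H L i Hi; subst L.
  - simpl in Hi. assert (i = 0) by lia; subst i. simpl. exact H.
  - destruct H as (H1 & H2 & H3 & H4). destruct i as [|i].
    + simpl. exact H1.
    + specialize (IH g' u' v' H4 i). cbn zeta in IH.
      change (nth (S i) ((g, u, v) :: (g', u', v') :: l) d) with (nth i ((g', u', v') :: l) d).
      change (nth (S (S i)) ((g, u, v) :: (g', u', v') :: l) d) with (nth (S i) ((g', u', v') :: l) d).
      change (length ((g, u, v) :: (g', u', v') :: l)) with (S (length ((g', u', v') :: l))) in *.
      destruct (Nat.eq_dec (S (S i)) (S (length ((g', u', v') :: l)))),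
        (Nat.eq_dec (S i) (length ((g', u', v') :: l))); try lia; apply IH; lia.
Qed.

Lemma qwalk_in J a l b x : qwalk J a l b -> In x l -> J (edge_of x) /\ joins (edge_of x) (tail_of x) (head_of x).
Proof.
  revert a; induction l as [|[[g u] v] l IH]; simpl; intros a H; [intros []|].
  destruct H as (H1 & H2 & H3 & H4). intros [<-|Hx]; [auto|eapply IH; eauto].
Qed.

Lemma simple_nth d l b i j : simple l b -> i < length l -> j < length l -> i < j ->
  ~ vequiv Psi (tail_of (nth i l d)) (tail_of (nth j l d)).
Proof.
  revert i j; induction l as [|x l IH]; simpl; intros i j H Hi Hj Hij; [lia|].
  destruct H as (H1 & H2 & H3). destruct j as [|j]; [lia|]. destruct i as [|i].
  - apply H2, nth_In; lia.
  - apply IH; auto; lia.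
Qed.

Lemma simple_end l b x : simple l b -> In x l -> ~ vequiv Psi (tail_of x) b.
Proof.
  induction l as [|y l IH]; simpl; [intros _ []|]. intros (H1 & H2 & H3) [<-|Hx]; auto.
Qed.

Lemma joins_twice (g : E G) u v u' v' : joins g u v -> joins g u' v' -> u <> u' -> u = v' /\ v = u'.
Proof. intros [[H1 H2]|[H1 H2]] [[H3 H4]|[H3 H4]] N; split; congruence. Qed.

Lemma fin_indep_forest F : fin_indep (psi_indep Psi) F -> forest nil F.
Proof.
  intros Hfin e He Hc. apply conn_sym, conn_qwalk in Hc as [l Hl].
  apply qwalk_simple in Hl as (l' & Hl' & Hs). clear l; rename l' into l.
  set (d := (e, src e, tgt e)). set (L := d :: l). set (n := length L).
  set (ed := fun i => edge_of (nth i L d)). set (ta := fun i => tail_of (nth i L d)).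
  set (he := fun i => head_of (nth i L d)).
  assert (Hcase : forall i, i < n -> nth i L d = d /\ i = 0 \/ In (nth i L d) l /\ i <> 0).
  { intros [|i] Hi; [left; auto|right]. split; [|lia]. apply (nth_In l). unfold n, L in Hi; simpl in Hi; lia. }
  assert (Hjoin : forall i, i < n -> joins (ed i) (ta i) (he i)).
  { intros i Hi. unfold ed, ta, he. destruct (Hcase i Hi) as [[-> _]|[H _]].
    - left; auto.
    - apply (qwalk_in _ _ _ _ _ Hl' H). }
  assert (Hhead : forall i, i < n -> vequiv Psi (he i) (ta (next n i))).
  { intros i Hi. pose proof (@qwalk_heads (minus F e) d l (src e) e (src e) (tgt e) Hl' i Hi) as H.
    fold d in H; fold L in H; fold n in H. unfold he, ta, next. destruct (Nat.eq_dec (S i) n); exact H. }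
  assert (Htail : forall i j, i < n -> j < n -> vequiv Psi (ta i) (ta j) -> i = j).
  { assert (Hlt : forall i j, i < n -> j < n -> i < j -> ~ vequiv Psi (ta i) (ta j)).
    { intros i j Hi Hj Hij. unfold ta. destruct i as [|i].
      - destruct (Hcase j Hj) as [[_ ->]|[H _]]; [lia|]. intros F0. apply vequiv_sym in F0.
        exact (simple_end l _ Hs H F0).
      - destruct j as [|j]; [lia|]. unfold n, L in Hi, Hj; simpl in Hi, Hj.
        apply (@simple_nth d l (src e)); auto; lia. }
    intros i j Hi Hj H. destruct (lt_eq_lt_dec i j) as [[Hij|]|Hij]; auto; exfalso.
    - apply (Hlt i j); auto.
    - apply (Hlt j i); auto. apply vequiv_sym, H. }
  assert (Hnext : forall i, i < n -> next n i < n).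
  { intros i Hi. unfold next. destruct (Nat.eq_dec (S i) n); lia. }
  (* A repeated edge is run in both directions, so its two indices follow each other both ways and
     one of them is 0. But [e], at index 0, does not occur in the walk through [minus F e]. *)
  assert (Hedge : forall i j, i < n -> j < n -> ed i = ed j -> i = j).
  { intros i j Hi Hj E0. apply NNPP; intros N.
    assert (Nt : ta i <> ta j).
    { intros Et; apply N, Htail; auto. rewrite Et; apply vequiv_refl. }
    pose proof (Hjoin j Hj) as Hjj. rewrite <- E0 in Hjj.
    destruct (joins_twice (Hjoin i Hi) Hjj Nt) as [E1 E2].
    assert (F1 : i = next n j) by (apply Htail; auto; rewrite E1; apply Hhead; auto).
    assert (F2 : j = next n i) by (apply Htail; auto; rewrite <- E2; apply Hhead; auto).
    assert (H0 : i = 0 \/ j = 0).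
    { unfold next in F1, F2. destruct (Nat.eq_dec (S i) n), (Nat.eq_dec (S j) n); lia. }
    assert (He' : forall k, k < n -> k <> 0 -> ed k <> ed 0).
    { intros k Hk Nk. destruct (Hcase k Hk) as [[_ ->]|[H _]]; [lia|].
      apply (qwalk_in _ _ _ _ _ Hl' H). }
    destruct H0 as [->| ->].
    - apply (He' j); auto.
    - apply (He' i); auto. }
  apply (@finite_circuit_dependent G Psi n ed ta he) with (F := fun g => In g (map edge_of L)); auto.
  - unfold n, L; simpl; lia.
  - intros i Hi. apply (in_map edge_of), nth_In; auto.
  - apply Hfin.
    + intros g Hg. apply in_map_iff in Hg as (x & <- & [<-|Hx]); [exact He|].
      apply (qwalk_in _ _ _ _ _ Hl' Hx).
    + exists (map edge_of L); auto.
Qed.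

(** ** Joining rays to their ends *)

(** Any two vertices at which [r] may be linked to its end are joined by [r] inside [J], so the new
    link has to be used at most once. *)
Lemma conn_add_ray J Rs r x y : let w := ray_equiv r in conn J (r :: Rs) x y ->
  conn J Rs x y \/
  (exists t, tail_in J r t /\ conn J Rs x (PV G (rv r t)) /\ conn J Rs y (PO w)) \/
  (exists t, tail_in J r t /\ conn J Rs x (PO w) /\ conn J Rs y (PV G (rv r t))).
Proof.
  intros w H. apply clos_rt_rt1n in H. induction H as [x|x y z Hs Hc IH].
  - left; apply conn_refl.
  - assert (Htt : forall t t', tail_in J r t -> tail_in J r t' ->
      conn J Rs (PV G (rv r t)) (PV G (rv r t'))).
    { intros t t' Ht Ht'. destruct (le_ge_dec t t'); [|apply conn_sym]; apply conn_tail; auto. }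
    assert (Hcase : step J Rs x y \/ exists t, tail_in J r t /\
      ((x = PV G (rv r t) /\ y = PO w) \/ (x = PO w /\ y = PV G (rv r t)))).
    { destruct Hs as [Hs|[Hs|(v & w' & (r' & t & [<-|Hr] & -> & -> & Hp & Ht) & Hxy)]].
      - left; left; auto.
      - left; right; left; auto.
      - right; exists t; auto.
      - left; right; right. exists (rv r' t), (ray_equiv r'). split; auto.
        exists r', t; auto. }
    destruct Hcase as [Hs'|(t & Ht & [[-> ->]|[-> ->]])].
    + apply (rt_step _ (step J Rs)) in Hs'.
      destruct IH as [IH|[(t & Ht & H1 & H2)|(t & Ht & H1 & H2)]].
      * left; eapply conn_trans; eauto.
      * right; left; exists t; repeat apply conj; auto; eapply conn_trans; eauto.
      * right; right; exists t; repeat apply conj; auto; eapply conn_trans; eauto.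
    + destruct IH as [IH|[(t' & Ht' & H1 & H2)|(t' & Ht' & H1 & H2)]].
      * right; left; exists t; repeat apply conj; auto using conn_refl, conn_sym.
      * right; left; exists t; repeat apply conj; auto using conn_refl.
      * left. eapply conn_trans; [apply (Htt t t')|]; auto using conn_sym.
    + destruct IH as [IH|[(t' & Ht' & H1 & H2)|(t' & Ht' & H1 & H2)]].
      * right; right; exists t; repeat apply conj; auto using conn_refl, conn_sym.
      * left; apply conn_sym; auto.
      * right; right; exists t'; repeat apply conj; auto using conn_refl.
Qed.

Definition ray_edge (r : ray G) (g : E G) : Prop := exists t, joins g (rv r t) (rv r (S t)).

Definition avoiding J (r : ray G) : E G -> Prop := fun g => J g /\ ~ ray_edge r g.

Lemma joins_det (g : E G) u v u' v' : joins g u v -> joins g u' v' -> (u = u' /\ v = v') \/ (u = v' /\ v = u').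
Proof. intros [[<- <-]|[<- <-]] [[<- <-]|[<- <-]]; auto. Qed.

Lemma tail_avoiding J r r' t : disjoint_rays r r' -> tail_in J r' t -> tail_in (avoiding J r) r' t.
Proof.
  intros Hd Ht s Hs. destruct (Ht s Hs) as (g & Hg & Hj). exists g; split; auto. split; auto.
  intros [m Hm]. destruct (joins_det Hj Hm) as [[E0 _]|[E0 _]]; exact (Hd _ _ (eq_sym E0)).
Qed.

(** Only the part of the connection after its last edge of [r] is kept. The links of [Rs] survive
    without the edges of [r], as their rays are disjoint from [r]. *)
Lemma last_ray_vertex J Rs r x z : (forall r', In r' Rs -> disjoint_rays r r') -> conn J Rs x z ->
  conn (avoiding J r) Rs x z \/ exists t, conn (avoiding J r) Rs (PV G (rv r t)) z.
Proof.
  intros Hd H. apply clos_rt_rt1n in H. induction H as [x|x y z Hs Hc IH].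
  - left; apply conn_refl.
  - destruct IH as [IH|IH]; auto.
    destruct Hs as [(u & v & -> & -> & (g & Hg & Hj))|[Hs|(v & w & Hl & Hxy)]].
    + destruct (classic (ray_edge r g)) as [[t Ht]|Hn].
      * right. destruct (joins_det Hj Ht) as [[_ E0]|[_ E0]]; rewrite E0 in IH; eauto.
      * left. eapply conn_trans; [|exact IH]. apply conn_edge. exists g; repeat split; auto.
    + left. eapply conn_trans; [|exact IH]. apply rt_step; right; left; auto.
    + left. eapply conn_trans; [|exact IH]. apply rt_step; right; right. exists v, w; split; auto.
      destruct Hl as (r' & t & Hr & Hv & Hw & Hp & Ht). exists r', t; repeat apply conj; auto.
      apply tail_avoiding; auto.
Qed.

Lemma forest_add_ray J Rs r : forest Rs J -> (forall r', In r' Rs -> disjoint_rays r r') -> tail_in J r 0 ->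
  exists J', (forall g, J' g -> J g) /\ forest (r :: Rs) J' /\
    (exists t, tail_in J' r t) /\
    exists l, length l <= 1 /\ forall g, J g -> ~ J' g -> ray_edge r g /\ In g l.
Proof.
  intros HF Hd Hr. set (w := ray_equiv r).
  (* A new cycle through [e] uses the link, and the rest of it, with [e], joins [r] to its end in
     [J']. The vertex [rv r t0] stands for all tails of [r]. *)
  assert (Hkey : forall J' t0, (forall g, J' g -> J g) ->
    (forall e t, tail_in (minus J' e) r t -> conn J' Rs (PV G (rv r t)) (PV G (rv r t0))) ->
    ~ conn J' Rs (PV G (rv r t0)) (PO w) -> forest (r :: Rs) J').
  { intros J' t0 Hsub Htail Hno e He Hc. pose proof (forest_mono Hsub HF) as HF'.
    assert (Hm : forall x y, conn (minus J' e) Rs x y -> conn J' Rs x y).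
    { intros x y; apply conn_mono. intros g [Hg _]; auto. }
    assert (Hxy : conn J' Rs (PV G (src e)) (PV G (tgt e))).
    { apply conn_edge; exists e; split; auto. left; auto. }
    apply conn_add_ray in Hc as [Hc|[(t & Ht & H1 & H2)|(t & Ht & H1 & H2)]].
    - apply (HF' e); auto.
    - apply Hno. apply conn_trans with (PV G (rv r t)); [apply conn_sym, (Htail e); auto|].
      apply conn_trans with (PV G (src e)); [apply conn_sym; auto|].
      apply conn_trans with (PV G (tgt e)); auto.
    - apply Hno. apply conn_trans with (PV G (rv r t)); [apply conn_sym, (Htail e); auto|].
      apply conn_trans with (PV G (tgt e)); [apply conn_sym; auto|].
      apply conn_trans with (PV G (src e)); auto. apply conn_sym; auto. }
  destruct (classic (conn J Rs (PV G (rv r 0)) (PO w))) as [Hc|Hc].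
  - assert (Ht : exists t, conn (avoiding J r) Rs (PV G (rv r t)) (PO w)).
    { destruct (last_ray_vertex Hd Hc); eauto. }
    destruct Ht as [t Ht]. destruct (Hr t) as (g & Hg & Hj); [lia|].
    assert (HrS : tail_in (minus J g) r (S t)).
    { intros s Hs. destruct (Hr s) as (g' & Hg' & Hj'); [lia|]. exists g'; repeat split; auto.
      intros ->. destruct (joins_det Hj Hj') as [[E0 _]|[E0 E1]]; apply rv_inj in E0; [lia|].
      apply rv_inj in E1; lia. }
    exists (minus J g). split; [intros g' [H _]; auto|]. split; [|split].
    + apply (Hkey (minus J g) (S t)).
      * intros g' [H _]; auto.
      * intros e s Hs. destruct (le_lt_dec (S t) s) as [Hle|Hlt]; [apply conn_sym, conn_tail; auto|].
        (* A tail starting before [S t] would use the deleted edge, and there is no parallel edge to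
           replace it. *)
        exfalso. destruct (Hs t) as (g' & [[Hg' N'] _] & Hj'); [lia|]. apply N'.
        apply no_parallel. destruct Hj as [[E1 E2]|[E1 E2]], Hj' as [[E3 E4]|[E3 E4]]; rewrite E1, E2, E3, E4; auto.
      * intros Hc'. apply (forest_bridge HF Hg Hj).
        apply conn_trans with (PO w); [|apply conn_sym; auto].
        eapply conn_mono; [|exact Ht]. intros g' [Hg' N']; split; auto. intros ->; apply N'; exists t; auto.
    + exists (S t); auto.
    + exists (g :: nil); split; auto. intros g' Hg' N'. assert (g' = g).
      { apply NNPP; intros N; apply N'; split; auto. }
      subst g'; split; [exists t; auto|simpl; auto].
  - exists J. split; auto. split; [|split; [exists 0; auto|]].
    + apply (Hkey J 0); auto. intros e t Ht. apply conn_sym, conn_tail; auto; lia.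
    + exists nil; split; auto. tauto.
Qed.

(** The edges deleted so far lie on rays disjoint from the next one. So the next ray is still
    complete, and its own deletion spoils no earlier tail. *)
Lemma forest_add_rays J Rs : forest nil J ->
  (forall i j, i < j -> j < length Rs -> forall d, disjoint_rays (nth i Rs d) (nth j Rs d)) ->
  (forall r, In r Rs -> tail_in J r 0) ->
  exists J', (forall g, J' g -> J g) /\ forest Rs J' /\
    (forall r, In r Rs -> exists t, tail_in J' r t) /\
    (forall g, J g -> ~ J' g -> exists r, In r Rs /\ ray_edge r g) /\
    exists l, length l <= length Rs /\ forall g, J g -> ~ J' g -> In g l.
Proof.
  intros HF. induction Rs as [|r Rs IH]; intros Hd Hin.
  - exists J. repeat split; auto; try tauto; [intros r []|]. exists nil; split; auto; tauto.
  - destruct IH as (J1 & H1 & H2 & H3 & H4 & l1 & Hl1 & H5).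
    { intros i j Hij Hj d. apply (Hd (S i) (S j)); simpl; lia. }
    { intros; apply Hin; simpl; auto. }
    assert (Hdr : forall r', In r' Rs -> disjoint_rays r r').
    { intros r' Hr'. destruct (In_nth _ _ r Hr') as (j & Hj & <-).
      apply (Hd 0 (S j)) with (d := r); simpl; lia. }
    assert (Hr1 : tail_in J1 r 0).
    { intros s Hs. destruct (Hin r (or_introl eq_refl) s Hs) as (g & Hg & Hj). exists g; split; auto.
      apply NNPP; intros N. destruct (H4 g Hg N) as (r' & Hr' & m & Hm).
      destruct (joins_det Hj Hm) as [[E0 _]|[E0 _]]; exact (Hdr r' Hr' _ _ E0). }
    destruct (forest_add_ray H2 Hdr Hr1) as (J2 & K1 & K2 & K3 & l2 & Hl2 & K5).
    exists J2. split; [auto|]. split; [auto|]. split; [|split].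
    + intros r' [<-|Hr']; auto. destruct (H3 r' Hr') as [t Ht]. exists t. intros s Hs.
      destruct (Ht s Hs) as (g & Hg & Hj). exists g; split; auto. apply NNPP; intros N.
      destruct (K5 g Hg N) as [[m Hm] _].
      destruct (joins_det Hj Hm) as [[E0 _]|[E0 _]]; exact (Hdr r' Hr' _ _ (eq_sym E0)).
    + intros g Hg N. destruct (classic (J1 g)) as [Hg1|Hg1].
      * exists r; split; [simpl; auto|]. apply (K5 g); auto.
      * destruct (H4 g Hg Hg1) as (r' & Hr' & H'). exists r'; simpl; auto.
    + exists (l2 ++ l1). split; [rewrite length_app; simpl; lia|]. intros g Hg N. apply in_app_iff.
      destruct (classic (J1 g)) as [Hg1|Hg1]; [left; apply (K5 g)|right; apply H5]; auto.
Qed.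

End Forest.

Arguments edge_in {G} J u v.
Arguments minus {G} J e _.

(** * Components clustering at an end *)

Section Cluster.
Variables (G : graph) (Psi : (ray G -> Prop) -> Prop).
Implicit Types (J : E G -> Prop) (Rs : list (ray G)) (X Y : list (V G)) (w : ray G -> Prop).

Definition jcomp J X (u v : V G) : Prop :=
  ~ In u X /\ clos_refl_trans _ (fun a b => edge_in J a b /\ ~ In a X /\ ~ In b X) u v.

Lemma jcomp_refl J X u : ~ In u X -> jcomp J X u u.
Proof. intros H; split; auto. apply rt_refl. Qed.

Lemma jcomp_notin J X u v : jcomp J X u v -> ~ In v X.
Proof. intros [H Hc]. apply clos_rt_rtn1 in Hc. inversion Hc; subst; tauto. Qed.

Lemma jcomp_trans J X u v z : jcomp J X u v -> jcomp J X v z -> jcomp J X u z.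
Proof. intros [H1 H2] [H3 H4]; split; auto. eapply rt_trans; eauto. Qed.

Lemma jcomp_sym J X u v : jcomp J X u v -> jcomp J X v u.
Proof.
  intros H; split; [eapply jcomp_notin; eauto|]. destruct H as [_ H].
  induction H as [a b (H1 & H2 & H3)| |]; [|apply rt_refl|eapply rt_trans; eauto].
  apply rt_step; auto using edge_in_sym.
Qed.

Lemma jcomp_edge J X u v : edge_in J u v -> ~ In u X -> ~ In v X -> jcomp J X u v.
Proof. intros; split; auto. apply rt_step; auto. Qed.

Lemma jcomp_mono J J' X Y u v : (forall a b, edge_in J a b -> ~ In a Y -> ~ In b Y -> edge_in J' a b) ->
  incl X Y -> jcomp J Y u v -> jcomp J' X u v.
Proof.
  intros HJ HX [Hu H]. assert (HN : forall z, ~ In z Y -> ~ In z X) by (intros z Hz Hi; apply Hz, HX, Hi).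
  split; auto. clear Hu.
  induction H as [a b (H1 & H2 & H3)| |]; [|apply rt_refl|eapply rt_trans; eauto].
  apply rt_step; repeat split; auto.
Qed.

Lemma jcomp_conn J Rs X u v : jcomp J X u v -> conn Psi J Rs (PV G u) (PV G v).
Proof.
  intros [_ H]. induction H as [a b (H1 & _)| |]; [|apply conn_refl|eapply conn_trans; eauto].
  apply conn_edge; auto.
Qed.

Lemma jcomp_connS J X Y u v : (forall s, jcomp J X u s -> ~ In s Y) -> jcomp J X u v ->
  connS G (lset Y) u v.
Proof.
  intros HY [Hu H]. apply clos_rt_rtn1 in H. induction H as [|a b (H1 & H2 & H3) Hc IH].
  - apply connS_refl, HY, jcomp_refl; auto.
  - assert (Ha : jcomp J X u a) by (split; auto; apply clos_rtn1_rt; auto).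
    eapply connS_trans; [exact IH|]. apply connS_step.
    + destruct H1 as (g & _ & Hg); exists g; exact Hg.
    + apply HY; auto.
    + apply HY. eapply jcomp_trans; [exact Ha|]. apply jcomp_edge; auto.
Qed.

Definition clusters J X w (v : V G) : Prop := forall Y, exists z, jcomp J X v z /\ nbN Y w z.

Lemma last_exit J X v z : jcomp J X v z -> z <> v ->
  exists v', edge_in J v v' /\ jcomp J (v :: X) v' z.
Proof.
  intros [Hv H] N. enough (Hgen : forall a, clos_refl_trans_1n _
    (fun a b => edge_in J a b /\ ~ In a X /\ ~ In b X) a z -> ~ In a X ->
    (a <> v -> jcomp J (v :: X) a z \/ exists v', edge_in J v v' /\ jcomp J (v :: X) v' z) /\
    (a = v -> exists v', edge_in J v v' /\ jcomp J (v :: X) v' z)).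
  { apply clos_rt_rt1n in H. destruct (Hgen v H Hv) as [_ H']; auto. }
  clear H Hv. intros a H. induction H as [z|a b z (H1 & H2 & H3) Hc IH]; intros Ha.
  - split; [|congruence]. intros _; left. apply jcomp_refl. intros [|]; auto.
  - destruct (IH N H3) as [IH1 IH2]. destruct (classic (b = v)) as [->|Nb].
    + split; auto.
    + specialize (IH1 Nb). split.
      * intros Na. destruct IH1 as [IH1|]; auto. left. eapply jcomp_trans; [|exact IH1].
        apply jcomp_edge; auto; intros [|]; auto.
      * intros ->. destruct IH1 as [IH1|]; eauto.
Qed.

(** Otherwise one finite [S] keeps away from [w] all components of [J - X - v] next to [v] that meet
    [Y0]. A component through which [v] comes closer to [w] than that avoids [Y0], so it lies in the
    neighbourhood of [w] at [Y0]; then [v] is in [nbN Y0 w], a contradiction. *)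
Lemma cluster_step J X w v : clusters J X w v -> (exists Y, ~ nbN Y w v) ->
  exists v', edge_in J v v' /\ ~ In v' (v :: X) /\ clusters J (v :: X) w v'.
Proof.
  intros Hcl [Y0 HY0]. apply NNPP; intros Hno.
  destruct (@union_over_list _ _ (fun s S => forall v', edge_in J v v' -> jcomp J (v :: X) v' s ->
    forall z, jcomp J (v :: X) s z -> ~ nbN S w z) Y0) as [S HS].
  - intros s S S' HSS H v' Hv' Hs z Hz Hn. apply (H v' Hv' Hs z Hz). eapply nbN_mono; eauto.
  - intros s _. destruct (classic (exists v', edge_in J v v' /\ jcomp J (v :: X) v' s)) as [(v' & He & Hs)|Hn].
    + assert (Hncl : ~ clusters J (v :: X) w v').
      { intros Hc; apply Hno; exists v'; split; auto. split; auto. apply Hs. }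
      apply not_all_ex_not in Hncl as [S HS]. exists S. intros v'' _ _ z Hz Hn.
      apply HS. exists z; split; auto. eapply jcomp_trans; eauto.
    + exists nil. intros v' He Hs; exfalso; apply Hn; eauto.
  - destruct (Hcl (Y0 ++ S)) as (z & Hz & Hn).
    assert (Hn0 : nbN Y0 w z) by (eapply nbN_mono; [|exact Hn]; auto using incl_appl, incl_refl).
    assert (HnS : nbN S w z) by (eapply nbN_mono; [|exact Hn]; auto using incl_appr, incl_refl).
    assert (Nz : z <> v) by (intros ->; auto).
    destruct (last_exit Hz Nz) as (v' & He & Hv').
    destruct (classic (exists s, In s Y0 /\ jcomp J (v :: X) v' s)) as [(s & Hs & Hvs)|Hfree].
    + apply (HS s Hs v' He Hvs z); auto. eapply jcomp_trans; [apply jcomp_sym|]; eauto.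
    + apply HY0. exists v'. split.
      * assert (Hav : forall s, jcomp J (v :: X) v' s -> ~ In s Y0) by (intros s Hs Hi; apply Hfree; eauto).
        apply nb_ext with z; [apply nbN_notin; auto|].
        apply connS_sym. eapply jcomp_connS; eauto.
      * right. destruct He as (g & _ & Hg). exists g. apply joins_sym; exact Hg.
Qed.

Lemma conn_nil J Rs x y : conn Psi J nil x y -> conn Psi J Rs x y.
Proof.
  intros H; induction H as [x y Hs| |]; [|apply conn_refl|eapply conn_trans; eauto].
  apply rt_step. destruct Hs as [Hs|[Hs|(v & w & (r & t & [] & _) & _)]]; [left|right; left]; auto.
Qed.

Lemma forest_nil J Rs : forest Psi Rs J -> forest Psi nil J.
Proof. intros H e He Hc. apply (H e He). apply conn_nil; auto. Qed.

(** Iterating [cluster_step], with the visited vertices deleted, gives the ray. In a forest no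
    vertex stays in the shrinking components forever. So they eventually avoid any finite [Y] while
    still meeting [nbN Y w], and the ray belongs to [w]. *)
Lemma cluster_ray J w v0 : forest Psi nil J -> is_end w -> clusters J nil w v0 ->
  (forall u, jcomp J nil v0 u -> exists Y, ~ nbN Y w u) ->
  exists r, rv r 0 = v0 /\ tail_in J r 0 /\ w r.
Proof.
  intros HF Hw Hcl0 Hdom.
  assert (Hstep : forall a : V G * list (V G), exists v', clusters J (snd a) w (fst a) ->
    jcomp J nil v0 (fst a) ->
    edge_in J (fst a) v' /\ ~ In v' (fst a :: snd a) /\ clusters J (fst a :: snd a) w v').
  { intros [v X]; simpl. destruct (classic (clusters J X w v /\ jcomp J nil v0 v)) as [[H1 H2]|Hn].
    - destruct (cluster_step H1 (Hdom v H2)) as (v' & H); exists v'; auto.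
    - exists v; tauto. }
  apply choice_fun in Hstep as [next Hnext].
  set (st := fix st n := match n with
    | 0 => (v0, nil) | S m => (next (st m), fst (st m) :: snd (st m)) end).
  assert (Hinv : forall n, clusters J (snd (st n)) w (fst (st n)) /\ jcomp J nil v0 (fst (st n))).
  { intros n; induction n as [|n [IH1 IH2]]; [split; auto; apply jcomp_refl; auto|].
    destruct (Hnext (st n) IH1 IH2) as (H1 & H2 & H3). split; [exact H3|].
    eapply jcomp_trans; [exact IH2|]. apply jcomp_edge; auto. }
  assert (Hedge : forall n, edge_in J (fst (st n)) (fst (st (S n)))).
  { intros n. destruct (Hinv n). apply (Hnext (st n)); auto. }
  assert (Hnot : forall n, ~ In (fst (st n)) (snd (st n))).
  { intros n. destruct (Hinv n) as [H _]. destruct (H nil) as (z & Hz & _). apply Hz. }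
  assert (Hpast : forall i n, i < n -> In (fst (st i)) (snd (st n))).
  { intros i n Hi. induction Hi as [|n Hi IH]; simpl; auto. }
  assert (Hinj : forall n m, fst (st n) = fst (st m) -> n = m).
  { intros n m E0. destruct (lt_eq_lt_dec n m) as [[H|]|H]; auto; exfalso.
    - apply (Hnot m). rewrite <- E0. auto.
    - apply (Hnot n). rewrite E0. auto. }
  assert (Hadj : forall n, adjacent G (fst (st n)) (fst (st (S n)))).
  { intros n. destruct (Hedge n) as (g & _ & Hg). exists g; exact Hg. }
  set (r := @Ray G (fun n => fst (st n)) Hinj Hadj).
  assert (Hr : tail_in J r 0) by (intros s _; apply Hedge).
  exists r; split; [reflexivity|split; [exact Hr|]].
  assert (Hnest : forall n m, n <= m -> forall z, jcomp J (snd (st m)) (fst (st m)) z ->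
    jcomp J (snd (st n)) (fst (st n)) z).
  { intros n m Hle; induction Hle as [|m Hle IH]; auto. intros z Hz. apply IH.
    eapply jcomp_trans; [apply jcomp_edge; [apply Hedge|apply Hnot|]|].
    - intros Hi. apply (Hnot (S m)). simpl; auto.
    - eapply jcomp_mono; [| |exact Hz]; [auto|]. intros a Ha; simpl; auto. }
  apply nb_tail_end; auto. intros Y.
  destruct (@bound_on_list _ (fun s n => ~ jcomp J (snd (st n)) (fst (st n)) s) Y) as [n Hn].
  - intros s n m Hle H Hm; apply H. eapply Hnest; eauto.
  - intros s _. apply NNPP; intros Hno.
    assert (Hall : forall n, jcomp J (snd (st n)) (fst (st n)) s) by (intros n; apply NNPP; eauto).
    assert (Hc : conn Psi J nil (PV G (rv r 0)) (PV G s)) by exact (jcomp_conn nil (Hall 0)).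
    (* A path to [s] leaves the ray for good at [rv r t], and the next vertex of the ray reaches [s]
       with the past deleted; so the edge between the two vertices is no bridge. *)
    assert (Ht : exists t, conn Psi (avoiding J r) nil (PV G (rv r t)) (PV G s)).
    { destruct (@last_ray_vertex G Psi J nil r (PV G (rv r 0)) (PV G s)) as [H|H]; auto.
      - intros r' [].
      - exists 0; auto. }
    destruct Ht as [t Ht]. destruct (Hedge t) as (g & Hg & Hj).
    apply (forest_bridge HF Hg Hj). apply conn_trans with (PV G s).
    + eapply conn_mono; [|exact Ht]. intros g' [Hg' N]; split; auto. intros ->; apply N; exists t; exact Hj.
    + apply conn_sym. apply (@jcomp_conn (minus J g) nil nil).
      apply (@jcomp_mono J _ nil (snd (st (S t)))); [|intros ? []|apply Hall].
      intros a b (g' & Hg' & Hj') Ha Hb. exists g'; split; auto. split; auto. intros ->.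
      assert (Hin : In (fst (st t)) (snd (st (S t)))) by (simpl; auto).
      destruct (joins_det Hj Hj') as [[E0 _]|[E0 _]]; rewrite E0 in Hin; auto.
  - destruct (proj1 (Hinv n) Y) as (z & Hz & Hnz).
    assert (Hav : forall s, jcomp J (snd (st n)) (fst (st n)) s -> ~ In s Y).
    { intros s Hs Hi. apply (Hn s Hi Hs). }
    exists n; intros m Hm. apply nb_ext with z; [apply nbN_notin; auto|].
    eapply connS_trans; [apply connS_sym; eapply jcomp_connS; eauto|].
    eapply jcomp_connS; [exact Hav|]. apply (Hnest n m Hm). apply jcomp_refl, Hnot.
Qed.

Lemma dominating_equiv w u : Psi w -> is_end w -> (forall Y, nbN Y w u) ->
  psi_equiv Psi (PV G u) (PO w).
Proof.
  intros Hp Hw Hdom. apply psi_equiv_cut; simpl; auto. intros A Q Hcut.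
  destruct (Hcut w Hp Hw) as [Y HY]. apply HY; auto.
Qed.

Lemma cut_or A Q A' Q' : cut Psi A Q -> cut Psi A' Q' ->
  cut Psi (fun v : V G => A v \/ A' v) (fun w => Q w \/ Q' w).
Proof.
  intros H H' w Hp Hw. destruct (H w Hp Hw) as [X HX], (H' w Hp Hw) as [X' HX'].
  exists (X ++ X'); intros v Hv. rewrite (HX v), (HX' v); [tauto| |];
    eapply nbN_mono; try exact Hv; auto using incl_appl, incl_appr, incl_refl.
Qed.

Lemma cut_between_ends (l1 l2 : list (ray G -> Prop)) :
  (forall w, In w l1 -> VPsi Psi (PO w)) -> (forall w, In w l2 -> VPsi Psi (PO w)) ->
  (forall w w', In w l1 -> In w' l2 -> ~ psi_equiv Psi (PO w) (PO w')) ->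
  exists A Q, cut Psi A Q /\ (forall w, In w l1 -> Q w) /\ forall w, In w l2 -> ~ Q w.
Proof.
  intros H1 H2 Hsep. induction l1 as [|w l1 IH].
  - exists (fun _ => False), (fun _ => False). split; [intros w _ _; exists nil; tauto|].
    split; [intros ? []|auto].
  - destruct IH as (A & Q & Hcut & HQ1 & HQ2).
    { intros; apply H1; simpl; auto. } { intros; apply Hsep; simpl; auto. }
    destruct (@separating_cut G Psi (PO w) (map (@PO G) l2)) as (A' & Q' & Hcut' & HA' & Hy).
    { apply H1; simpl; auto. }
    { intros y Hy; apply in_map_iff in Hy as (w' & <- & Hw'). split; [apply H2; auto|].
      apply Hsep; simpl; auto. }
    exists (fun v => A v \/ A' v), (fun w => Q w \/ Q' w). split; [apply cut_or; auto|]. split.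
    + intros w' [<-|Hw']; auto.
    + intros w' Hw' [Hq|Hq]; [apply (HQ2 w'); auto|].
      apply (Hy (PO w')); [apply in_map; auto|exact Hq].
Qed.

Lemma conn_first J Rs v z : conn Psi J Rs (PV G v) z ->
  (exists v', z = PV G v' /\ jcomp J nil v v') \/
  exists u w, jcomp J nil v u /\ Psi w /\ is_end w /\
    (psi_equiv Psi (PV G u) (PO w) \/ link Psi J Rs u w).
Proof.
  intros H. apply clos_rt_rt1n in H. remember (PV G v) as x eqn:Ex. revert v Ex.
  induction H as [x|x y z Hs Hc IH]; intros v ->.
  - left; exists v; split; auto. apply jcomp_refl; auto.
  - destruct Hs as [(u & v' & E1 & -> & He)|[(H1 & H2 & H3 & w & Hpo)|(u & w & Hl & [[E1 ->]|[E1 ->]])]].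
    + injection E1 as <-. assert (Hvv : jcomp J nil v v') by (apply jcomp_edge; auto).
      destruct (IH v' eq_refl) as [(v'' & -> & H)|(u & w & H & H')].
      * left; exists v''; split; auto. eapply jcomp_trans; eauto.
      * right; exists u, w; split; auto. eapply jcomp_trans; eauto.
    + right. destruct Hpo as [E1| ->]; [discriminate|]. destruct H2 as [Hw Hp].
      exists v, w; repeat apply conj; auto. apply jcomp_refl; auto.
    + injection E1 as <-. right; exists v, w. pose proof Hl as (r & t & _ & _ & -> & Hp & _).
      repeat apply conj; auto using is_end_class. apply jcomp_refl; auto.
    + discriminate.
Qed.

(** If [u] is equivalent to the end, [u] itself is on its side of the cut; if a ray links them, the
    far vertices of this ray are, and they lie in the component. *)
Lemma conn_first_hits J Rs A Q v u w : cut Psi A Q -> jcomp J nil v u -> Psi w -> is_end w ->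
  (psi_equiv Psi (PV G u) (PO w) \/ link Psi J Rs u w) ->
  conn Psi J Rs (PV G v) (PO w) /\ exists u', jcomp J nil v u' /\ (A u' <-> Q w).
Proof.
  intros Hcut Hvu Hp Hw H. split.
  - eapply conn_trans; [eapply jcomp_conn; exact Hvu|].
    destruct H; [apply conn_jump; simpl; auto|apply conn_link; auto].
  - destruct H as [H|(r & t & Hr & -> & -> & _ & Ht)].
    + exists u; split; auto. rewrite psi_equiv_cut in H by (simpl; auto). apply (H A Q Hcut).
    + destruct (Hcut _ Hp Hw) as [X HX].
      destruct (nb_tail X (ray_equiv r) r (ray_equiv_refl r)) as [n Hn].
      exists (rv r (n + t)). split; [|apply HX, nb_nbN, Hn; lia].
      eapply jcomp_trans; [exact Hvu|]. clear -Ht.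
      induction n as [|n IH]; [apply jcomp_refl; auto|].
      eapply jcomp_trans; [exact IH|]. apply jcomp_edge; auto. apply (Ht (n + t)); lia.
Qed.

Lemma tail_minus (I : E G -> Prop) e r t : tail_in I r t -> exists t', t <= t' /\ tail_in (minus I e) r t'.
Proof.
  intros Ht. destruct (classic (exists m, joins e (rv r m) (rv r (S m)))) as [[m Hm]|Hn].
  - exists (t + S m); split; [lia|]. intros s Hs. destruct (Ht s) as (g & Hg & Hj); [lia|].
    exists g; repeat split; auto. intros ->.
    destruct (joins_det Hj Hm) as [[E0 _]|[_ E0]]; apply rv_inj in E0; lia.
  - exists t; split; auto. intros s Hs. destruct (Ht s Hs) as (g & Hg & Hj).
    exists g; repeat split; auto. intros ->; eauto.
Qed.

(** * The cut that meets the forest in a single edge *)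

Section Cut.
Variables (I : E G -> Prop) (Rs : list (ray G)) (ends : list (ray G -> Prop)).
Hypothesis I_forest : forest Psi Rs I.
Hypothesis Rs_tails : forall r, In r Rs -> exists t, tail_in I r t.
Hypothesis Rs_absorb : forall r', tail_in I r' 0 -> exists r, In r Rs /\
  forall N, exists s t, N <= s /\ N <= t /\ rv r' s = rv r t.
Hypothesis ends_complete : forall w, is_end w -> In w ends.

(** The star-comb dichotomy: either some vertex of the component lies in [nbN Y w] for all [Y] and
    is equivalent to [w], or the component contains a ray of [w]. By [Rs_absorb] that ray meets a
    ray of [Rs] arbitrarily late, and the link of the latter leads to [w]. *)
Lemma cluster_conn e w v : Psi w -> is_end w -> clusters (minus I e) nil w v ->
  conn Psi (minus I e) Rs (PV G v) (PO w).
Proof.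
  intros Hp Hw Hcl. set (J := minus I e).
  destruct (classic (exists u, jcomp J nil v u /\ forall Y, nbN Y w u)) as [(u & Hu & Hdom)|Hno].
  - eapply conn_trans; [eapply jcomp_conn; exact Hu|].
    apply conn_jump; simpl; auto using dominating_equiv.
  - assert (HF : forest Psi nil J).
    { apply (@forest_mono G Psi nil I); [intros g [Hg _]; auto|]. eapply forest_nil; eauto. }
    destruct (@cluster_ray J w v HF Hw Hcl) as (r' & <- & Htl & Hwr).
    { intros u Hu. apply NNPP; intros Hn. apply Hno; exists u; split; auto.
      intros Y; apply NNPP; eauto. }
    destruct (Rs_absorb (r' := r')) as (r & Hr & Hmeet).
    { intros s Hs. destruct (Htl s Hs) as (g & [Hg _] & Hj); exists g; auto. }
    assert (Ew : w = ray_equiv r).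
    { apply end_eq_class; auto. apply (end_mem_equiv r' r Hw Hwr). apply meeting_rays_equiv; auto. }
    destruct (Rs_tails r Hr) as [t0 Ht0]. destruct (@tail_minus I e r t0 Ht0) as (t1 & _ & Ht1).
    destruct (Hmeet t1) as (s & t & _ & Ht & E0).
    eapply conn_trans; [apply (@conn_tail G Psi J Rs r' 0 s Htl); lia|].
    rewrite E0. apply conn_link. exists r, t; repeat apply conj; auto.
    intros m Hm; apply Ht1; lia.
Qed.

(* Only finitely many components in [W] can leave [P'] and still meet a small neighbourhood of [w],
   since each of them crosses the finite set bounding a neighbourhood inside [P']; none of these
   finitely many clusters at [w]. *)
Lemma avoid_components e w (P' W : V G -> Prop) s0 : Psi w -> is_end w ->
  (exists X, forall v, nbN X w v -> P' v) ->
  (forall v v', W v -> jcomp (minus I e) nil v v' -> W v') ->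
  (forall v, W v -> jcomp (minus I e) nil v s0 \/ exists u, jcomp (minus I e) nil v u /\ ~ P' u) ->
  (forall v, W v -> ~ conn Psi (minus I e) Rs (PV G v) (PO w)) ->
  exists X, forall v, nbN X w v -> ~ W v.
Proof.
  intros Hp Hw [X0 HX0] Hclosed Hleave Hfar. set (J := minus I e) in *.
  (* Including [s0] takes care of the one component that need not leave [P']. *)
  destruct (@union_over_list _ _ (fun s S => W s -> forall z, jcomp J nil s z -> ~ nbN S w z) (s0 :: X0))
    as [S HS].
  - intros s S S' HSS H Hs z Hz Hn. apply (H Hs z Hz). eapply nbN_mono; eauto.
  - intros s _. destruct (classic (W s)) as [Hs|]; [|exists nil; tauto].
    assert (Hncl : ~ clusters J nil w s) by (intros Hc; apply (Hfar s Hs), cluster_conn; auto).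
    apply not_all_ex_not in Hncl as [S HS]. exists S. intros _ z Hz Hn; apply HS; eauto.
  - exists (X0 ++ S). intros v Hn HWv.
    assert (Hn0 : nbN X0 w v) by (eapply nbN_mono; [|exact Hn]; auto using incl_appl, incl_refl).
    assert (HnS : nbN S w v) by (eapply nbN_mono; [|exact Hn]; auto using incl_appr, incl_refl).
    assert (Hin : forall s, In s (s0 :: X0) -> ~ jcomp J nil v s).
    { intros s Hs Hvs. apply (HS s Hs) with v; auto; [eapply Hclosed; eauto|apply jcomp_sym; auto]. }
    destruct (Hleave v HWv) as [Hvs|(u & Hu & HPu)]; [apply (Hin s0); simpl; auto|].
    assert (Hav : forall s, jcomp J nil v s -> ~ In s X0) by (intros s Hs Hi; apply (Hin s); simpl; auto).
    apply HPu, HX0, nb_nbN. apply nb_ext with v.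
    + apply nbN_notin; auto. apply Hav, jcomp_refl; auto.
    + eapply jcomp_connS; eauto.
Qed.

Lemma forest_cut e : I e -> exists A Q, cut Psi A Q /\ A (src e) /\ ~ A (tgt e) /\
  forall g, I g -> g <> e -> (A (src g) <-> A (tgt g)).
Proof.
  intros He. set (J := minus I e). set (x := src e). set (y := tgt e).
  assert (Hxy : ~ conn Psi J Rs (PV G x) (PV G y)) by (apply I_forest; auto).
  set (Qx := fun w => conn Psi J Rs (PV G x) (PO w)).
  (* Equivalent ends are connected, hence agree on [Qx]. As there are finitely many ends, a single
     cut realizes [Qx]. *)
  assert (HP : exists P Q, cut Psi P Q /\ forall w, Psi w -> is_end w -> (Q w <-> Qx w)).
  { set (l := filterP (fun w => VPsi Psi (PO w)) ends).
    assert (Hl : forall w, In w l -> VPsi Psi (PO w)) by (intros w Hw; apply filterP_In in Hw; tauto).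
    destruct (@cut_between_ends (filterP Qx l) (filterP (fun w => ~ Qx w) l)) as (P & Q & Hcut & H1 & H2).
    - intros w Hw; apply filterP_In in Hw; apply Hl; tauto.
    - intros w Hw; apply filterP_In in Hw; apply Hl; tauto.
    - intros w w' Hw Hw' Heq. apply filterP_In in Hw as [Hw Hq]. apply filterP_In in Hw' as [Hw' Hq'].
      apply Hq'. eapply conn_trans; [exact Hq|]. apply conn_jump; auto.
    - exists P, Q; split; auto. intros w Hp Hw.
      assert (Hin : In w l) by (apply filterP_In; split; auto; split; auto).
      destruct (classic (Qx w)) as [Hq|Hq].
      + split; auto. intros _; apply H1, filterP_In; auto.
      + split; [|tauto]. intros Hq'; exfalso; apply (H2 w); auto. apply filterP_In; auto. }
  destruct HP as (P & Q & Hcut & HQ).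
  (* For anchored components the connection decides the side. Any other component goes to [A] as
     soon as it meets [P], so those left outside lie wholly outside [P]. *)
  set (anchored := fun v => conn Psi J Rs (PV G y) (PV G v) \/
    exists w, Psi w /\ is_end w /\ conn Psi J Rs (PV G v) (PO w)).
  set (A := fun v => conn Psi J Rs (PV G x) (PV G v) \/
    (~ anchored v /\ exists u, jcomp J nil v u /\ P u)).
  assert (Hinv : forall v v', A v -> jcomp J nil v v' -> A v').
  { intros v v' HA Hvv. assert (Hc : conn Psi J Rs (PV G v) (PV G v')) by (eapply jcomp_conn; eauto).
    destruct HA as [HA|[Hn (u & Hu & HPu)]].
    - left; eapply conn_trans; eauto.
    - right; split.
      + intros [H|(w & Hp & Hw & H)]; apply Hn.
        * left. eapply conn_trans; [exact H|]. apply conn_sym; auto.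
        * right; exists w; repeat apply conj; auto. eapply conn_trans; eauto.
      + exists u; split; auto. eapply jcomp_trans; [apply jcomp_sym|]; eauto. }
  exists A, Qx. split; [|split; [|split]].
  - intros w Hp Hw. destruct (Hcut w Hp Hw) as [X0 HX0].
    destruct (classic (Qx w)) as [Hq|Hq].
    + destruct (@avoid_components e w P (fun v => ~ A v) y Hp Hw) as [X HX].
      * exists X0; intros v Hv. apply HX0, HQ; auto.
      * intros v v' Hv Hvv HA; apply Hv. eapply Hinv; [exact HA|]. apply jcomp_sym; auto.
      * intros v Hv. fold J. destruct (classic (exists u, jcomp J nil v u /\ ~ P u)) as [|Hall]; auto. left.
        assert (Hnx : ~ conn Psi J Rs (PV G x) (PV G v)) by (intros H; apply Hv; left; auto).
        assert (HPv : exists u, jcomp J nil v u /\ P u).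
        { exists v; split; [apply jcomp_refl; auto|]. apply NNPP; intros HPv; apply Hall.
          exists v; split; auto; apply jcomp_refl; auto. }
        (* A component inside [P] could only reach ends on the side of [x], and would then be
           connected to [x]. *)
        assert (Hside : forall u w', jcomp J nil v u -> Psi w' -> is_end w' ->
          psi_equiv Psi (PV G u) (PO w') \/ link Psi J Rs u w' -> False).
        { intros u w' Hvu Hp' Hw' H. destruct (conn_first_hits Hcut Hvu Hp' Hw' H) as (Hc & u' & Hu' & Hiff).
          apply Hall; exists u'; split; auto. rewrite Hiff, HQ by auto. intros Hq'; apply Hnx.
          eapply conn_trans; [exact Hq'|]. apply conn_sym; auto. }
        assert (Hanch : anchored v) by (apply NNPP; intros Hn; apply Hv; right; auto).
        destruct Hanch as [Hc|(w' & Hp' & Hw' & Hc)].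
        -- apply conn_sym in Hc. destruct (conn_first Hc) as [(v' & E0 & Hvv)|(u & w' & H1 & H2 & H3 & H4)].
           ++ injection E0 as ->; auto.
           ++ exfalso; eauto.
        -- destruct (conn_first Hc) as [(v' & E0 & Hvv)|(u & w'' & H1 & H2 & H3 & H4)]; [discriminate|].
           exfalso; eauto.
      * intros v Hv Hc. apply Hv; left. eapply conn_trans; [exact Hq|]. apply conn_sym; auto.
      * exists X; intros v Hv. split; auto. intros _; apply NNPP, HX, Hv.
    + destruct (@avoid_components e w (fun v => ~ P v) A x Hp Hw) as [X HX].
      * exists X0; intros v Hv HPv. apply Hq, HQ, (HX0 v); auto.
      * exact Hinv.
      (* A component connected to [x] either contains [x] or reaches an end on the side of [x], and
         so meets [P]. *)
      * intros v [Hv|[_ (u & Hu & HPu)]]; [|right; exists u; split; auto]. fold J.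
        apply conn_sym in Hv. destruct (conn_first Hv) as [(v' & E0 & Hvv)|(u & w' & H1 & H2 & H3 & H4)].
        -- injection E0 as ->; auto.
        -- right. destruct (conn_first_hits Hcut H1 H2 H3 H4) as (Hc & u' & Hu' & Hiff).
           exists u'; split; auto. intros Hn; apply Hn, Hiff, HQ; auto.
           eapply conn_trans; [apply conn_sym; exact Hv|exact Hc].
      * fold J. intros v [Hv|[Hn _]] Hc.
        -- apply Hq. eapply conn_trans; eauto.
        -- apply Hn; right; eauto.
      * exists X; intros v Hv. split; [intros HA; exfalso; apply (HX v Hv HA)|tauto].
  - left; apply conn_refl.
  - intros [H|[H _]]; [auto|]. apply H; left; apply conn_refl.
  - intros g Hg N. assert (Hj : jcomp J nil (src g) (tgt g)).
    { apply jcomp_edge; auto. exists g; split; [split; auto|left; auto]. }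
    split; intros H; eapply Hinv; eauto. apply jcomp_sym; auto.
Qed.

End Cut.
End Cluster.

(** * Matroids *)

Section Exchange.
Variables (T : Type) (indep : (T -> Prop) -> Prop).
Hypothesis M : is_matroid indep.
Implicit Types (F B A : T -> Prop) (l : list T).

Lemma indep_subset A B : indep B -> subset A B -> indep A.
Proof. destruct M as (_ & H & _); apply H. Qed.

Lemma exchange A B : indep A -> ~ is_base indep A -> is_base indep B ->
  exists b, B b /\ ~ A b /\ indep (fun x => A x \/ x = b).
Proof. destruct M as (_ & _ & H & _); apply H. Qed.

(** Every element added from [B] lies in [F - A] and uses up an entry of [l], so the process stops
    at a base. *)
Lemma extend_to_base F B : is_base indep B -> subset B F ->
  forall l A, indep A -> subset A F -> (forall x, F x -> ~ A x -> In x l) ->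
  exists A' l', is_base indep A' /\ subset A' F /\ length l' <= length l /\
    forall x, F x -> ~ A' x -> In x l'.
Proof.
  intros HB HBF l. remember (length l) as n eqn:En. revert l En.
  induction n as [|n IH]; intros l En A HA HAF Hl;
    (destruct (classic (is_base indep A)) as [|Hnb]; [exists A, l; repeat split; auto; try lia; apply H|]);
    destruct (exchange HA Hnb HB) as (b & Hb & HAb & HAb');
    pose proof (Hl b (HBF b Hb) HAb) as Hin; apply in_split in Hin as (l1 & l2 & ->);
    rewrite length_app in En; simpl in En; [lia|].
  destruct (IH (l1 ++ l2)) with (A := fun x => A x \/ x = b) as (A' & l' & H1 & H2 & H3 & H4); auto.
  - rewrite length_app; lia.
  - intros x [Hx| ->]; auto.
  - intros x Hx Hn. specialize (Hl x Hx (fun H => Hn (or_introl H))).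
    rewrite in_app_iff in *; simpl in Hl. destruct Hl as [|[|]]; auto. exfalso; apply Hn; auto.
  - exists A', l'; repeat split; auto; try lia; apply H1.
Qed.

(** Swap some [b] of [B - A] for an element [i] of [A]; the new base is closer to [A]. A list
    covering what it misses in [F] contains [b], and replacing that entry by [i] gives a list of the
    same length for [B]. *)
Lemma base_codim F A l : is_base indep A -> subset A F -> (forall x, F x -> ~ A x -> In x l) ->
  forall lB B, is_base indep B -> subset B F -> (forall x, B x -> ~ A x -> In x lB) ->
  exists l', length l' <= length l /\ forall x, F x -> ~ B x -> In x l'.
Proof.
  intros HA HAF Hl lB. remember (length lB) as n eqn:En. revert lB En.
  induction n as [|n IH]; intros lB En B HB HBF HlB;
    (destruct (classic (exists b, B b /\ ~ A b)) as [(b & Hb & HAb)|Hsub];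
     [|exists l; split; auto; intros x Hx Hn; apply Hl; auto; intros HAx; apply Hn;
       destruct HB as (_ & _ & Hmax); apply (Hmax A); auto;
       [apply HA|intros z Hz; apply NNPP; eauto|intros ? _; exact Logic.I]]);
    pose proof (HlB b Hb HAb) as Hin; apply in_split in Hin as (l1 & l2 & ->);
    rewrite length_app in En; simpl in En; [lia|].
  set (B1 := fun x => B x /\ x <> b).
  assert (HB1 : indep B1) by (apply (@indep_subset B1 B); [apply HB|intros x [Hx _]; auto]).
  assert (HB1' : ~ is_base indep B1).
  { intros (_ & _ & Hmax). destruct (Hmax B) with b as [_ Hbb]; auto; [apply HB|intros x [Hx _]; auto|].
    intros ? _; exact Logic.I. }
  destruct (exchange HB1 HB1' HA) as (i & Hi & HB1i & HB2). set (B2 := fun x => B1 x \/ x = i) in *.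
  assert (Nib : i <> b) by (intros ->; auto).
  assert (HBi : ~ B i) by (intros Hbi; apply HB1i; split; auto).
  (* If [B2] were no base, exchange with [B] could only add [b], and then [B] together with [i]
     would be independent. *)
  assert (HB2' : is_base indep B2).
  { apply NNPP; intros Hnb. destruct (exchange HB2 Hnb HB) as (c & Hc & HB2c & HB3).
    assert (c = b) by (apply NNPP; intros N; apply HB2c; left; split; auto). subst c.
    apply HBi. destruct HB as (_ & _ & Hmax). apply (Hmax (fun x => B x \/ x = i)); auto.
    - apply (indep_subset HB3). intros x [Hx| ->]; [|left; right; auto].
      destruct (classic (x = b)); [right; auto|left; left; split; auto].
    - intros x Hx; auto.
    - intros ? _; exact Logic.I. }
  destruct (IH (l1 ++ l2)) with (B := B2) as (l' & Hl' & Hcov); auto.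
  - rewrite length_app; lia.
  - intros x [[Hx _]| ->]; auto.
  - intros x [[Hx N]| ->] Hn; [|contradiction]. specialize (HlB x Hx Hn).
    rewrite in_app_iff in *; simpl in HlB. destruct HlB as [|[|]]; auto; congruence.
  - assert (Hbl : In b l').
    { apply Hcov; auto. intros [[_ N]|N]; auto. }
    apply in_split in Hbl as (k1 & k2 & ->). rewrite length_app in Hl'; simpl in Hl'.
    exists (i :: k1 ++ k2). split; [simpl; rewrite length_app; lia|]. intros x Hx Hn.
    destruct (classic (x = i)) as [->|Ni]; [simpl; auto|]. right.
    assert (Hx' : In x (k1 ++ b :: k2)).
    { apply Hcov; auto. intros [[Hx' _]|]; auto. }
    rewrite in_app_iff in *; simpl in Hx'. destruct Hx' as [|[|]]; auto. subst x; contradiction.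
Qed.

Lemma finite_codim F A B l : indep A -> subset A F -> (forall x, F x -> ~ A x -> In x l) ->
  is_base indep B -> subset B F ->
  exists l', length l' <= length l /\ forall x, F x -> ~ B x -> In x l'.
Proof.
  intros HA HAF Hl HB HBF.
  destruct (extend_to_base HB HBF l HA HAF Hl) as (A' & l1 & HA' & HAF' & Hlen & Hl1).
  (* The list [l1] also covers [B - A'], because [B] lies in [F]. *)
  destruct (@base_codim F A' l1 HA' HAF' Hl1 l1 B HB HBF) as (l' & Hl' & Hcov); auto.
  exists l'; split; auto; lia.
Qed.

End Exchange.

(** * The small set of deleted edges and the final bound *)

(** A ray in [F] that stops meeting each [R i] from some point on has a tail disjoint from all of
    them, against the maximality of [m]. *)
Lemma maximal_ray_family (G : graph) (F : E G -> Prop) (k : nat) :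
  (exists r : ray G, True) -> (forall n (R : nat -> ray G), disjoint_family n R -> n <= k) ->
  exists m R, m <= k /\ disjoint_family m R /\ (forall i, i < m -> tail_in F (R i) 0) /\
    forall r', tail_in F r' 0 -> exists i, i < m /\
      forall N, exists s t, N <= s /\ N <= t /\ rv r' s = rv (R i) t.
Proof.
  intros [r0 _] Hk.
  destruct (@maximal_nat (fun m => exists R : nat -> ray G, disjoint_family m R /\
    forall i, i < m -> tail_in F (R i) 0) k) as (m & (R & HR & HF) & Hmax).
  - exists (fun _ => r0); split; [intros i j Hi; lia|intros; lia].
  - intros n (R & HR & _); eauto.
  - exists m, R; split; [eauto|]. split; auto. split; auto. intros r' Hr'. apply NNPP; intros Hno.
    destruct (@bound_on_list _ (fun i N => forall s t, N <= s -> N <= t -> rv r' s <> rv (R i) t) (seq 0 m))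
      as [N HN].
    { intros i N N' Hle H s t Hs Ht; apply H; lia. }
    { intros i Hi; apply in_seq in Hi. apply NNPP; intros Hn; apply Hno. exists i; split; [lia|].
      intros N; apply NNPP; intros Hst; apply Hn; exists N; intros s t Hs Ht E0; apply Hst; eauto 6. }
    destruct (tail_avoids_finite r' (flat_map (fun i => map (rv (R i)) (seq 0 N)) (seq 0 m))) as [n Hn].
    (* Beyond [n] the ray avoids the first [N] vertices of every [R i], and beyond [N] it avoids the
       rest. *)
    set (r1 := shift_ray r' (n + N)).
    assert (Hd : forall i, i < m -> disjoint_rays r1 (R i)).
    { intros i Hi s t E0; simpl in E0. destruct (le_lt_dec N t) as [Ht|Ht].
      - apply (HN i) with (s := n + N + s) (t := t); auto; [apply in_seq|]; lia.
      - apply (Hn (n + N + s)); [lia|]. rewrite E0. apply in_flat_map. exists i; split; [apply in_seq; lia|].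
        apply in_map, in_seq; lia. }
    apply Hmax. exists (fun i => if Nat.eq_dec i m then r1 else R i). split.
    + intros i j Hi Hj Nij. destruct (Nat.eq_dec i m), (Nat.eq_dec j m); try lia.
      * apply Hd; lia.
      * apply disjoint_rays_sym, Hd; lia.
      * apply HR; lia.
    + intros i Hi. destruct (Nat.eq_dec i m); [|apply HF; lia].
      intros s _; simpl. replace (n + N + S s) with (S (n + N + s)) by lia. apply Hr'; lia.
Qed.

Lemma nth_map_seq {A : Type} (f : nat -> A) m i d : i < m -> nth i (map f (seq 0 m)) d = f i.
Proof.
  intros Hi. rewrite nth_indep with (d' := f 0) by (rewrite length_map, length_seq; auto).
  rewrite map_nth, seq_nth; auto.
Qed.

Lemma independent_of_small_codim (G : graph) (Psi : (ray G -> Prop) -> Prop) (F : E G -> Prop) (k : nat) :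
  (forall n (R : nat -> ray G), disjoint_family n R -> n <= k) ->
  fin_indep (psi_indep Psi) F ->
  exists I l, psi_indep Psi I /\ subset I F /\ length l <= k /\ forall e, F e -> ~ I e -> In e l.
Proof.
  intros Hk HF. apply fin_indep_forest in HF.
  assert (Hrays : exists Rs, length Rs <= k /\
    (forall i j, i < j -> j < length Rs -> forall d, disjoint_rays (nth i Rs d) (nth j Rs d)) /\
    (forall r : ray G, In r Rs -> tail_in F r 0) /\
    forall r', tail_in F r' 0 -> exists r, In r Rs /\
      forall N, exists s t, N <= s /\ N <= t /\ rv r' s = rv r t).
  { destruct (classic (exists r : ray G, True)) as [Hr|Hr].
    - destruct (maximal_ray_family F Hr Hk) as (m & R & Hm & HR & Hin & Habs).
      exists (map R (seq 0 m)). rewrite length_map, length_seq. split; auto. split; [|split].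
      + intros i j Hij Hj d. rewrite !nth_map_seq by lia. apply HR; lia.
      + intros r Hin'. apply in_map_iff in Hin' as (i & <- & Hi). apply Hin. apply in_seq in Hi; lia.
      + intros r' Hr'. destruct (Habs r' Hr') as (i & Hi & H). exists (R i); split; auto.
        apply in_map, in_seq; lia.
    - exists nil. simpl. split; [lia|]. split; [intros; lia|]. split; [intros r []|].
      intros r' _; exfalso; eauto. }
  destruct Hrays as (Rs & Hlen & Hdisj & Hin & Habs).
  destruct (forest_add_rays Rs HF Hdisj Hin) as (I & HIF & HI & Htails & _ & l & Hl & Hcov).
  destruct (finitely_many_ends Hk) as [ends Hends].
  exists I, l. split; [|split; [exact HIF|split; [lia|auto]]].
  apply psi_indep_of_cuts. apply (@forest_cut G Psi I Rs ends); auto.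
  intros r' Hr'. apply Habs. intros s Hs. eapply edge_in_mono; [|apply Hr'; auto]. auto.
Qed.

Unset Implicit Arguments.

Theorem theorem5p1p1 (G : graph) (Psi : (ray G -> Prop) -> Prop) :
  ~ inf_disjoint_rays G ->
  (forall A, Psi A -> is_end A) ->
  is_matroid (psi_indep Psi) ->
  exists k : nat, nearly_finitary (psi_indep Psi) k.
Proof.
  intros Hinf _ HM.
  assert (Hk : exists k, forall n (R : nat -> ray G), disjoint_family n R -> n <= k).
  { apply NNPP; intros Hno. apply Hinf, halin. intros n. apply NNPP; intros Hn. apply Hno.
    exists n; intros m R HR. destruct (le_lt_dec m n); auto. exfalso; apply Hn; exists R.
    intros i j Hi Hj; apply HR; lia. }
  destruct Hk as [k Hk]. exists k. intros F B (HF & _ & _) HB HBF.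
  destruct (@independent_of_small_codim G Psi F k Hk HF) as (I & l & HI & HIF & Hl & Hcov).
  destruct (finite_codim HM l HI HIF Hcov HB HBF) as (l' & Hl' & Hcov').
  exists l'; split; auto; lia.
Qed.
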